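(* Let $B_1\subset\mathbb{R}^N$ be the open unit ball centered at $0$ and let $p_c<p<2^*$. There exists $\mu^{**}_p>0$ such that, for any $0<\mu<\mu^{**}_p$, the problem $$-\Delta u+\lambda u=|u|^{p-2}u\ \text{ in }B_1,\qquad u\in H_0^1(B_1),\qquad \int_{B_1}|u|^2dx=\mu$$ (with unknown $(u,\lambda)\in H_0^1(B_1)\times\mathbb{R}$) has a sign-changing solution $u_{\mathrm{sc},\mu}$ with $\lambda=\lambda_{\mathrm{sc},\mu}$. Moreover, $$\lim_{\mu\to0^+}E(u_{\mathrm{sc},\mu})=+\infty,\qquad \lim_{\mu\to0^+}\lambda_{\mathrm{sc},\mu}=+\infty.$$
   Context: $2^*=+\infty$ if $N=1,2$ and $2^*=2N/(N-2)$ if $N\ge3$; $p_c=2+4/N$. $E(u)=\frac12\int_{B_1}|\nabla u|^2dx-\frac1p\int_{B_1}|u|^pdx$. A function $u$ is sign-changing if both $\max\{u,0\}$ and $\min\{u,0\}$ are nonzero. *)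

(* Defs.v *)
From HB Require Import structures.
From mathcomp Require Import all_boot all_order all_algebra.
From mathcomp Require Import all_classical all_reals all_analysis.

Set Implicit Arguments.
Unset Strict Implicit.
Unset Printing Implicit Defensive.
Import Order.TTheory GRing.Theory Num.Theory.
Import numFieldNormedType.Exports.

Local Open Scope classical_set_scope.
Local Open Scope ring_scope.

Definition rV_coord (T : Type) (n : nat) (i : 'I_n) (v : 'rV[T]_n) : T := v 0 i.

Definition measure_rV_display : measure_display -> measure_display.
Proof. exact. Qed.

Section measurable_rV.
Context {d} {T : sigmaRingType d} (n : nat).

Let coors := @rV_coord T n.

Let rV_set0 : g_sigma_preimage coors set0.
Proof. exact: sigma_algebra0. Qed.

Let rV_setC A : g_sigma_preimage coors A -> g_sigma_preimage coors (~` A).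
Proof. exact: sigma_algebraC. Qed.

Let rV_bigcup (F : _^nat) : (forall i, g_sigma_preimage coors (F i)) ->
  g_sigma_preimage coors (\bigcup_i (F i)).
Proof. exact: sigma_algebra_bigcup. Qed.

(* The product sigma-algebra, i.e. the smallest one making the coordinates
   measurable, exactly as the library does for [n.-tuple T]. *)
HB.instance Definition _ := @isMeasurable.Build (measure_rV_display d)
  'rV[T]_n (g_sigma_preimage coors) rV_set0 rV_setC rV_bigcup.
End measurable_rV.

Lemma measurable_rV_coord d (T : measurableType d) n (i : 'I_n) :
  measurable_fun [set: 'rV[T]_n] (@rV_coord T n i).
Proof.
move=> _ Y mY; rewrite setTI; apply: sub_sigma_algebra => /=.
rewrite -bigcup_seq/=; exists i => /=; first by rewrite mem_index_enum.
by exists Y => //; rewrite setTI.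
Qed.

Lemma measurable_fun_rVP d1 d2 (T1 : measurableType d1) (T2 : measurableType d2)
    n (f : T1 -> 'rV[T2]_n) :
  (forall i, measurable_fun [set: T1] (@rV_coord T2 n i \o f)) ->
  measurable_fun [set: T1] f.
Proof.
move=> mf.
suff H : g_sigma_preimage (fun i => @rV_coord T2 n i \o f) `<=` measurable.
  by move=> _ A mA; apply: H; rewrite g_sigma_preimage_comp; exists A.
apply: smallest_sub; first exact: sigma_algebra_measurable.
rewrite -bigcup_seq; apply: bigcup_sub => i _.
by move=> A [B mB <-]; exact: mf.
Qed.

Section lebesgue_rV.
Context {R : realType}.


Definition rV_cons (n : nat) (p : R * 'rV[R]_n) : 'rV[R]_n.+1 :=
  \row_i oapp (p.2 0) p.1 (unlift ord0 i).

Definition rV_uncons (n : nat) (v : 'rV[R]_n.+1) : R * 'rV[R]_n :=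
  (v 0 ord0, \row_i v 0 (lift ord0 i)).

Lemma rV_consK n : cancel (@rV_cons n) (@rV_uncons n).
Proof.
case=> x v; congr pair => /=; first by rewrite mxE unlift_none.
by apply/rowP => i; rewrite !mxE liftK.
Qed.

Lemma measurable_rV_cons n : measurable_fun setT (@rV_cons n).
Proof.
apply: measurable_fun_rVP => i.
rewrite (_ : _ \o _ = fun p : R * 'rV[R]_n => oapp (p.2 0) p.1 (unlift ord0 i)); last first.
  by apply/funext => p /=; rewrite /rV_coord mxE.
case: (unliftP ord0 i) => [j _|_] /=.
  exact: (measurableT_comp (measurable_rV_coord j) measurable_snd).
exact: measurable_fst.
Qed.

Lemma measurable_rV_uncons n : measurable_fun setT (@rV_uncons n).
Proof.
apply/measurable_fun_pairP; split => /=.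
  exact: measurable_rV_coord.
apply: measurable_fun_rVP => i.
rewrite (_ : _ \o _ = @rV_coord R n.+1 (lift ord0 i)); last first.
  by apply/funext => p /=; rewrite /rV_coord mxE.
exact: measurable_rV_coord.
Qed.

Section step.
Variables (n : nat) (mu : {sigma_finite_measure set 'rV[R]_n -> \bar R}).

Definition lebesgue_rV_step : set 'rV[R]_n.+1 -> \bar R :=
  pushforward (@lebesgue_measure R \x mu)%E (@rV_cons n).

Let preimage_measurable A : measurable A -> measurable (@rV_cons n @^-1` A).
Proof. by move=> mA; rewrite -[X in measurable X]setTI; exact: measurable_rV_cons. Qed.

Let step0 : lebesgue_rV_step set0 = 0%E.
Proof. by rewrite /lebesgue_rV_step /pushforward preimage_set0 measure0. Qed.

Let step_ge0 A : (0 <= lebesgue_rV_step A)%E.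
Proof. exact: (measure_ge0 (@lebesgue_measure R \x mu)%E). Qed.

Let step_sigma_additive : semi_sigma_additive lebesgue_rV_step.
Proof.
move=> F mF tF mUF; rewrite /lebesgue_rV_step /pushforward preimage_bigcup.
apply: measure_semi_sigma_additive.
- by move=> k; exact: preimage_measurable.
- apply/trivIsetP => /= i j _ _ ij; rewrite -preimage_setI.
  by move/trivIsetP : tF => /(_ _ _ _ _ ij) ->//; rewrite preimage_set0.
- by rewrite -preimage_bigcup; exact: preimage_measurable.
Qed.

HB.instance Definition _ := isMeasure.Build _ _ _ lebesgue_rV_step
  step0 step_ge0 step_sigma_additive.

Let step_sigma_finite : sigma_finite setT lebesgue_rV_step.
Proof.
have /sigma_finiteP[F [FT ndF F_oo]] := sigma_finiteT (@lebesgue_measure R).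
have /sigma_finiteP[G [GT ndG G_oo]] := sigma_finiteT mu.
exists (fun k => @rV_uncons n @^-1` (F k `*` G k)).
  rewrite -preimage_bigcup (_ : \bigcup_k _ = setT) ?preimage_setT//.
  rewrite -setXTT FT GT predeqE => -[x y]; split; last first.
    move=> [/= [i _ Fix] [j _ Gjy]]; exists (maxn i j) => //; split.
    - by move: x Fix; exact/subsetPset/ndF/leq_maxl.
    - by move: y Gjy; exact/subsetPset/ndG/leq_maxr.
  by move=> [k _ []/= ? ?]; split; exists k.
move=> k; have [mF Foo] := F_oo k; have [mG Goo] := G_oo k; split.
  rewrite -[X in measurable X]setTI; apply: measurable_rV_uncons => //.
  exact: measurableX.
rewrite /lebesgue_rV_step /pushforward -comp_preimage.
rewrite (_ : _ \o _ = id); last by apply/funext => p; exact: rV_consK.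
by rewrite preimage_id product_measure1E// lte_mul_pinfty// ge0_fin_numE.
Qed.

HB.instance Definition _ := Measure_isSigmaFinite.Build _ _ _
  lebesgue_rV_step step_sigma_finite.
End step.

(* The 0-dimensional space is a point, of mass 1. *)
Fixpoint lebesgue_rV (n : nat) : {sigma_finite_measure set 'rV[R]_n -> \bar R} :=
  match n return {sigma_finite_measure set 'rV[R]_n -> \bar R} with
  | 0%N => @dirac _ 'rV[R]_0 (0 : 'rV[R]_0) R
  | n'.+1 => lebesgue_rV_step (lebesgue_rV n')
  end.
End lebesgue_rV.

Lemma lebesgue_rV_box (R : realType) (n : nat) (A : 'I_n -> set R) :
  (forall i, measurable (A i)) ->
  lebesgue_rV n [set v | forall i, A i (v 0 i)] =
  (\prod_(i < n) lebesgue_measure (A i))%E.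
Proof.
elim: n A => [|n IHn] A mA /=.
  rewrite big_ord0 diracE (_ : _ \in _) ?mem_set//= => -[].
  by [].
have mB : measurable [set v : 'rV[R]_n | forall i, A (lift ord0 i) (v 0 i)].
  rewrite [X in measurable X](_ : _ = \big[setI/setT]_(i < n)
      (@rV_coord R n i @^-1` A (lift ord0 i))); last first.
    rewrite -bigcap_seq; apply/seteqP; split => v /= Av i; first by move=> _; exact: Av.
    by apply: (Av i); rewrite /= mem_index_enum.
  apply: bigsetI_measurable => i _; rewrite -[X in measurable X]setTI.
  exact: measurable_rV_coord.
rewrite big_ord_recl -IHn// /lebesgue_rV_step /pushforward -product_measure1E//; last exact: mA.
congr (product_measure1 _ _ _); apply/seteqP; split => -[x v] /=.
  move=> Av; split; first by have := Av ord0; rewrite mxE unlift_none.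
  by move=> i; have := Av (lift ord0 i); rewrite mxE liftK.
by move=> [Ax Av] i; rewrite mxE; case: unliftP => [j|] ->.
Qed.

(* The norm of ['rV[R]_n] in the library is the sup norm; the ball of the
   theorem is the Euclidean one. *)
Definition unit_ball (R : realType) (N : nat) : set 'rV[R]_N :=
  [set x | \sum_(i < N) x 0 i ^+ 2 < 1].
Arguments unit_ball {R} N.

Lemma measurable_unit_ball (R : realType) (N : nat) :
  measurable (unit_ball N : set 'rV[R]_N).
Proof.
pose f (x : 'rV[R]_N) : R := \sum_(i < N) x 0 i ^+ 2.
have mf : measurable_fun setT f.
  apply: measurable_sum => i; apply: measurable_realfun.measurable_funX.
  exact: measurable_rV_coord.
rewrite (_ : unit_ball N = setT `&` f @^-1` `]-oo, 1[%classic); last first.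
  by rewrite setTI; apply/seteqP; split=> x /=; rewrite in_itv.
by apply: mf => //; exact: measurable_itv.
Qed.

(* Integrals over [B_1] are integrals against this measure on the whole space:
   the values outside [B_1] of the functions below are irrelevant. *)
Definition ball_measure (R : realType) (N : nat) :
    {measure set 'rV[R]_N -> \bar R} :=
  mrestr (lebesgue_rV N) (@measurable_unit_ball R N).
Arguments ball_measure {R} N.

Section sobolev.
Context {R : realType} {N : nat}.

Local Notation muB := (@ball_measure R N).

Definition partial (i : 'I_N) (f : 'rV[R]_N -> R) : 'rV[R]_N -> R :=
  fun x => 'D_(delta_mx 0 i) f x.

(* A function is smooth when all its iterated partial derivatives, of any
   order, are differentiable everywhere (hence in particular continuous). *)
Definition smooth (f : 'rV[R]_N -> R) :=
  forall (s : seq 'I_N) (x : 'rV[R]_N), differentiable (foldr partial f s) x.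

Definition test_function (f : 'rV[R]_N -> R) :=
  let supp := closure [set x | f x != 0] in
  [/\ smooth f, compact supp & supp `<=` unit_ball N].

Definition is_weak_gradient (u : 'rV[R]_N -> R) (G : 'rV[R]_N -> 'rV[R]_N) :=
  (forall i, (fun x => G x 0 i) \in Lfun muB 2%:E) /\
  (forall i phi, test_function phi ->
    \int[muB]_x (u x * partial i phi x) = - \int[muB]_x (G x 0 i * phi x)).

Definition in_H1 (u : 'rV[R]_N -> R) :=
  u \in Lfun muB 2%:E /\ exists G, is_weak_gradient u G.

(* A chosen weak gradient of a function of [H^1(B_1)]; weak gradients are
   unique up to equality almost everywhere in [B_1]. *)
Definition weak_gradient (u : 'rV[R]_N -> R) : 'rV[R]_N -> 'rV[R]_N :=
  xget (fun=> 0) [set G | is_weak_gradient u G].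

Definition dot (x y : 'rV[R]_N) : R := \sum_(i < N) x 0 i * y 0 i.

Definition norm2 (x : 'rV[R]_N) : R := dot x x.

Definition gradient (f : 'rV[R]_N -> R) : 'rV[R]_N -> 'rV[R]_N :=
  fun x => \row_i partial i f x.

(* The closure of the test functions in the norm of [H^1(B_1)]. *)
Definition in_H10 (u : 'rV[R]_N -> R) :=
  in_H1 u /\
  exists phi : nat -> 'rV[R]_N -> R,
    (forall k, test_function (phi k)) /\
    (\int[muB]_x ((u x - phi k x) ^+ 2 +
       norm2 (weak_gradient u x - gradient (phi k) x))%:E)%E
      @[k --> \oo] --> 0%E.

Definition energy (p : R) (u : 'rV[R]_N -> R) : R :=
  2^-1 * \int[muB]_x norm2 (weak_gradient u x)
  - p^-1 * \int[muB]_x (`|u x| `^ p).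

(* Weak formulation, as usual tested against all of [H^1_0(B_1)]. *)
Definition weak_solution (p lambda : R) (u : 'rV[R]_N -> R) :=
  in_H10 u /\
  forall v, in_H10 v ->
    \int[muB]_x dot (weak_gradient u x) (weak_gradient v x)
      + lambda * \int[muB]_x (u x * v x)
    = \int[muB]_x (`|u x| `^ (p - 2) * u x * v x).

Definition mass (u : 'rV[R]_N -> R) : R := \int[muB]_x (`|u x| ^+ 2).

(* The two parts are nonzero as elements of [H^1_0(B_1)], i.e. not almost
   everywhere zero. *)
Definition sign_changing (u : 'rV[R]_N -> R) :=
  ~ {ae muB, forall x, Num.max (u x) 0 = 0} /\
  ~ {ae muB, forall x, Num.min (u x) 0 = 0}.

End sobolev.

Definition critical_exponent (R : realType) (N : nat) : \bar R :=
  if (N <= 2)%N then +oo%E else (2 * N%:R / (N%:R - 2))%:E.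
Arguments critical_exponent {R} N.

Definition mass_critical_exponent (R : realType) (N : nat) : R := 2 + 4 / N%:R.
Arguments mass_critical_exponent {R} N.

(* Main.v *)
(* Radial shooting. Let [n = N - 1] and let [w] solve [w'' + (n / r) w' + |w|^(p-2) w - l w = 0],
   [w(0) = 1], [w'(0) = 0], with second zero [R]. Then [u(x) = c w(R |x|)], [c = R^(2 / (p - 2))],
   is a sign-changing solution on the unit ball with [lambda = l R^2] and with mass a multiple of
   [R^(-g) \int_0^R w^2 r^n], where [g = N - 4 / (p - 2) > 0] because [p > p_c].

   The second zero exists for [l = 0], where Pohozaev's identity with [p < 2^*] rules out slow
   decay without a change of sign, but not for [l = 2 / p]. It is continuous in [l] as long as it
   exists and unbounded as [l] approaches the first value at which it does not, while the integral
   [\int_0^R w^2 r^n] stays bounded: [w] spends a bounded time above the level below which the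
   potential energy is negative, and decays exponentially under it. By the intermediate value
   theorem the mass takes every small value, with [l] bounded away from [0], and a small mass
   forces [R], hence [lambda], to be large. Pohozaev's identity, whose boundary term is
   nonnegative, bounds the energy below by a multiple of [R^(4 / (p - 2) + 2 - N)], a positive
   power because [p < 2^*].

   The Sobolev side is reduced to one dimension: radial integrals come from the divergence theorem,
   weak gradients are unique by the fundamental lemma, and [u] is approximated in [H^1] by
   polynomials in [|x|^2] times smooth cutoffs. *)
Require Import Defs.
From mathcomp Require Import all_boot all_order all_algebra.
From mathcomp Require Import all_classical all_reals all_analysis.
From mathcomp Require Import measurable_realfun ring lra.

Set Implicit Arguments.
Unset Strict Implicit.
Unset Printing Implicit Defensive.
Import Order.TTheory GRing.Theory Num.Theory.
Import numFieldNormedType.Exports.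
Local Open Scope classical_set_scope.
Local Open Scope ring_scope.

(** Scaling leaves one free parameter. Normalising $w(0)=1$ and placing the second zero on the unit
    sphere uses up the amplitude and the radius, so that lambda and the mass become functions of $l$
    alone. The value $2/p$ is where the initial energy $1/p-l/2$ vanishes, while a second zero
    requires positive energy, which never increases along the solution. The obstacle lies at the end
    of the parameter range, where $R\to\infty$: the weight $r^n$ would make the mass integral grow
    if the negative bump drifted outward, so the bump has to be located. For $n>0$ this rests on the
    weight $r^{2n}$, which turns the energy into a quantity whose derivative contains only the
    potential. For $n=0$ that weight is trivial and a virial identity takes its place. Nothing says
    that the mass is monotone in $l$, so a given mass may be attained at any of several $l$. The
    asymptotics therefore use only bounds uniform in $l$: since $w\ge1/2$ on $[0,1/4]$, the mass
    integral is bounded below, and a small mass can come only from a large $R$. *)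

(* [lra] is slow in contexts with many universally quantified hypotheses, which it does not use. *)
Ltac order_lra := solve [repeat match goal with H : forall _, _ |- _ => clear H end; lra].
Ltac order_nra := solve [repeat match goal with H : forall _, _ |- _ => clear H end; nra].

(** * Derivatives of real functions *)

Section derive_rules.
Context {R : realType}.
Implicit Types (f g : R -> R) (x a b c : R).

(* Not a class, unlike [is_derive], so that hypotheses of this form are never discharged by
   instance resolution. *)
Definition hasD f x d := is_derive x 1 f d.

Lemma der_cst c x : hasD (fun _ : R => c) x 0.
Proof. exact: is_derive_cst. Qed.

Lemma der_id x : hasD (fun t : R => t) x 1.
Proof. exact: is_derive_id. Qed.

Lemma derD f g x a b : hasD f x a -> hasD g x b ->
  hasD (fun t => f t + g t) x (a + b).
Proof. by move=> fa gb; exact: (is_deriveD fa gb). Qed.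

Lemma derN f x a : hasD f x a -> hasD (fun t => - f t) x (- a).
Proof. by move=> fa; exact: (is_deriveN fa). Qed.

Lemma derM f g x a b : hasD f x a -> hasD g x b ->
  hasD (fun t => f t * g t) x (a * g x + f x * b).
Proof.
move=> fa gb; apply: is_derive_eq (is_deriveM fa gb) _.
by rewrite addrC /GRing.scale/= (mulrC a).
Qed.

Lemma derX n f x a : hasD f x a ->
  hasD (fun t => f t ^+ n) x (n%:R * f x ^+ n.-1 * a).
Proof.
move=> fa; have := is_deriveX n fa.
by rewrite (_ : f ^+ n = fun t => f t ^+ n)//; apply/funext => t; rewrite fctE.
Qed.

Lemma derV f x a : f x != 0 -> hasD f x a ->
  hasD (fun t => (f t)^-1) x (- (f x ^- 2) * a).
Proof. by move=> fx fa; apply: is_derive_eq (is_deriveV fx fa) _. Qed.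

Lemma der_comp f g x a b : hasD f x a -> hasD g (f x) b ->
  hasD (fun t => g (f t)) x (b * a).
Proof. by move=> fa gb; exact: (is_derive1_comp gb fa). Qed.

Lemma der_expR f x a : hasD f x a ->
  hasD (fun t => expR (f t)) x (expR (f x) * a).
Proof. by move=> fa; apply: (der_comp fa); exact: is_derive_expR. Qed.

Lemma der_powR f (q : R) x a : 0 < f x -> hasD f x a ->
  hasD (fun t => f t `^ q) x (q * f x `^ (q - 1) * a).
Proof.
move=> fx fa.
exact: (@der_comp f (fun y => y `^ q) x a _ fa (is_derive1_powR q fx)).
Qed.

Lemma der_eq f x a b : hasD f x a -> a = b -> hasD f x b.
Proof. by move=> ? <-. Qed.

Lemma der_cont f x a : hasD f x a -> {for x, continuous f}.
Proof. by move=> [df _]; apply: differentiable_continuous; apply/derivable1_diffP. Qed.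

(** For the points where the calculus rules break down, which are all origins: [pw] and [flat] at
    $0$, and radial functions at the centre of the ball. *)
Lemma hasD_eps f x a : (forall e, 0 < e -> exists2 d, 0 < d &
    forall y, `|y - x| < d -> `|f y - f x - a * (y - x)| <= e * `|y - x|) ->
  hasD f x a.
Proof.
move=> H.
have cv : h^-1 *: (f (h *: 1 + x) - f x) @[h --> (0:R)^'] --> a.
  apply/cvgrPdist_le => e /H[d d0 Hd]; exists d => //= h; rewrite /ball_/= sub0r normrN => hd h0.
  have := Hd (h *: 1 + x); rewrite addrK [h *: 1]mulr1 => /(_ hd) Hh.
  rewrite [h^-1 *: _]mulrC -(ler_pM2r (_ : 0 < `|h|)) ?normr_gt0// -normrM mulrBl divfK//.
  by rewrite distrC.
by split; [apply/cvg_ex; exists a|apply/cvg_lim => //; exact: Rhausdorff].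
Qed.

Lemma hasD_epsP f x a : hasD f x a -> forall e, 0 < e -> exists2 d, 0 < d &
  forall y, `|y - x| < d -> `|f y - f x - a * (y - x)| <= e * `|y - x|.
Proof.
move=> [df fa] e e0; have : h^-1 *: (f (h *: 1 + x) - f x) @[h --> (0:R)^'] --> a.
  by rewrite -fa; exact: df.
move=> /cvgrPdist_le /(_ e e0) [d d0 Hd]; exists d => // y yx.
have [->|yx0] := eqVneq y x; first by rewrite !subrr mulr0 subrr normr0 mulr0.
have := Hd (y - x); rewrite /ball_/= sub0r normrN subr_eq0 => /(_ yx yx0).
rewrite [(y - x) *: 1]mulr1 subrK [_^-1 *: _]mulrC.
rewrite -(ler_pM2r (_ : 0 < `|y - x|)) ?normr_gt0 ?subr_eq0// -normrM mulrBl divfK ?subr_eq0//.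
by rewrite distrC.
Qed.

End derive_rules.

Section continuity_rules.
Context {R : realType}.
Implicit Types (f g : R -> R) (x : R).

(* A rigid head constant keeps [ct_auto] from unfolding filters when a rule does not apply. *)
Definition ctat f x := {for x, continuous f}.

Lemma ctat_cont f x : ctat f x -> {for x, continuous f}. Proof. by []. Qed.

Lemma ct_hyp f x : continuous f -> ctat f x. Proof. by move=> /(_ x). Qed.

Lemma ct_cst (c : R) x : ctat (fun _ : R => c) x.
Proof. exact: cvg_cst. Qed.

Lemma ct_id x : ctat (fun t : R => t) x.
Proof. exact: cvg_id. Qed.

Lemma ctD f g x : ctat f x -> ctat g x ->
  ctat (fun t => f t + g t) x.
Proof. by move=> cf cg; exact: (cvgD cf cg). Qed.

Lemma ctN f x : ctat f x -> ctat (fun t => - f t) x.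
Proof. by move=> cf; exact: (cvgN cf). Qed.

Lemma ctM f g x : ctat f x -> ctat g x ->
  ctat (fun t => f t * g t) x.
Proof. by move=> cf cg; exact: (cvgM cf cg). Qed.

Lemma ct_comp f g x : ctat f x -> ctat g (f x) ->
  ctat (fun t => g (f t)) x.
Proof. by move=> cf cg; exact: (@continuous_comp _ _ _ f g). Qed.

Lemma ctX n f x : ctat f x -> ctat (fun t => f t ^+ n) x.
Proof. by move=> cf; exact: (@ct_comp f (fun y => y ^+ n) x cf (@exprn_continuous _ _ _)). Qed.

Lemma ct_expR f x : ctat f x -> ctat (fun t => expR (f t)) x.
Proof. by move=> cf; exact: (@ct_comp f expR x cf (der_cont (is_derive_expR _))). Qed.

End continuity_rules.

Ltac ct_step := match goal with
  | H : continuous ?h |- ctat (fun t => ?h t) _ => exact (ct_hyp H)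
  | H : continuous ?h |- ctat ?h _ => exact (ct_hyp H)
  | H : ctat ?h ?x |- ctat (fun t => ?h t) ?x => exact H
  | H : ctat ?h ?x |- ctat ?h ?x => exact H
  | |- ctat (fun _ => ?c) _ => apply ct_cst
  | |- ctat (fun t => t) _ => apply ct_id
  | |- ctat (fun t => @?f t + @?g t) _ => refine (@ctD _ f g _ _ _)
  | |- ctat (fun t => @?f t * @?g t) _ => refine (@ctM _ f g _ _ _)
  | |- ctat (fun t => - @?f t) _ => refine (@ctN _ f _ _)
  | |- ctat (fun t => @?f t ^+ ?n) _ => refine (@ctX _ n f _ _)
  | |- ctat (fun t => expR (@?f t)) _ => refine (@ct_expR _ f _ _)
  end.
Ltac ct_auto := try apply ctat_cont; repeat (ct_step; cbv beta).

Ltac der_step := first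
  [ match goal with H : hasD _ _ _ |- _ => solve [apply H] end
  | match goal with H : forall _, hasD _ _ _ |- _ => solve [apply H] end
  | apply der_cst | apply der_id | apply derX | apply derN | apply derD
  | apply derM | apply der_expR ].
Ltac der_auto := repeat der_step.

(** * Comparison by derivatives, intermediate values, primitives *)

Section monotone.
Context {R : realType}.
Implicit Types (f g df dg : R -> R) (a b x : R).

(** The derivative is asked for only in the open interval because the radial equation is singular at
    $0$. Most estimates below apply this lemma, or one of its variants, to an auxiliary function. *)
Lemma nondecr f df a b : a <= b ->
  (forall x, a <= x <= b -> {for x, continuous f}) ->
  (forall x, a < x < b -> hasD f x (df x)) ->
  (forall x, a < x < b -> 0 <= df x) -> f a <= f b.
Proof.
move=> ab cf fdf df0; move: (ab); rewrite le_eqVlt => /predU1P[->//|ltab].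
have fdf' x : x \in `]a, b[ -> hasD f x (df x) by rewrite in_itv; exact: fdf.
have cf' : {within `[a, b], continuous f}.
  by apply: continuous_in_subspaceT => x; rewrite inE/= in_itv; exact: cf.
have [c] := MVT ltab fdf' cf'; rewrite in_itv/= => cab fE.
by rewrite -subr_ge0 fE mulr_ge0 ?df0// subr_ge0.
Qed.

Lemma nonincr f df a b : a <= b ->
  (forall x, a <= x <= b -> {for x, continuous f}) ->
  (forall x, a < x < b -> hasD f x (df x)) ->
  (forall x, a < x < b -> df x <= 0) -> f b <= f a.
Proof.
move=> ab cf fdf df0; rewrite -lerN2.
have := @nondecr (fun x => - f x) (fun x => - df x) a b ab; apply.
- by move=> x xab; apply: cvgN; exact: cf.
- by move=> x xab; apply: derN; exact: fdf.
- by move=> x xab; rewrite oppr_ge0; exact: df0.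
Qed.

Lemma incr f df a b : a < b ->
  (forall x, a <= x <= b -> {for x, continuous f}) ->
  (forall x, a < x < b -> hasD f x (df x)) ->
  (forall x, a < x < b -> 0 < df x) -> f a < f b.
Proof.
move=> ltab cf fdf df0.
have fdf' x : x \in `]a, b[ -> hasD f x (df x) by rewrite in_itv; exact: fdf.
have cf' : {within `[a, b], continuous f}.
  by apply: continuous_in_subspaceT => x; rewrite inE/= in_itv; exact: cf.
have [c] := MVT ltab fdf' cf'; rewrite in_itv/= => cab fE.
by rewrite -subr_gt0 fE mulr_gt0 ?df0// subr_gt0.
Qed.

Lemma abs_incr_le f g df dg a b : a <= b ->
  (forall x, a <= x <= b -> {for x, continuous f}) ->
  (forall x, a <= x <= b -> {for x, continuous g}) ->
  (forall x, a < x < b -> hasD f x (df x)) ->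
  (forall x, a < x < b -> hasD g x (dg x)) ->
  (forall x, a < x < b -> `|df x| <= dg x) -> `|f b - f a| <= g b - g a.
Proof.
move=> ab cf cg fdf gdg dfg; rewrite ler_norml; apply/andP; split.
- have /= := @nondecr (fun t => f t + g t) (fun t => df t + dg t) a b ab.
  suff : [/\ forall x, a <= x <= b -> {for x, continuous (fun t => f t + g t)},
    forall x, a < x < b -> hasD (fun t => f t + g t) x (df x + dg x) &
    forall x, a < x < b -> 0 <= df x + dg x].
    by case=> h1 h2 h3 H; have := H h1 h2 h3; order_lra.
  split => x xab; [by apply: cvgD; [exact: cf|exact: cg]|by apply: derD; auto|].
  by have := dfg _ xab; rewrite ler_norml; order_lra.
- have /= := @nonincr (fun t => f t - g t) (fun t => df t - dg t) a b ab.
  suff : [/\ forall x, a <= x <= b -> {for x, continuous (fun t => f t - g t)},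
    forall x, a < x < b -> hasD (fun t => f t - g t) x (df x - dg x) &
    forall x, a < x < b -> df x - dg x <= 0].
    by case=> h1 h2 h3 H; have := H h1 h2 h3; order_lra.
  split => x xab; [by apply: cvgB; [exact: cf|exact: cg]|
    by apply: derD; [|apply: derN]; auto|].
  by have := dfg _ xab; rewrite ler_norml; order_lra.
Qed.

Lemma epsdelta f x : (forall e, 0 < e -> exists2 d, 0 < d &
  forall y, `|y - x| < d -> `|f y - f x| < e) -> {for x, continuous f}.
Proof.
move=> H; apply/cvgrPdist_lt => e /H[d d0 Hd].
by exists d => //= y xy; rewrite distrC; apply: Hd; rewrite distrC.
Qed.

Lemma epsdeltaP f x : {for x, continuous f} -> forall e, 0 < e ->
  exists2 d, 0 < d & forall y, `|y - x| < d -> `|f y - f x| < e.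
Proof.
move=> /cvgrPdist_lt H e /H[d /= d0 Hd].
by exists d => // y xy; rewrite distrC; apply: Hd; rewrite /= distrC.
Qed.

Lemma ivt f a b v : a <= b -> (forall x, a <= x <= b -> {for x, continuous f}) ->
  (f a <= v <= f b) || (f b <= v <= f a) -> exists2 c, a <= c <= b & f c = v.
Proof.
move=> ab cf fv.
have cf' : {within `[a, b], continuous f}.
  by apply: continuous_in_subspaceT => x; rewrite inE/= in_itv; exact: cf.
have [|c] := @IVT _ f a b v ab cf'.
  by rewrite minEle maxEle; move: fv; case: (leP (f a) (f b)) => ? /orP[] /andP[? ?];
    apply/andP; split; order_lra.
by rewrite in_itv/= => cab <-; exists c.
Qed.

Lemma der_pos_loc f x d : hasD f x d -> 0 < d -> exists2 e, 0 < e &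
  forall y, `|y - x| < e -> (x < y -> f x < f y) /\ (y < x -> f y < f x).
Proof.
move=> fd d0; have d2 : 0 < d / 2 by rewrite divr_gt0.
have [e e0 He] := hasD_epsP fd d2; exists e => // y /He H.
split => xy; move: H.
- by rewrite (gtr0_norm (_ : 0 < y - x)) ?subr_gt0// ler_norml; order_nra.
- by rewrite (ltr0_norm (_ : y - x < 0)) ?subr_lt0// ler_norml; order_nra.
Qed.

Lemma first_zero f a b : continuous f -> a <= b -> 0 < f a -> f b <= 0 ->
  exists c, [/\ a < c <= b, f c = 0 & forall x, a <= x < c -> 0 < f x].
Proof.
move=> cf ab fa fb; pose E := [set x | a <= x /\ f x <= 0].
have Eb : E b by [].
have hE : has_inf E by split; [exists b|exists a => x []].
have ai : a <= inf E by apply: lb_le_inf; [exists b|move=> x []].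
have ib : inf E <= b by apply: inf_lbound => //; exists a => x [].
have lti x : a <= x < inf E -> 0 < f x.
  move=> /andP[ax xi]; rewrite ltNge; apply/negP => fx; move: xi; rewrite ltNge => /negP; apply.
  by apply: inf_lbound => //; exists a => y [].
have fi : f (inf E) <= 0.
  rewrite leNgt; apply/negP => fi; have [d d0 Hd] := epsdeltaP (cf (inf E)) fi.
  have [x [ax fx] xd] := inf_adherent d0 hE.
  have ix : inf E <= x by apply: inf_lbound => //; exists a => y [].
  have := Hd x; rewrite ger0_norm ?subr_ge0// ltrBlDl => /(_ xd); rewrite ltr_norml.
  order_lra.
have {}ai : a < inf E.
  by rewrite lt_neqAle ai andbT; apply/eqP => ai'; move: fi; rewrite -ai' leNgt fa.
exists (inf E); split; [by rewrite ai|apply/eqP; rewrite eq_le fi/=|exact: lti].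
rewrite leNgt; apply/negP => fi0; have nfi : 0 < - f (inf E) by rewrite oppr_gt0.
have [d d0 Hd] := epsdeltaP (cf (inf E)) nfi.
pose x := Num.max a (inf E - d / 2).
have xi : x < inf E by rewrite /x gt_max ai/=; order_lra.
have ax : a <= x by rewrite /x le_max lexx.
have xd : inf E - d / 2 <= x by rewrite /x le_max lexx orbT.
have := lti x; rewrite ax xi => /(_ isT).
have := Hd x; rewrite ltr0_norm ?subr_lt0// opprB => H; have {}H := H _.
have /H : inf E - x < d by order_lra.
rewrite ltr_norml; order_lra.
Qed.

Lemma primitive_gt f n : continuous f -> 0 < n ->
  exists2 F : R -> R, F 0 = 0 & forall x, - n < x -> hasD F x (f x).
Proof.
move=> cf n0; pose F x := \int[lebesgue_measure]_(t in `[- n, x]) f t.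
exists (fun x => F x + - F 0); first by rewrite subrr.
move=> x nx.
have intf : lebesgue_measure.-integrable `[- n, x + 1] (EFin \o f).
  apply: continuous_compact_integrable; first exact: segment_compact.
  by apply: continuous_subspaceT => y; exact: cf.
have x1 : x < x + 1 by rewrite ltrDl.
have [dF F'] := continuous_FTC1_closed x1 intf nx (cf x).
have dFx : hasD F x (f x) by rewrite -F' derive1E; exact/derivableP.
by have := derD dFx (der_cst (- F 0) x); rewrite addr0.
Qed.

Lemma eq_der f g df a b : a <= b ->
  (forall x, a <= x <= b -> hasD f x (df x)) ->
  (forall x, a <= x <= b -> hasD g x (df x)) -> f b - f a = g b - g a.
Proof.
move=> ab fdf gdf.
have fgd x : a <= x <= b -> hasD (fun t => f t - g t) x 0.
  by move=> xab; rewrite -(subrr (df x)); apply: derD; [exact: fdf|apply: derN; exact: gdf].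
have dcf x : a <= x <= b -> {for x, continuous (fun t => f t - g t)}.
  by move=> /fgd; exact: der_cont.
have dfo x : a < x < b -> hasD (fun t => f t - g t) x 0.
  by move=> /andP[ax xb]; apply: fgd; rewrite !ltW.
have /= := @nondecr _ (fun=> 0) _ _ ab dcf dfo (fun _ _ => lexx 0).
have /= := @nonincr _ (fun=> 0) _ _ ab dcf dfo (fun _ _ => lexx 0).
by move=> ? ?; apply/eqP; rewrite eq_le; apply/andP; split; order_lra.
Qed.

(** The primitives based at $-n$ vanish at $0$ and have the same derivative, so two of them agree
    wherever both are defined. Picking the base according to the point glues them into one function
    on the line. *)
Lemma primitive f : continuous f ->
  exists2 F : R -> R, F 0 = 0 & forall x, hasD F x (f x).
Proof.
move=> cf.
have /choice[G HG] (n : nat) : exists F : R -> R,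
    F 0 = 0 /\ forall x, - n.+1%:R < x -> hasD F x (f x).
  by have [F F0 HF] := @primitive_gt f n.+1%:R cf (ltr0Sn _ _); exists F.
have GE m n x : - m.+1%:R < x -> - n.+1%:R < x -> G m x = G n x.
  move=> mx nx; have [m0 Hm] := HG m; have [n0 Hn] := HG n.
  have n0' k : - k.+1%:R < 0 :> R by rewrite oppr_lt0.
  have [x0|x0] := leP 0 x.
  - have := @eq_der (G m) (G n) f 0 x x0.
    rewrite m0 n0 !subr0; apply => y /andP[y0 _]; [apply: Hm|apply: Hn];
    exact: lt_le_trans y0.
  - have := @eq_der (G m) (G n) f x 0 (ltW x0).
    rewrite m0 n0 !sub0r => H; apply: oppr_inj; apply: H => y /andP[xy _];
    [apply: Hm|apply: Hn]; exact: lt_le_trans xy.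
pose k (x : R) := Num.truncn `|x|.
have kx x : - (k x).+1%:R < x.
  by rewrite ltrNl; apply: le_lt_trans (ler_norm _) _; rewrite normrN; exact: truncnS_gt.
exists (fun x => G (k x) x); first by have [] := HG (k 0).
move=> x; have [_ H] := HG (k x); apply: near_eq_is_derive (H _ (kx x)).
near=> y; apply: GE => //; near: y.
exact: lt_nbhsr.
Unshelve. all: by end_near. Qed.

End monotone.

(** * The radial initial value problem *)

Section picard.
Context {R : realType} (n : nat) (g : R -> R) (K B : R).
Hypotheses (K0 : 0 <= K) (B0 : 0 <= B)
  (gK : forall x y, `|g x - g y| <= K * `|x - y|) (gB : forall x, `|g x| <= B).

Lemma lipschitz_continuous : continuous g.
Proof.
move=> x; apply: epsdelta => e e0; exists (e / (K + 1)).
  by rewrite divr_gt0// ltr_wpDl.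
move=> y; rewrite ltr_pdivlMr ?ltr_wpDl// => yx; apply: le_lt_trans (gK _ _) _.
by apply: le_lt_trans yx; rewrite mulrC ler_wpM2l// lerDl.
Qed.

(* [picard_step phi w z]: [w 0 = 1], [w' = z] and [(r^n z)' = - r^n g (phi r)] for [r > 0], both
   [w] and [z] being extended by constants to [r <= 0]. *)
Definition picard_step (phi w z : R -> R) :=
  [/\ w 0 = 1, forall r : R, hasD w r (z r), forall r : R, r <= 0 -> z r = 0 &
   exists S : R -> R, [/\ S 0 = 0, forall r : R, hasD S r (r ^+ n * g (phi r)) &
     forall r : R, 0 < r -> z r * r ^+ n = - S r]].

Lemma primitive_bound phi S (r : R) : S 0 = 0 ->
  (forall x : R, hasD S x (x ^+ n * g (phi x))) -> 0 <= r -> `|S r| <= B * r ^+ n.+1.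
Proof.
move=> S0 dS r0; have /= := @abs_incr_le _ S (fun t => B * t ^+ n.+1)
  _ (fun t => B * (n.+1%:R * t ^+ n)) 0 r r0 _ _ (fun x _ => dS x).
rewrite S0 expr0n/= mulr0 !subr0; apply.
- by move=> x _; exact: der_cont (dS x).
- by move=> x _; apply: der_cont; der_auto.
- by move=> x _; apply: der_eq; [der_auto|rewrite /=; ring].
- move=> x /andP[x0 _]; rewrite normrM (ger0_norm (exprn_ge0 n (ltW x0))).
  rewrite mulrA [leRHS]mulrC; apply: ler_wpM2l; first exact: exprn_ge0 (ltW x0).
  by apply: le_trans (gB _) _; rewrite ler_peMr// ler1n.
Qed.

Lemma picard_step_bound phi w z (r : R) : picard_step phi w z -> 0 <= r -> `|z r| <= B * r.
Proof.
move=> [_ _ z0 [S [S0 dS Sz]]]; rewrite le_eqVlt => /predU1P[<-|r0].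
  by rewrite z0// normr0 mulr0.
have rn := exprn_gt0 n r0.
rewrite -(ler_pM2r rn) -{1}(gtr0_norm rn) -normrM Sz// normrN -mulrA -exprS.
exact: primitive_bound S0 dS (ltW r0).
Qed.

Lemma picard_step_ode phi w z (r : R) : picard_step phi w z -> 0 < r ->
  hasD z r (- (n%:R / r * z r) - g (phi r)).
Proof.
move=> [_ _ z0 [S [S0 dS Sz]]] r0; have rn0 : r ^+ n != 0 by rewrite expf_neq0// gt_eqF.
have dq : hasD (fun x => - S x * (x ^+ n)^-1) r (- (r ^+ n * g (phi r)) * (r ^+ n)^-1 +
    - S r * (- (r ^+ n) ^- 2 * (n%:R * r ^+ n.-1 * 1))).
  by apply: derM; [der_auto|apply: derV => //; der_auto].
apply: (@near_eq_is_derive _ _ _ (fun x => - S x * (x ^+ n)^-1)).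
  near=> x; have x0 : 0 < x by near: x; exact: lt_nbhsr.
  by rewrite -Sz// mulfK// expf_neq0// gt_eqF.
apply: der_eq dq _; rewrite -(Sz _ r0).
case: n rn0 => [|k] rn0; first by rewrite !expr0 invr1; ring.
rewrite /= exprS; move: rn0; rewrite exprS mulf_eq0 negb_or => /andP[r1 rk].
by field; rewrite r1 rk.
Unshelve. all: by end_near. Qed.

Lemma picard_step_continuous phi w z : picard_step phi w z -> continuous z.
Proof.
move=> H r; have [r0|r0|->] := ltgtP r 0.
- have [_ _ z0 _] := H; apply: epsdelta => e e0; exists (- r); first by rewrite oppr_gt0.
  move=> y; rewrite ltr_norml => /andP[_ yr].
  by rewrite !z0 ?subrr ?normr0//; order_lra.
- exact: der_cont (picard_step_ode H r0).
- have [_ _ z0 _] := H; apply: epsdelta => e e0; exists (e / (B + 1)).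
    by rewrite divr_gt0// ltr_wpDl.
  move=> x; rewrite subr0 (z0 0)// subr0 ltr_pdivlMr ?ltr_wpDl// => xe.
  have [x0|x0] := leP x 0; first by rewrite z0// normr0.
  apply: le_lt_trans (picard_step_bound H (ltW x0)) _; apply: le_lt_trans xe.
  by rewrite (gtr0_norm x0) mulrC ler_wpM2l ?lerDl// ltW.
Qed.

Lemma picard_step_exists phi : continuous phi ->
  exists wz : (R -> R) * (R -> R), picard_step phi wz.1 wz.2.
Proof.
move=> cphi.
have cs : continuous (fun r : R => r ^+ n * g (phi r)).
  move=> r; apply: cvgM; first exact: exprn_continuous.
  by apply: (@continuous_comp _ _ _ phi g); [exact: cphi|exact: lipschitz_continuous].
have [S S0 dS] := primitive cs.
have SB (r : R) : 0 <= r -> `|S r| <= B * r ^+ n.+1 by move=> r0; exact: primitive_bound S0 dS r0.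
pose z (r : R) := if r <= 0 then 0 else - S r / r ^+ n.
have zB (r : R) : `|z r| <= B * `|r|.
  rewrite /z; case: ifPn => [r0|]; first by rewrite normr0 mulr_ge0.
  rewrite -ltNge => r0; rewrite normrM normfV normrN.
  rewrite (ger0_norm (exprn_ge0 n (ltW r0))) ler_pdivrMr ?exprn_gt0//.
  by rewrite (gtr0_norm r0) -mulrA -exprS; apply: SB; exact: ltW.
have cz : continuous z.
  move=> r; have [r0|r0|->] := ltgtP r 0.
  - apply: epsdelta => e e0; exists (- r); first by rewrite oppr_gt0.
    move=> y; rewrite ltr_norml => /andP[_ yr].
    by rewrite /z !ifT ?subrr ?normr0//; order_lra.
  - have rn0 : r ^+ n != 0 by rewrite expf_neq0// gt_eqF.
    have dq : hasD (fun x => - S x * (x ^+ n)^-1) r (- (r ^+ n * g (phi r)) * (r ^+ n)^-1 +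
        - S r * (- (r ^+ n) ^- 2 * (n%:R * r ^+ n.-1 * 1))).
      by apply: derM; [der_auto|apply: derV => //; der_auto].
    apply: der_cont; apply: near_eq_is_derive dq; near=> x.
    by rewrite /z leNgt ifF//; apply/negbTE/negPn; near: x; exact: lt_nbhsr.
  - apply: epsdelta => e e0; exists (e / (B + 1)).
      by rewrite divr_gt0// ltr_wpDl.
    move=> x; rewrite subr0 {2}/z lexx subr0 ltr_pdivlMr ?ltr_wpDl// => xe.
    by apply: le_lt_trans (zB _) _; apply: le_lt_trans xe; rewrite mulrC ler_wpM2l// lerDl.
have [W W0 dW] := primitive cz.
exists (fun r => 1 + W r, z); split => /=.
- by rewrite W0 addr0.
- by move=> r; have := derD (der_cst 1 r) (dW r); rewrite add0r.
- by move=> r r0; rewrite /z r0.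
- exists S; split => // r r0; rewrite /z leNgt r0/= divfK// expf_neq0// gt_eqF//.
Unshelve. all: by end_near. Qed.

(** Two integrations turn $s^{2m}$ into $s^{2m+2}$: dividing the first by $r^n$ cancels the weight,
    and the denominator $m+1$ is what is kept of the second. These denominators multiply to the
    factorial that makes the iteration converge on every bounded interval. *)
Lemma picard_step_le phi w z phi' w' z' m (A T : R) : 0 <= A ->
  picard_step phi w z -> picard_step phi' w' z' ->
  (forall s : R, 0 <= s <= T -> `|phi s - phi' s| <= A * s ^+ (2 * m)) ->
  forall s : R, 0 <= s <= T -> `|w s - w' s| <= K * A / m.+1%:R * s ^+ (2 * m.+1).
Proof.
move=> A0 [w0 dw z0 [S [S0 dS Sz]]] [w'0 dw' z'0 [S' [S'0 dS' Sz']]] phiA.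
have KA : 0 <= K * A by rewrite mulr_ge0.
have dSS (s : R) : 0 <= s <= T -> `|S s - S' s| <= K * A * s ^+ (n + 2 * m).+1.
  move=> /andP[s0 sT].
  have /= := @abs_incr_le _ (fun t => S t - S' t) (fun t => K * A * t ^+ (n + 2 * m).+1)
    (fun t => t ^+ n * g (phi t) - t ^+ n * g (phi' t))
    (fun t => K * A * ((n + 2 * m).+1%:R * t ^+ (n + 2 * m))) 0 s s0.
  rewrite S0 S'0 expr0n/= mulr0 !subr0; apply.
  - by move=> x _; apply: der_cont; der_auto.
  - by move=> x _; apply: der_cont; der_auto.
  - by move=> x _; der_auto.
  - by move=> x _; apply: der_eq; [der_auto|rewrite /=; ring].
  - move=> x /andP[x0 xs]; have xn0 := exprn_ge0 n (ltW x0).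
    rewrite -mulrBr normrM (ger0_norm xn0).
    apply: (@le_trans _ _ (x ^+ n * (K * (A * x ^+ (2 * m))))).
      apply: ler_wpM2l => //; apply: le_trans (gK _ _) _; apply: ler_wpM2l => //.
      by apply: phiA; rewrite (ltW x0) (le_trans (ltW xs)).
    have -> : x ^+ n * (K * (A * x ^+ (2 * m))) = K * A * x ^+ (n + 2 * m).
      by rewrite exprD; ring.
    apply: ler_wpM2l => //; apply: ler_peMl; last by rewrite ler1n.
    exact: exprn_ge0 (ltW x0).
have dz (s : R) : 0 < s <= T -> `|z s - z' s| <= K * A * s ^+ (2 * m).+1.
  move=> /andP[s0 sT]; have sn0 := exprn_gt0 n s0.
  rewrite -(ler_pM2r sn0) -{1}(gtr0_norm sn0) -normrM mulrBl Sz// Sz'//.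
  have -> : K * A * s ^+ (2 * m).+1 * s ^+ n = K * A * s ^+ (n + 2 * m).+1.
    by rewrite -mulrA -exprD addSn addnC.
  by rewrite opprK addrC distrC; apply: dSS; rewrite (ltW s0).
move=> s /andP[s0 sT].
have /= := @abs_incr_le _ (fun t => w t - w' t) (fun t => K * A / m.+1%:R * t ^+ (2 * m.+1))
    (fun t => z t - z' t)
    (fun t => K * A / m.+1%:R * ((2 * m.+1)%:R * t ^+ (2 * m).+1)) 0 s s0.
rewrite w0 w'0 (_ : (2 * m.+1)%N = (2 * m).+2); last by rewrite mulnS.
rewrite subrr expr0n/= mulr0 !subr0; apply.
- by move=> x _; apply: der_cont; der_auto.
- by move=> x _; apply: der_cont; der_auto.
- by move=> x _; der_auto.
- by move=> x _; apply: der_eq; [der_auto|rewrite /=; ring].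
- move=> x /andP[x0 xs]; apply: le_trans (dz _ _) _.
    by rewrite x0 (le_trans (ltW xs)).
  have -> : K * A / m.+1%:R * ((2 * m).+2%:R * x ^+ (2 * m).+1) =
      2 * (K * A * x ^+ (2 * m).+1).
    have -> : (2 * m).+2%:R = 2 * m.+1%:R :> R by rewrite -natrM mulnS.
    by field; rewrite addrC natr1 pnatr_eq0.
  have : 0 <= K * A * x ^+ (2 * m).+1 by rewrite mulr_ge0// exprn_ge0// ltW.
  order_lra.
Qed.

Theorem radial_ode : exists wz : (R -> R) * (R -> R), picard_step wz.1 wz.1 wz.2.
Proof.
have cpi phi w z : picard_step phi w z -> continuous w.
  by move=> [_ dw _ _] r; exact: der_cont (dw r).
pose cfun := {phi : R -> R | continuous phi}.
have /choice[nxt Hnxt] (phi : cfun) : exists wz : cfun * (R -> R),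
    picard_step (proj1_sig phi) (proj1_sig wz.1) wz.2.
  have [[w z] /= H] := picard_step_exists (proj2_sig phi).
  by exists (exist _ w (cpi _ _ _ H), z).
pose phi0 : cfun := exist _ (fun=> 1) (@cst_continuous R R 1).
pose it := fix it k := if k is k'.+1 then (nxt (it k')).1 else phi0.
pose u k := proj1_sig (it k).
have uS k : picard_step (u k) (u k.+1) (nxt (it k)).2 by exact: Hnxt.
have d0 (s : R) : 0 <= s -> `|u 1%N s - u 0%N s| <= B * s ^+ 2.
  move=> s0; rewrite /u /=; have [w0 dw _ _] := uS 0%N.
  have /= := @abs_incr_le _ (u 1%N) (fun t => B * t ^+ 2) _ (fun t => B * (2 * t)) 0 s s0.
  rewrite w0 expr0n/= mulr0 subr0; apply.
  - by move=> x _; apply: der_cont; der_auto.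
  - by move=> x _; apply: der_cont; der_auto.
  - by move=> x _; der_auto.
  - by move=> x _; apply: der_eq; [der_auto|rewrite /=; ring].
  - move=> x /andP[x0 _]; have := picard_step_bound (uS 0%N) (ltW x0).
    by have := mulr_ge0 B0 (ltW x0); order_lra.
have du k (s : R) : 0 <= s -> `|u k.+1 s - u k s| <= B * K ^+ k / k`!%:R * s ^+ (2 * k.+1).
  elim: k s => [|k IH] s s0; first by rewrite expr0 mulr1 fact0 divr1 muln1; exact: d0.
  have Ak : 0 <= B * K ^+ k / k`!%:R by rewrite divr_ge0 ?mulr_ge0 ?exprn_ge0.
  have := @picard_step_le _ _ _ _ _ _ k.+1 _ s Ak (uS k.+1) (uS k)
    (fun x => fun H => IH x (proj1 (andP H))) s.
  rewrite s0 lexx => /(_ isT) /le_trans; apply; apply: ler_wpM2r; first exact: exprn_ge0.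
  rewrite exprS factS natrM.
  have -> : B * (K * K ^+ k) / (k.+1%:R * k`!%:R) = K * (B * K ^+ k / k`!%:R) / k.+1%:R.
    by field; rewrite !pnatr_eq0 -lt0n fact_gt0/= addrC natr1 pnatr_eq0.
  by apply: ler_wpM2l; [exact: mulr_ge0|rewrite lef_pV2 ?posrE ?ltr0Sn// ler_nat].
pose e (T : R) := exp_coeff (K * T ^+ 2).
have e0 (T : R) k : 0 <= e T k by apply: exp_coeff_ge0; rewrite mulr_ge0// sqr_ge0.
have due (T : R) k (s : R) : 0 <= s <= T -> `|u k.+1 s - u k s| <= B * T ^+ 2 * e T k.
  move=> /andP[s0 sT]; apply: le_trans (du _ _ s0) _; rewrite /e /exp_coeff/=.
  have -> : B * T ^+ 2 * ((K * T ^+ 2) ^+ k / k`!%:R) = B * K ^+ k / k`!%:R * T ^+ (2 * k.+1).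
    by rewrite exprMn -exprM mulnS exprD; ring.
  apply: ler_wpM2l; first by rewrite divr_ge0 ?mulr_ge0 ?exprn_ge0.
  by rewrite lerXn2r ?nnegrE// (le_trans s0).
(* The remainder of the exponential series: it bounds the distance from the $k$-th iterate to every
   later one, uniformly on $[0,T]$. *)
pose E (T : R) k := B * T ^+ 2 * (expR (K * T ^+ 2) - series (e T) k).
have cvE (T : R) : series (e T) @ \oo --> expR (K * T ^+ 2) by exact: is_cvg_series_exp_coeff.
have E0 (T d : R) : 0 < d -> exists k, E T k <= d.
  move=> dpos; have BT : 0 <= B * T ^+ 2 by rewrite mulr_ge0// sqr_ge0.
  have d1 : 0 < d / (B * T ^+ 2 + 1) by rewrite divr_gt0// ltr_wpDl.
  move/cvgrPdist_le : (cvE T) => /(_ _ d1) [k _ /(_ k (leqnn k)) /= Hk]; exists k.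
  apply: le_trans (ler_norm _) _; rewrite normrM (ger0_norm BT).
  move: Hk; rewrite ler_pdivlMr ?ltr_wpDl// mulrDr mulr1 [X in _ -> X <= _]mulrC.
  by have := normr_ge0 (expR (K * T ^+ 2) - series (e T) k); order_lra.
have uE (T : R) k j (s : R) : 0 <= s <= T -> `|u (k + j)%N s - u k s| <= E T k.
  move=> sT; apply: (@le_trans _ _ (B * T ^+ 2 * (series (e T) (k + j)%N - series (e T) k))).
    elim: j => [|j IH]; first by rewrite addn0 !subrr normr0 mulr0.
    have -> : u (k + j.+1)%N s - u k s =
      (u (k + j).+1 s - u (k + j)%N s) + (u (k + j)%N s - u k s) by rewrite addnS; ring.
    apply: le_trans (ler_normD _ _) _; apply: le_trans (lerD (due _ _ _ sT) IH) _.
    by rewrite -mulrDr addnS /series/= big_nat_recr//=; rewrite le_eqVlt; apply/orP; left; apply/eqP; ring.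
  apply: ler_wpM2l; first by rewrite mulr_ge0// sqr_ge0.
  rewrite lerB//; apply: nondecreasing_cvgn_le.
    by apply/nondecreasing_series => i _ _; exact: e0.
  by apply/cvg_ex; exists (expR (K * T ^+ 2)); exact: cvE.
have u0 k (s : R) : s <= 0 -> u k s = 1.
  case: k => [//|k] s0; have [w0 dw z0 _] := uS k.
  have := @eq_der _ (u k.+1) (fun=> 1) (fun=> 0) s 0 s0.
  rewrite w0 => H; suff : 1 - u k.+1 s = 1 - 1 :> R by order_lra.
  apply: H => x /andP[_ x0]; last exact: der_cst.
  by apply: der_eq (dw x) _; exact: z0.
have ucv (s : R) : cvgn (fun k => u k s).
  have [s0|s0] := leP 0 s; last first.
    by rewrite (_ : (fun k => _) = fun=> 1); [exact: is_cvg_cst|apply/funext => k; rewrite u0// ltW].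
  have : cvgn (series (telescope (fun k => u k s))).
    apply: normed_cvg.
    apply: (@series_le_cvg _ _ (fun k => B * s ^+ 2 * e s k)) => [k|k|k|].
    - exact: normr_ge0.
    - by rewrite mulr_ge0// mulr_ge0// sqr_ge0.
    - by apply: due; rewrite s0 lexx.
    - by apply: is_cvg_seriesZ; apply/cvg_ex; exists (expR (K * s ^+ 2)); exact: cvE.
  rewrite telescopeK => H.
  rewrite (_ : (fun k => u k s) = (fun k => (u k s - u 0%N s) + u 0%N s)).
    by apply: is_cvgD => //; exact: is_cvg_cst.
  by apply/funext => k; rewrite subrK.
pose phi (s : R) := limn (fun k => u k s).
have phiE (T : R) k (s : R) : 0 <= T -> s <= T -> `|phi s - u k s| <= E T k.
  move=> T0 sT; have EP : 0 <= E T k.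
    by apply: le_trans (uE T k 0%N 0 _); rewrite ?normr_ge0// lexx T0.
  have [s0|s0] := leP 0 s; last first.
    rewrite /phi (_ : (fun k => _) = fun=> 1); last by apply/funext => i; rewrite u0// ltW.
    by rewrite (lim_cst (@Rhausdorff R)) (u0 k s (ltW s0)) subrr normr0.
  apply/ler_addgt0Pr => d dpos; have /cvgrPdist_le /(_ d dpos) [M _ HM] := ucv s.
  have := HM (k + M)%N (leq_addl _ _); rewrite -/(phi s) /= => H1.
  have := uE T k M s; rewrite s0 sT => /(_ isT) H2.
  have -> : phi s - u k s = (phi s - u (k + M)%N s) + (u (k + M)%N s - u k s) by ring.
  by apply: le_trans (ler_normD _ _) _; rewrite addrC lerD.
have cphi : continuous phi.
  move=> x; apply: epsdelta => d dpos; have d4 : 0 < d / 4 by rewrite divr_gt0.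
  have T0 : 0 <= `|x| + 1 by rewrite addr_ge0.
  have [k Ek] := E0 (`|x| + 1) _ d4.
  have [w0 dw _ _] : picard_step (u k) (u k.+1) (nxt (it k)).2 by [].
  have [c c0 Hc] := epsdeltaP (proj2_sig (it k) x) d4.
  exists (Num.min c 1); first by rewrite lt_min c0 ltr01.
  move=> y; rewrite lt_min => /andP[yc y1].
  have xT : x <= `|x| + 1 by have := ler_norm x; order_lra.
  have yT : y <= `|x| + 1 by move: y1; rewrite ltr_norml; have := ler_norm x; order_lra.
  have := Hc _ yc; rewrite -/(u k) => H1.
  have H2 := phiE _ k _ T0 xT; have H3 := phiE _ k _ T0 yT.
  have -> : phi y - phi x = (phi y - u k y) + (u k y - u k x) - (phi x - u k x) by ring.
  apply: le_lt_trans (ler_normB _ _) _; apply: le_lt_trans (lerD (ler_normD _ _) (lexx _)) _.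
  by order_lra.
(* The limit [phi] comes without a slope. One more step applied to it produces one, and
   [picard_step_le] with $m=0$ shows that this step returns [phi] itself. *)
have [[w z] /= H] := picard_step_exists cphi.
suff wphi : w = phi by exists (w, z); rewrite /= wphi; rewrite wphi in H.
apply/funext => s; have [s0|s0] := leP s 0.
  rewrite /phi (_ : (fun k => _) = fun=> 1); last by apply/funext => i; rewrite u0.
  rewrite (lim_cst (@Rhausdorff R)); have [w0 dw z0 _] := H.
  have := @eq_der _ w (fun=> 1) (fun=> 0) s 0 s0.
  rewrite w0 => H'; suff : 1 - w s = 1 - 1 :> R by order_lra.
  apply: H' => x /andP[_ x0]; last exact: der_cst.
  by apply: der_eq (dw x) _; exact: z0.
apply/eqP; rewrite -subr_eq0 -normr_le0; apply/ler_addgt0Pr => d dpos; rewrite add0r.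
have T1 : 0 < K * s ^+ 2 + 1 by rewrite ltr_wpDl// mulr_ge0// sqr_ge0.
have d2 : 0 < d / (2 * (K * s ^+ 2 + 1)) by rewrite divr_gt0// mulr_gt0.
have [k Ek] := E0 s _ d2.
have EP k' : 0 <= E s k'.
  by apply: le_trans (uE s k' 0%N 0 _); rewrite ?normr_ge0// lexx ltW.
have := @picard_step_le _ _ _ _ _ _ 0 (E s k) s (EP k) H (uS k) _ s.
rewrite lexx (ltW s0) divr1 muln1 => /(_ _ isT) H1.
have {}H1 : `|w s - u k.+1 s| <= K * E s k * s ^+ 2.
  by apply: H1 => x /andP[x0 xs]; rewrite expr0 mulr1; exact: phiE (ltW s0) xs.
have H2 := phiE s k s (ltW s0) (lexx s).
have H3 : `|u k.+1 s - u k s| <= E s k.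
  by rewrite -addn1; apply: uE; rewrite (ltW s0) lexx.
have -> : w s - phi s = (w s - u k.+1 s) + (u k.+1 s - u k s) - (phi s - u k s) by ring.
apply: le_trans (ler_normB _ _) _; apply: le_trans (lerD (ler_normD _ _) (lexx _)) _.
move: Ek; rewrite ler_pdivlMr ?mulr_gt0// => Ek.
have : 0 <= E s k * (K * s ^+ 2) by rewrite mulr_ge0// mulr_ge0// sqr_ge0.
by order_nra.
Qed.

End picard.

(** * The equation and its energy *)

Section nonlinearity.
Context {R : realType}.
Implicit Types (p l x y : R).

Definition pw p x : R := `|x| `^ (p - 2) * x.

Lemma pwN p x : pw p (- x) = - pw p x.
Proof. by rewrite /pw normrN mulrN. Qed.

Lemma pw0 p : pw p 0 = 0. Proof. by rewrite /pw mulr0. Qed.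

Lemma pw1 p : pw p 1 = 1. Proof. by rewrite /pw normr1 powR1 mulr1. Qed.

Lemma pw_gt0 p x : 0 < x -> pw p x = x `^ (p - 1).
Proof.
move=> x0; rewrite /pw gtr0_norm// -[X in _ * X](powRr1 (ltW x0)) -powRD.
  by congr (_ `^ _); ring.
by rewrite (gt_eqF x0) implybT.
Qed.

Lemma der_pw p x : 2 < p -> hasD (pw p) x ((p - 1) * `|x| `^ (p - 2)).
Proof.
move=> p2; wlog x0 : x / 0 <= x.
  move=> H; have [x0|x0] := leP 0 x; first exact: H.
  have := H (- x); rewrite oppr_ge0 normrN => /(_ (ltW x0)) dp.
  have -> : pw p = fun y => - pw p (- y) by apply/funext => y; rewrite pwN opprK.
  apply: der_eq; first by apply: derN; apply: (der_comp (derN (der_id x)) dp).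
  by ring.
have p10 : 0 < p - 1 by order_lra.
have p20 : p - 2 != 0 by order_lra.
move: x0; rewrite le_eqVlt => /predU1P[<-|x0].
  rewrite normr0 powR0// mulr0; apply: hasD_eps => e e0.
  (* The radius at which $|y|^{p-2}$ reaches $e$. *)
  exists (e `^ (p - 2)^-1); first by rewrite powR_gt0.
  move=> y; rewrite subr0 pw0 subr0 mul0r subr0 /pw => ye.
  rewrite normrM norm_powR// normr_id ler_wpM2r//.
  have -> : e = (e `^ (p - 2)^-1) `^ (p - 2) by rewrite -powRrM mulVf// powRr1// ltW.
  by rewrite ge0_ler_powR ?nnegrE ?powR_ge0 ?(ltW ye)//; order_lra.
apply: (@near_eq_is_derive _ _ _ (fun t => t `^ (p - 1))).
  by near=> t; rewrite pw_gt0//; near: t; exact: lt_nbhsr.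
apply: der_eq (der_powR (p - 1) x0 (der_id x)) _.
by rewrite mulr1 gtr0_norm//; congr (_ * _ `^ _); ring.
Unshelve. all: by end_near. Qed.

Lemma powR_le1 p x : 2 < p -> `|x| <= 1 -> `|x| `^ (p - 2) <= 1.
Proof.
move=> p2 x1; have p0 : 0 <= p - 2 by order_lra.
have := @ge0_ler_powR R (p - 2) p0 `|x| 1; rewrite powR1 !nnegrE; apply => //.
Qed.

Lemma pw_lip p x y : 2 < p -> `|x| <= 1 -> `|y| <= 1 ->
  `|pw p x - pw p y| <= (p - 1) * `|x - y|.
Proof.
move=> p2; wlog yx : x y / y <= x.
  move=> H x1 y1; have [yx|xy] := leP y x; first exact: H.
  by rewrite distrC (distrC x); apply: H => //; exact: ltW.
move=> x1 y1; rewrite (ger0_norm (_ : 0 <= x - y)) ?subr_ge0//.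
have /= := @abs_incr_le _ (pw p) (fun t => (p - 1) * t) (fun t => (p - 1) * `|t| `^ (p - 2))
  (fun t => p - 1) y x yx.
rewrite -mulrBr; apply.
- by move=> t _; exact: der_cont (der_pw _ p2).
- by move=> t _; apply: der_cont; der_auto.
- by move=> t _; exact: der_pw.
- by move=> t _; apply: der_eq; [der_auto|rewrite /=; ring].
- move=> t /andP[yt tx]; rewrite normrM norm_powR// normr_id ger0_norm; last order_lra.
  rewrite ler_piMr//; first order_lra.
  by apply: powR_le1 => //; move: x1 y1; rewrite !ler_norml; order_lra.
Qed.

Definition nl p l x : R := pw p x - l * x.
(** The potential of the force [nl]. Writing $|x|^p$ as [pw p x * x] makes its derivative a product
    rule with no case distinction at $0$. *)
Definition Nl p l x : R := pw p x * x / p - l * x ^+ 2 / 2.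

Lemma nlN p l x : nl p l (- x) = - nl p l x.
Proof. by rewrite /nl pwN; ring. Qed.

Lemma NlN p l x : Nl p l (- x) = Nl p l x.
Proof. by rewrite /Nl pwN; ring. Qed.

Lemma der_Nl p l x : 2 < p -> hasD (Nl p l) x (nl p l x).
Proof.
move=> p2; have dp := der_pw x p2.
apply: der_eq; rewrite /Nl. der_auto.
by rewrite /nl /pw /=; field; order_lra.
Qed.

Lemma nl_lip p l x y : 2 < p -> 0 <= l <= 1 -> `|x| <= 1 -> `|y| <= 1 ->
  `|nl p l x - nl p l y| <= p * `|x - y|.
Proof.
move=> p2 /andP[l0 l1] x1 y1.
have -> : nl p l x - nl p l y = (pw p x - pw p y) - l * (x - y) by rewrite /nl; ring.
apply: le_trans (ler_normB _ _) _; rewrite normrM (ger0_norm l0).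
have := pw_lip p2 x1 y1; have := normr_ge0 (x - y); order_nra.
Qed.

(** Truncating the argument makes [nl] globally bounded and Lipschitz, as the Picard iteration
    requires; [sol_exists] shows that the truncation never acts. *)
Definition clamp x : R := Num.max (- 1) (Num.min x 1).

Lemma clamp_norm x : `|clamp x| <= 1.
Proof. by rewrite /clamp ler_norml; apply/andP; split; rewrite ?maxElt ?minElt; do ?case: ifPn; order_lra. Qed.

Lemma clamp_id x : `|x| <= 1 -> clamp x = x.
Proof.
by rewrite ler_norml /clamp => /andP[x1 x2]; rewrite (min_idPl _)// (max_idPr _).
Qed.

Lemma clamp_lip x y : `|clamp x - clamp y| <= `|x - y|.
Proof.
wlog yx : x y / y <= x.
  move=> H; have [yx|xy] := leP y x; first exact: H.
  by rewrite distrC (distrC x); apply: H => //; exact: ltW.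
rewrite (ger0_norm (_ : 0 <= x - y)) ?subr_ge0//.
rewrite /clamp ler_norml !maxElt !minElt; apply/andP; split; do ?case: ifPn; order_lra.
Qed.

End nonlinearity.

(** * Existence, energy and dependence on the parameter *)

Section solution.
Context {R : realType} (n : nat) (p : R).

(** The equation is asked only for $r>0$, where the damping makes sense. Freezing [w] and [z] for
    $r\le0$ keeps [w] differentiable and [z] continuous on the whole line, so no one-sided
    derivatives are needed at $0$. *)
Definition is_sol (l : R) (w z : R -> R) :=
  [/\ w 0 = 1, forall r : R, hasD w r (z r), continuous z,
    forall r : R, `|w r| <= 1 &
    forall r : R, 0 < r -> hasD z r (- (n%:R / r * z r) - nl p l (w r))]
  /\ (forall r : R, r <= 0 -> w r = 1 /\ z r = 0).

Lemma der_rnz (h : R -> R) z (r c : R) : 0 < r -> hasD z r (- (n%:R / r * z r) - c) ->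
  hasD (fun t => t ^+ n * z t) r (- (r ^+ n * c)).
Proof.
move=> r0 dz; apply: der_eq; first by der_auto.
rewrite /=; case: n => [|k]; first by rewrite !expr0 /=; ring.
by rewrite /= exprS; field; rewrite gt_eqF.
Qed.

(** The truncated problem is solved first. If $|w|$ exceeded $1$, then at the first exit radius $a$
    the energy, which starts at the potential of $\pm1$ and cannot increase, would leave $z(a)=0$.
    But at $\pm1$ the force points inward, since $l<1$, so [w] could not move out. *)
Lemma sol_exists (l : R) : 2 < p -> 0 <= l < 1 -> exists wz : (R -> R) * (R -> R), is_sol l wz.1 wz.2.
Proof.
move=> p2 /andP[l0 l1]; pose g x := nl p l (clamp x).
have l01 : 0 <= l <= 1 by rewrite l0 ltW.
have p0 : 0 <= p by order_lra.
have gK x y : `|g x - g y| <= p * `|x - y|.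
  apply: le_trans (nl_lip p2 l01 (clamp_norm _) (clamp_norm _)) _.
  by apply: ler_wpM2l; [exact: p0|exact: clamp_lip].
have gB x : `|g x| <= p.
  have := nl_lip (y := 0) p2 l01 (clamp_norm x); rewrite normr0 {2}/nl pw0 mulr0 subr0 !subr0.
  move=> /(_ ler01) /le_trans; apply; have := clamp_norm x; order_nra.
have [[w z] /= H] := radial_ode n p0 p0 gK gB.
have [w0 dw z0 _] := H; have cz := picard_step_continuous p0 gB H.
have dz (r : R) := @picard_step_ode _ _ _ _ _ _ r H.
have w10 (r : R) : r <= 0 -> w r = 1.
  move=> r0; have := @eq_der _ w (fun=> 1) (fun=> 0) r 0 r0.
  rewrite w0 => H'; suff : 1 - w r = 1 - 1 :> R by order_lra.
  apply: H' => x /andP[_ x0]; last exact: der_cst.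
  by apply: der_eq (dw x) _; exact: z0.
have cw : continuous w by move=> r; exact: der_cont (dw r).
suff w1 (r : R) : `|w r| <= 1.
  exists (w, z) => /=; split; [split => //|by move=> r r0; rewrite z0// w10].
  by move=> r r0; have := dz r r0; rewrite /g clamp_id.
pose E := [set x : R | 0 <= x /\ 1 < `|w x|].
have [//|w1] := leP `|w r| 1; exfalso.
have Er : E r.
  by split => //; rewrite leNgt; apply/negP => r0; move: w1; rewrite w10 ?normr1 ?ltxx// ltW.
have Elb : lbound E 0 by move=> x [].
have hE : has_inf E by split; [exists r|exists 0].
pose a := inf E.
have a0 : 0 <= a by apply: lb_le_inf => //; exists r.
have lta (x : R) : x < a -> `|w x| <= 1.
  move=> xa; have [x0|x0] := leP 0 x; last by rewrite w10 ?normr1// ltW.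
  by rewrite leNgt; apply/negP => wx; move: xa; rewrite ltNge => /negP; apply; apply: inf_lbound => //; exists 0.
have near_a (d : R) : 0 < d -> exists2 x, a <= x < a + d & 1 < `|w x|.
  move=> d0; have [x Ex xad] := inf_adherent d0 hE; exists x; last by case: Ex.
  by rewrite xad andbT; apply: inf_lbound => //; exists 0.
have wa1 : `|w a| = 1.
  apply/eqP; rewrite eq_le; apply/andP; split.
  - rewrite leNgt; apply/negP => wa.
    have e0 : 0 < `|w a| - 1 by order_lra.
    have [d d0 Hd] := epsdeltaP (cw a) e0.
    have := Hd (a - d / 2); have d2 : 0 < d / 2 by order_lra.
    have := lta (a - d / 2); rewrite ltrBlDr ltrDl d2 => /(_ isT) H1.
    have -> : a - d / 2 - a = - (d / 2) by ring.
    rewrite normrN gtr0_norm// => H2; have {}H2 : `|w (a - d / 2) - w a| < `|w a| - 1.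
      by apply: H2; order_lra.
    have := ler_normD (w (a - d / 2)) (- (w (a - d / 2) - w a)).
    by rewrite normrN opprB addrC subrK; order_lra.
  - rewrite leNgt; apply/negP => wa.
    have e0 : 0 < 1 - `|w a| by order_lra.
    have [d d0 Hd] := epsdeltaP (cw a) e0.
    have [x /andP[ax xad] wx] := near_a d d0.
    have := Hd x; rewrite ger0_norm ?subr_ge0// ltrBlDl => /(_ xad) H1.
    by have := ler_normD (w x - w a) (w a); rewrite subrK; order_lra.
have ltea (x : R) : x <= a -> `|w x| <= 1.
  by rewrite le_eqVlt => /predU1P[->|]; [rewrite wa1|exact: lta].
have za : z a = 0.
  have /= := @nonincr _ (fun t => z t ^+ 2 / 2 + Nl p l (w t)) (fun t => - (n%:R / t * z t ^+ 2)) 0 a a0.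
  have -> : Nl p l (w a) = Nl p l 1.
    by move: wa1; case: (ler0P (w a)) => _ <-; rewrite ?NlN.
  rewrite w0 (z0 0 (lexx 0)) expr0n/= mul0r add0r => H1.
  suff : z a ^+ 2 / 2 + Nl p l 1 <= Nl p l 1.
    move=> H2; have : z a ^+ 2 <= 0 by order_lra.
    by rewrite exprn_even_le0//= => /eqP.
  apply: H1.
  + move=> x _; apply: cvgD.
      apply: cvgMl; apply: (@continuous_comp _ _ _ z (fun y => y ^+ 2)); first exact: cz.
      exact: exprn_continuous.
    by apply: (@continuous_comp _ _ _ w (Nl p l)); [exact: cw|exact: der_cont (der_Nl _ _ p2)].
  + move=> x /andP[x0 xa]; have dzx := dz x x0.
    apply: der_eq; first by apply: derD; [der_auto|apply: der_comp (dw x) (der_Nl _ _ p2)].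
    by rewrite /g clamp_id ?ltea ?ltW//=; field; rewrite gt_eqF.
  + move=> x /andP[x0 xa]; rewrite oppr_le0 mulr_ge0// ?sqr_ge0// divr_ge0//; exact: ltW.
have g1 : 0 < w a * g (w a).
  move: wa1; rewrite /g clamp_id ?ltea//; case: (ler0P (w a)) => _ wa.
    by rewrite -[w a]opprK wa nlN /nl pw1; order_lra.
  by rewrite wa /nl pw1; order_lra.
have cg : continuous g by exact: lipschitz_continuous gK.
have cwg : {for a, continuous (fun x => w a * g (w x))}.
  by apply: cvgMr; apply: (@continuous_comp _ _ _ w g); [exact: cw|exact: cg].
(* [d1] preserves the sign of the force; [d2] keeps [w] within $1$ of [w a], so that it cannot leave
   through the opposite end of $[-1,1]$. *)
have [d1 d10 Hd1] := epsdeltaP cwg g1.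
have [d2 d20 Hd2] := epsdeltaP (cw a) ltr01.
have dd0 : 0 < Num.min d1 d2 by rewrite lt_min d10.
have [x /andP[ax xad] wx] := near_a _ dd0.
have {xad} [xd1 xd2] : x < a + d1 /\ x < a + d2.
  by move: xad; rewrite -!ltrBlDl lt_min => /andP[].
have gpos (t : R) : a < t < x -> 0 < w a * g (w t).
  move=> /andP[at_ tx]; have := Hd1 t; rewrite gtr0_norm ?subr_gt0//.
  rewrite ltr_norml => H1; have {}H1 : t - a < d1 by order_lra.
  by move: (Hd1 t); rewrite gtr0_norm ?subr_gt0// ltr_norml => /(_ H1); order_lra.
have zneg (t : R) : a < t < x -> w a * z t <= 0.
  move=> /andP[at_ tx]; have t0 : 0 < t by order_lra.
  have /= := @nonincr _ (fun s => w a * (s ^+ n * z s)) (fun s => w a * (- (s ^+ n * g (w s)))) a t (ltW at_).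
  rewrite za !mulr0 => H1; have {}H1 : w a * (t ^+ n * z t) <= 0.
    apply: H1.
    + move=> s _; apply: cvgMr; apply: cvgM; last exact: cz.
      exact: exprn_continuous.
    + move=> s /andP[as_ st]; have s0 : 0 < s by order_lra.
      apply: der_eq; first by apply: derM; [exact: der_cst|apply: der_rnz => //; exact: dz].
      by rewrite /=; ring.
    + move=> s /andP[as_ st]; have s0 : 0 < s by order_lra.
      have := gpos s; rewrite as_ (lt_trans st tx) => /(_ isT) H2.
      have := exprn_ge0 n (ltW s0) => H3.
      by rewrite mulrN oppr_le0 mulrCA mulr_ge0// ltW.
  have := exprn_gt0 n t0 => tn.
  by rewrite mulrCA pmulr_rle0 in H1.
have H1 : w a * w x <= w a * w a.
  apply: (@nonincr _ (fun s => w a * w s) (fun s => w a * z s) a x ax).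
  - by move=> s _; apply: cvgMr; exact: cw.
  - by move=> s _; apply: der_eq; [der_auto|rewrite /=; ring].
  - exact: zneg.
have := Hd2 x; rewrite ger0_norm ?subr_ge0// ltrBlDl => /(_ xd2).
rewrite ltr_norml => /andP[H2 H3].
have {wa1} : w a = 1 \/ w a = - 1 by move/eqP: wa1; rewrite eqr_norml ler01 andbT => /orP[]/eqP; [left|right].
by case=> wa; rewrite wa in H1 H2 H3; clear - wx H1 H2 H3; move: wx; case: (ler0P (w x)); order_lra.
Qed.

Section facts.
Variables (l : R) (w z : R -> R).
Hypothesis sol : is_sol l w z.

Lemma sol_w0 : w 0 = 1. Proof. by case: sol => -[]. Qed.
Lemma sol_dw r : hasD w r (z r). Proof. by case: sol => -[]. Qed.
Lemma sol_cz : continuous z. Proof. by case: sol => -[]. Qed.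
Lemma sol_cw : continuous w. Proof. by move=> r; exact: der_cont (sol_dw r). Qed.
Lemma sol_w1 (r : R) : `|w r| <= 1. Proof. by case: sol => -[]. Qed.
Lemma sol_dz (r : R) : 0 < r -> hasD z r (- (n%:R / r * z r) - nl p l (w r)).
Proof. by case: sol => -[_ _ _ _ H] _; exact: H. Qed.
Lemma sol_z0 (r : R) : r <= 0 -> z r = 0.
Proof. by case: sol => _ H /H[]. Qed.

Definition energy_at r := z r ^+ 2 / 2 + Nl p l (w r).

Lemma energy_at0 : energy_at 0 = 1 / p - l / 2.
Proof. by rewrite /energy_at sol_w0 (sol_z0 (lexx 0)) /Nl pw1 !expr2; ring. Qed.

Lemma continuous_pw q : 2 < q -> continuous (pw q : R -> R).
Proof. by move=> q2 x; exact: der_cont (der_pw _ q2). Qed.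

Lemma continuous_energy_at : 2 < p -> continuous energy_at.
Proof.
move=> p2 x; apply: cvgD.
  apply: cvgMl; apply: (@continuous_comp _ _ _ z (fun y => y ^+ 2)); first exact: sol_cz.
  exact: exprn_continuous.
by apply: (@continuous_comp _ _ _ w (Nl p l)); [exact: sol_cw|exact: der_cont (der_Nl _ _ p2)].
Qed.

Lemma der_energy_at (r : R) : 2 < p -> 0 < r -> hasD energy_at r (- (n%:R / r * z r ^+ 2)).
Proof.
move=> p2 r0; have dz := sol_dz r0.
apply: der_eq; first by apply: derD; [der_auto|apply: der_comp (sol_dw r) (der_Nl _ _ p2)].
by rewrite /=; field; rewrite gt_eqF.
Qed.

Lemma energy_at_nincr (a b : R) : 2 < p -> 0 <= a -> a <= b -> energy_at b <= energy_at a.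
Proof.
move=> p2 a0 ab; apply: (@nonincr _ _ (fun r => - (n%:R / r * z r ^+ 2)) _ _ ab).
- by move=> x _; exact: continuous_energy_at.
- by move=> x /andP[ax _]; apply: der_energy_at => //; exact: le_lt_trans ax.
- move=> x /andP[ax _]; rewrite oppr_le0 mulr_ge0 ?sqr_ge0// divr_ge0//.
  by rewrite (le_trans a0)// ltW.
Qed.

Lemma Nl_bound x : 2 < p -> 0 <= l <= 1 -> `|x| <= 1 -> - (1 / 2) <= Nl p l x.
Proof.
move=> p2 /andP[l0 l1] x1; have x2 : x ^+ 2 <= 1 by rewrite -real_normK ?num_real// expr_le1.
have := sqr_ge0 x => x20; rewrite /Nl.
have -> : pw p x * x = `|x| `^ (p - 2) * x ^+ 2 by rewrite /pw; ring.
have p0 : 0 <= p by order_lra.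
have : 0 <= `|x| `^ (p - 2) * x ^+ 2 / p by rewrite divr_ge0// mulr_ge0// powR_ge0.
have : l * x ^+ 2 <= 1 by order_nra.
order_lra.
Qed.

Lemma sol_z2 (r : R) : 2 < p -> 0 <= l <= 1 -> `|z r| <= 2.
Proof.
move=> p2 l01; have [r0|r0] := leP r 0; first by rewrite sol_z0// normr0.
have := energy_at_nincr p2 (lexx 0) (ltW r0); rewrite energy_at0 /energy_at.
have := Nl_bound p2 l01 (sol_w1 r); have /andP[l0 l1] := l01.
have : 1 / p <= 1 / 2 by rewrite ler_pdivrMr; [order_lra|order_lra].
move=> H1 H2 H3; have {H1 H2 H3} : z r ^+ 2 <= 2 ^+ 2 by rewrite (expr2 2); order_lra.
by rewrite -[z r ^+ 2]real_normK ?num_real// ler_sqr ?nnegrE.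
Qed.

Lemma nl_bound x : 2 < p -> 0 <= l <= 1 -> `|x| <= 1 -> `|nl p l x| <= 2 * `|x|.
Proof.
move=> p2 /andP[l0 l1] x1; rewrite /nl /pw -mulrBl normrM ler_wpM2r//.
by have := powR_le1 p2 x1; have := powR_ge0 `|x| (p - 2); rewrite ler_norml; order_lra.
Qed.

(* The weight compensates the damping, so that this is a backward Gronwall inequality. *)
Lemma sol_nondegenerate (a b : R) : 2 < p -> 0 <= l <= 1 -> 0 <= a -> a <= b ->
  a ^+ (2 * n) * expR (4 * a) * (w a ^+ 2 + z a ^+ 2) <=
  b ^+ (2 * n) * expR (4 * b) * (w b ^+ 2 + z b ^+ 2).
Proof.
move=> p2 l01 a0 ab; apply: (@nondecr _ (fun r => r ^+ (2 * n) * expR (4 * r) * (w r ^+ 2 + z r ^+ 2))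
  (fun r => r ^+ (2 * n) * expR (4 * r) *
   ((4 * (w r ^+ 2 + z r ^+ 2) + 2 * z r * (w r - nl p l (w r))) + 2 * n%:R / r * w r ^+ 2)) _ _ ab).
- by move=> x _; have cw := sol_cw; have cz := sol_cz; ct_auto.
- move=> r /andP[ar _]; have r0 : 0 < r by exact: le_lt_trans ar.
  have dz := sol_dz r0; have dw := sol_dw r.
  apply: der_eq; first by der_auto.
  rewrite /=; case: n => [|k]; first by rewrite muln0 /=; ring.
  have -> : (2 * k.+1)%:R = 2 * k.+1%:R :> R by rewrite natrM.
  have -> : (2 * k.+1).-1 = (2 * k).+1 by rewrite mulnS.
  have -> : r ^+ (2 * k.+1) = r * r ^+ (2 * k).+1 by rewrite -exprS mulnS.
  by field; rewrite gt_eqF.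
- move=> r /andP[ar _]; have r0 : 0 < r by exact: le_lt_trans ar.
  rewrite mulr_ge0// ?mulr_ge0 ?expR_ge0// ?exprn_ge0 ?(ltW r0)// addr_ge0//; last first.
    by rewrite mulr_ge0 ?sqr_ge0// divr_ge0 ?mulr_ge0// ltW.
  have := nl_bound p2 l01 (sol_w1 r) => H1.
  have H2 : `|w r - nl p l (w r)| <= 3 * `|w r|.
    by apply: le_trans (ler_normB _ _) _; order_lra.
  have : `|z r * (w r - nl p l (w r))| <= `|z r| * (3 * `|w r|).
    by rewrite normrM ler_wpM2l.
  rewrite ler_norml => /andP[H3 _].
  rewrite -[w r ^+ 2]real_normK ?num_real// -[z r ^+ 2]real_normK ?num_real//.
  have := sqr_ge0 (`|z r| - `|w r|); have := sqr_ge0 `|z r|; have := sqr_ge0 `|w r|.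
  rewrite sqrrB; order_lra.
Qed.

End facts.

(** Gronwall's inequality for [D], which carries the constant $(l_1-l_2)^2$ so that no forcing term
    remains. The damping, singular at $0$, enters the difference of the two equations with a
    favourable sign and is simply dropped. *)
Lemma sol_dependence (l1 l2 : R) w1 z1 w2 z2 (r : R) : 2 < p -> 0 <= l1 <= 1 -> 0 <= l2 <= 1 ->
  is_sol l1 w1 z1 -> is_sol l2 w2 z2 -> 0 <= r ->
  (w1 r - w2 r) ^+ 2 + (z1 r - z2 r) ^+ 2 <= (l1 - l2) ^+ 2 * expR ((p + 4) * r).
Proof.
move=> p2 l101 l201 s1 s2 r0.
pose D t := (w1 t - w2 t) ^+ 2 + (z1 t - z2 t) ^+ 2 + (l1 - l2) ^+ 2.
pose f1 t := nl p l1 (w1 t); pose f2 t := nl p l2 (w2 t).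
have /= := @nonincr _ (fun t => D t * expR (- (p + 4) * t))
  (fun t => expR (- (p + 4) * t) * (2 * (w1 t - w2 t) * (z1 t - z2 t)
    - 2 * (z1 t - z2 t) * (f1 t - f2 t) - 2 * n%:R / t * (z1 t - z2 t) ^+ 2
    - (p + 4) * D t)) 0 r r0.
have -> : D 0 = (l1 - l2) ^+ 2.
  rewrite /D (sol_w0 s1) (sol_w0 s2) (sol_z0 s1 (lexx 0)) (sol_z0 s2 (lexx 0)) !subrr.
  by rewrite !expr0n/= !add0r.
rewrite mulr0 expR0 mulr1 => H.
suff : D r * expR (- (p + 4) * r) <= (l1 - l2) ^+ 2.
  rewrite mulNr expRN ler_pdivrMr ?expR_gt0// /D => H1.
  by apply: le_trans H1; rewrite lerDl sqr_ge0.
apply: H.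
- move=> x _; have cw1 := sol_cw s1; have cz1 := sol_cz s1.
  by have cw2 := sol_cw s2; have cz2 := sol_cz s2; rewrite /D; ct_auto.
- move=> t /andP[t0 _]; have dz1 := sol_dz s1 t0; have dz2 := sol_dz s2 t0.
  have dw1 := sol_dw s1 t; have dw2 := sol_dw s2 t.
  apply: der_eq; first by rewrite /D; der_auto.
  by rewrite /= /D /f1 /f2; field; rewrite gt_eqF.
- move=> t /andP[t0 _]; rewrite mulr_ge0_le0 ?expR_ge0//.
  have f12 : `|f1 t - f2 t| <= p * `|w1 t - w2 t| + `|l1 - l2|.
    have -> : f1 t - f2 t = (nl p l1 (w1 t) - nl p l1 (w2 t)) - (l1 - l2) * w2 t.
      by rewrite /f1 /f2 /nl; ring.
    apply: le_trans (ler_normB _ _) _; apply: lerD.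
      by apply: nl_lip => //; [exact: sol_w1 s1 t|exact: sol_w1 s2 t].
    by rewrite normrM ler_piMr// (sol_w1 s2).
  have n0 : 0 <= 2 * n%:R / t * (z1 t - z2 t) ^+ 2.
    by rewrite mulr_ge0 ?sqr_ge0// divr_ge0 ?mulr_ge0// ltW.
  have : `|(z1 t - z2 t) * (f1 t - f2 t)| <= `|z1 t - z2 t| * (p * `|w1 t - w2 t| + `|l1 - l2|).
    by rewrite normrM ler_wpM2l.
  rewrite ler_norml => /andP[H3 _].
  have : `|(w1 t - w2 t) * (z1 t - z2 t)| <= `|w1 t - w2 t| * `|z1 t - z2 t| by rewrite normrM.
  rewrite ler_norml => /andP[_ H4].
  rewrite /D -[(w1 t - w2 t) ^+ 2]real_normK ?num_real// -[(z1 t - z2 t) ^+ 2 in X in _ - X]real_normK ?num_real//.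
  rewrite -[(l1 - l2) ^+ 2]real_normK ?num_real//.
  set a := `|w1 t - w2 t| in H4 H3 *; set b := `|z1 t - z2 t| in H4 H3 *; set c := `|l1 - l2| in H4 H3 *.
  have ab : 0 <= (a - b) ^+ 2 := sqr_ge0 _; have bc : 0 <= (b - c) ^+ 2 := sqr_ge0 _.
  have pab : 0 <= p * (a - b) ^+ 2 by rewrite mulr_ge0//; order_lra.
  have : 0 <= (p + 4) * c ^+ 2 - c ^+ 2.
    by have := sqr_ge0 c; order_nra.
  have := sqr_ge0 a; have := sqr_ge0 b; have := sqr_ge0 c.
  rewrite sqrrB in ab; rewrite sqrrB in bc; rewrite sqrrB in pab.
  order_nra.
Qed.

End solution.

(** * The first two zeros *)

Section zeros.
Context {R : realType} (n : nat) (p : R).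

(** A barrier argument: at a first zero reached from below the derivative cannot be negative. *)
Lemma no_return (y v : R -> R) (a b : R) : continuous y -> a <= b -> y a < 0 ->
  (forall x, a <= x <= b -> hasD y x (v x)) ->
  (forall x, a <= x <= b -> y x = 0 -> v x < 0) -> forall x, a <= x <= b -> y x < 0.
Proof.
move=> cy ab ya dy v0 x /andP[ax xb]; rewrite ltNge; apply/negP => yx.
have cN : continuous (fun t => - y t) by move=> t; ct_auto.
have Nya : 0 < - y a by rewrite oppr_gt0.
have Nyx : - y x <= 0 by rewrite oppr_le0.
have [c [/andP[ac cx] yc Hc]] := first_zero cN ax Nya Nyx.
have acb : a <= c <= b by rewrite (ltW ac) (le_trans cx).
have {}yc : y c = 0 by apply: oppr_inj; rewrite yc oppr0.
have vc : 0 < - v c by rewrite oppr_gt0; exact: v0.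
have [e e0 He] := der_pos_loc (derN (dy c acb)) vc.
pose t := Num.max a (c - e / 2).
have tc : t < c by rewrite /t gt_max ac/=; order_lra.
have at_ : a <= t by rewrite /t le_max lexx.
have td : c - e / 2 <= t by rewrite /t le_max lexx orbT.
have := Hc t; rewrite at_ tc => /(_ isT) Ht.
have [|_ /(_ tc)] := He t; first by rewrite ltr0_norm ?subr_lt0//; order_lra.
by rewrite yc oppr0; order_lra.
Qed.

Section one_solution.
Variables (l : R) (w z : R -> R).
Hypothesis sol : is_sol n p l w z.

Lemma sol_lower (r : R) : 2 < p -> 0 <= l <= 1 -> 0 <= r -> 1 - 2 * r <= w r.
Proof.
move=> p2 l01 r0; have := @abs_incr_le _ w (fun t => 2 * t) z (fun=> 2) 0 r r0.
rewrite (sol_w0 sol) mulr0 subr0 => H.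
have : `|w r - 1| <= 2 * r.
  apply: H.
  - by move=> x _; exact: (sol_cw sol).
  - by move=> x _; apply: der_cont; der_auto.
  - by move=> x _; exact: (sol_dw sol).
  - by move=> x _; apply: der_eq; [der_auto|rewrite /=; ring].
  - by move=> x _; exact: sol_z2 sol _ p2 l01.
by rewrite ler_norml; order_lra.
Qed.

(** The backward estimate is started at $1/4$, where $w\ge1/2$; started at $0$ it would lose
    everything to the weight $r^{2n}$. *)
Lemma sol_nondegenerate_bound (r : R) : 2 < p -> 0 <= l <= 1 -> 1 / 4 <= r ->
  (1 / 4) ^+ (2 * n) / 4 <= r ^+ (2 * n) * expR (4 * r) * (w r ^+ 2 + z r ^+ 2).
Proof.
move=> p2 l01 r4; have q0 : 0 <= 1 / 4 :> R by order_lra.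
apply: le_trans (sol_nondegenerate sol p2 l01 q0 r4).
rewrite -mulrA ler_pM2l; last by rewrite exprn_gt0//; order_lra.
have := sol_lower p2 l01 q0 => w4.
have : 1 <= expR (4 * (1 / 4)) :> R by have := expR_ge1Dx (4 * (1 / 4) : R); order_lra.
have : 1 / 4 <= w (1 / 4) ^+ 2 by rewrite expr2; order_nra.
have := sqr_ge0 (z (1 / 4)); order_nra.
Qed.

Lemma sol_neq0 (r : R) : 2 < p -> 0 <= l <= 1 -> 0 < r -> 0 < w r ^+ 2 + z r ^+ 2.
Proof.
move=> p2 l01 r0; have [r4|r4] := leP r (1 / 4).
  have := sol_lower p2 l01 (ltW r0) => w4.
  have : 1 / 4 <= w r ^+ 2 by rewrite expr2; order_nra.
  by have := sqr_ge0 (z r); order_lra.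
have := sol_nondegenerate_bound p2 l01 (ltW r4).
have q0 : 0 < (1 / 4) ^+ (2 * n) / 4 :> R by rewrite divr_gt0 ?exprn_gt0//; order_lra.
move=> /(lt_le_trans q0); rewrite pmulr_rgt0// mulr_gt0 ?expR_gt0// exprn_gt0//; order_lra.
Qed.

Lemma sol_z_init : 2 < p -> 0 <= l < 1 -> exists2 e, 0 < e & forall r, 0 < r < e -> z r < 0.
Proof.
move=> p2 /andP[l0 l1].
have cnl : continuous (fun r => nl p l (w r)).
  have cw := sol_cw sol; have cpw := @continuous_pw R p p2.
  have cpww : continuous (fun r => pw p (w r)) by move=> r; exact: (ct_comp (cw r) (cpw _)).
  by move=> r; rewrite /nl; ct_auto.
have nl1 : 0 < nl p l (w 0) by rewrite (sol_w0 sol) /nl pw1; order_lra.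
have [e e0 He] := epsdeltaP (cnl 0) nl1; exists e => // r /andP[r0 re].
have := @incr _ (fun t => - (t ^+ n * z t)) (fun t => - - (t ^+ n * nl p l (w t))) 0 r r0.
rewrite (sol_z0 sol (lexx 0)) mulr0 oppr0 oppr_gt0 pmulr_rlt0 ?exprn_gt0//; apply.
- by have cz := sol_cz sol; move=> x _; ct_auto.
- move=> x /andP[x0 xr]; apply: derN; apply: (der_rnz w) => //; exact: (sol_dz sol).
- move=> x /andP[x0 xr]; rewrite opprK mulr_gt0 ?exprn_gt0//.
  by have := He x; rewrite subr0 gtr0_norm// ltr_norml => /(_ (lt_trans xr re)); order_lra.
Qed.

Definition two_zeros (r1 r2 : R) := [/\ 0 < r1 < r2, w r1 = 0, w r2 = 0,
  forall r, 0 <= r < r1 -> 0 < w r & forall r, r1 < r < r2 -> w r < 0].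

(** The robust form of having a second zero: two strict inequalities, which survive any small
    uniform perturbation and do not mention where the zeros are. *)
Definition up_cross := exists s1 s2 : R, [/\ 0 < s1, s1 < s2, w s1 < 0 & 0 < w s2].

(** All zeros are simple by [sol_neq0], so [w] really crosses at its first zero and is negative just
    after it; the next zero then comes no later than $s_2$. *)
Lemma two_zeros_exist : 2 < p -> 0 <= l <= 1 -> up_cross -> exists r1 r2, two_zeros r1 r2.
Proof.
move=> p2 l01 [s1 [s2 [s10 s12 ws1 ws2]]].
have cw := sol_cw sol; have w00 : 0 < w 0 by rewrite (sol_w0 sol).
have [r1 [/andP[r10 r1s] wr1 Hr1]] := first_zero cw (ltW s10) w00 (ltW ws1).
have {}r1s : r1 < s1.
  by rewrite lt_neqAle r1s andbT; apply/eqP => E; move: ws1; rewrite -E wr1 ltxx.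
have zr1 : z r1 < 0.
  have := sol_neq0 p2 l01 r10; rewrite wr1 expr0n/= add0r => zr1.
  rewrite ltNge; apply/negP => zr; have {}zr1 : 0 < z r1.
    by rewrite lt_neqAle zr andbT; apply/eqP => E; move: zr1; rewrite -E expr0n/= ltxx.
  have [e e0 He] := der_pos_loc (sol_dw sol r1) zr1.
  pose t := Num.max 0 (r1 - e / 2).
  have t1 : t < r1 by rewrite /t gt_max r10/=; order_lra.
  have t0 : 0 <= t by rewrite /t le_max lexx.
  have td : r1 - e / 2 <= t by rewrite /t le_max lexx orbT.
  have := Hr1 t; rewrite t0 t1 => /(_ isT) Ht.
  have [|_ /(_ t1)] := He t; first by rewrite ltr0_norm ?subr_lt0//; order_lra.
  by rewrite wr1; order_lra.
have Nz : 0 < - z r1 by rewrite oppr_gt0.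
have [e e0 He] := der_pos_loc (derN (sol_dw sol r1)) Nz.
have wneg t : r1 < t < r1 + e -> w t < 0.
  move=> /andP[rt te]; have [|/(_ rt) + _] := He t; first by rewrite gtr0_norm ?subr_gt0//; order_lra.
  by rewrite wr1 oppr0 oppr_gt0.
pose a := Num.min s1 (r1 + e / 2).
have ar1 : r1 < a by rewrite /a lt_min r1s/=; order_lra.
have as1 : a <= s1 by rewrite /a ge_min lexx.
have are : a < r1 + e by rewrite (@le_lt_trans _ _ (r1 + e / 2))//; [rewrite /a ge_min lexx orbT|order_lra].
have cN : continuous (fun t => - w t) by move=> t; ct_auto.
have Nwa : 0 < - w a by rewrite oppr_gt0; apply: wneg; rewrite ar1.
have Nws : - w s2 <= 0 by rewrite oppr_le0 ltW.
have as2 : a <= s2 by rewrite (le_trans as1)// ltW.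
have [r2 [/andP[ar2 r2s] wr2 Hr2]] := first_zero cN as2 Nwa Nws.
exists r1, r2; split => //.
- by rewrite r10 (lt_trans ar1).
- by apply: oppr_inj; rewrite wr2 oppr0.
- move=> r /andP[rr1 rr2]; have [ra|ra] := leP a r.
    by rewrite -oppr_gt0; apply: Hr2; rewrite ra.
  by apply: wneg; rewrite rr1 (lt_trans ra).
Qed.

Section bumps.
Variables (r1 r2 : R).
Hypothesis tz : two_zeros r1 r2.

Lemma r1_gt0 : 0 < r1. Proof. by case: tz => /andP[]. Qed.
Lemma r1_lt_r2 : r1 < r2. Proof. by case: tz => /andP[]. Qed.
Lemma r2_gt0 : 0 < r2. Proof. exact: lt_trans r1_gt0 r1_lt_r2. Qed.

Lemma z_neq0 (r : R) : 2 < p -> 0 <= l <= 1 -> 0 < r -> w r = 0 -> z r != 0.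
Proof.
move=> p2 l01 r0 wr; apply/eqP => zr; have := sol_neq0 p2 l01 r0.
by rewrite wr zr expr0n/= addr0 ltxx.
Qed.

Lemma z_r2 : 2 < p -> 0 <= l <= 1 -> 0 < z r2.
Proof.
move=> p2 l01; have := z_neq0 p2 l01 r2_gt0; case: tz => _ _ wr2 _ wneg => /(_ wr2) zr2.
rewrite lt_neqAle eq_sym zr2/= leNgt; apply/negP => zr; have Nz : 0 < - z r2 by rewrite oppr_gt0.
have [e e0 He] := der_pos_loc (derN (sol_dw sol r2)) Nz.
pose t := Num.max ((r1 + r2) / 2) (r2 - e / 2); have r12 := r1_lt_r2.
have t1 : t < r2 by rewrite /t gt_max; apply/andP; split; order_lra.
have t0 : (r1 + r2) / 2 <= t by rewrite /t le_max lexx.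
have td : r2 - e / 2 <= t by rewrite /t le_max lexx orbT.
have [|_ /(_ t1)] := He t; first by rewrite ltr0_norm ?subr_lt0//; order_lra.
have := wneg t; rewrite t1 wr2 (lt_le_trans _ t0); [move=> /(_ isT); order_lra|order_lra].
Qed.

(** At the second zero only the kinetic term is left, and it is positive because the zero is simple.
    Monotonicity carries this back to all smaller radii. *)
Lemma energy_pos (r : R) : 2 < p -> 0 <= l <= 1 -> 0 <= r <= r2 -> 0 < energy_at p l w z r.
Proof.
move=> p2 l01 /andP[r0 rr]; apply: lt_le_trans (energy_at_nincr sol p2 r0 rr).
have [_ _ wr2 _ _] := tz; rewrite /energy_at wr2 /Nl pw0 mul0r expr0n/= mulr0 !mul0r subr0 addr0.
by rewrite divr_gt0// exprn_gt0// z_r2.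
Qed.

(* Where the energy is positive, every critical point of [|w|] is a strict local maximum. *)
Lemma crit_nl (r : R) : 2 < p -> 0 <= l <= 1 -> 0 <= r <= r2 -> z r = 0 ->
  0 < w r * nl p l (w r).
Proof.
move=> p2 l01 rr zr; have := energy_pos p2 l01 rr.
rewrite /energy_at zr expr0n/= mul0r add0r /Nl /nl => H.
have /andP[l0 l1] := l01; have p0 : 0 < p by order_lra.
have H1 : 0 < pw p (w r) * w r - p / 2 * (l * w r ^+ 2).
  rewrite -(pmulr_lgt0 _ (_ : 0 < p^-1)) ?invr_gt0//.
  have -> : (pw p (w r) * w r - p / 2 * (l * w r ^+ 2)) / p =
    pw p (w r) * w r / p - l * w r ^+ 2 / 2 by field; rewrite gt_eqF.
  exact: H.
have : 0 <= (p / 2 - 1) * (l * w r ^+ 2).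
    by apply: mulr_ge0; [order_lra|apply: mulr_ge0 => //; exact: sqr_ge0].
by rewrite expr2 in H1 *; order_lra.
Qed.

Lemma w_decr (r : R) : 2 < p -> 0 <= l < 1 -> 0 < r <= r1 -> z r < 0.
Proof.
move=> p2 l01 /andP[r0 rr1]; have /andP[l0 l1] := l01.
have l01' : 0 <= l <= 1 by rewrite l0 ltW.
have [e e0 He] := sol_z_init p2 l01.
pose a := Num.min r (e / 2).
have a0 : 0 < a by rewrite /a lt_min r0/=; order_lra.
have ar : a <= r by rewrite /a ge_min lexx.
have ae : a < e by rewrite (@le_lt_trans _ _ (e / 2))//; [rewrite /a ge_min lexx orbT|order_lra].
have za : z a < 0 by apply: He; rewrite a0.
apply: (@no_return z (fun t => - (n%:R / t * z t) - nl p l (w t)) a r (sol_cz sol) ar za).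
- by move=> x /andP[ax _]; apply: (sol_dz sol); exact: lt_le_trans ax.
- move=> x /andP[ax xr] zx; rewrite zx mulr0 oppr0 sub0r oppr_lt0.
  have x0 : 0 < x by exact: lt_le_trans ax.
  have xr1 : x <= r1 by exact: le_trans rr1.
  have := crit_nl p2 l01' _ zx; rewrite (ltW x0) (le_trans xr1 (ltW r1_lt_r2)) => /(_ isT).
  have [_ wr1 _ wpos _] := tz.
  move: xr1; rewrite le_eqVlt => /predU1P[E|xr1]; first by rewrite E wr1 mul0r ltxx.
  by rewrite pmulr_rgt0// wpos// (ltW x0).
- by rewrite ar lexx.
Qed.

(** At a zero of [z] where $w<0$, [crit_nl] gives $z'>0$, so [z] can cross $0$ only upward, hence
    once. *)
Lemma bump_shape : 2 < p -> 0 <= l < 1 -> exists2 rm, r1 < rm < r2 &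
  [/\ z rm = 0, forall r, r1 <= r < rm -> z r < 0 & forall r, rm < r <= r2 -> 0 < z r].
Proof.
move=> p2 l01; have /andP[l0 l1] := l01; have r12 := r1_lt_r2; have r10 := r1_gt0.
have l01' : 0 <= l <= 1 by rewrite l0 ltW.
have [_ wr1 wr2 wpos wneg] := tz; have cz := sol_cz sol.
have zr1 : z r1 < 0 by apply: w_decr => //; rewrite r10/=.
have cN : continuous (fun t => - z t) by move=> t; ct_auto.
have Nz1 : 0 < - z r1 by rewrite oppr_gt0.
have Nz2 : - z r2 <= 0 by rewrite oppr_le0 ltW// z_r2.
have [rm [/andP[r1m rm2] zrm Hm]] := first_zero cN (ltW r12) Nz1 Nz2.
have {}zrm : z rm = 0 by apply: oppr_inj; rewrite zrm oppr0.
have {}rm2 : rm < r2.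
  rewrite lt_neqAle rm2 andbT; apply/eqP => E; have := z_r2 p2 l01'.
  by rewrite -E zrm ltxx.
exists rm; first by rewrite r1m.
have crit x : r1 < x < r2 -> z x = 0 -> 0 < - (n%:R / x * z x) - nl p l (w x).
  move=> /andP[x1 x2] zx; rewrite zx mulr0 oppr0 sub0r oppr_gt0.
  have := crit_nl p2 l01' _ zx; rewrite (ltW x2) (ltW (lt_trans r10 x1)) => /(_ isT).
  by rewrite nmulr_rgt0// wneg// x1.
split => // [r rr|r /andP[mr r2r]]; first by rewrite -oppr_gt0 Hm.
have rm0 : 0 < rm by exact: lt_trans r1m.
have dm := crit rm; rewrite r1m rm2 in dm; have {}dm := dm isT zrm.
have [e e0 He] := der_pos_loc (sol_dz sol rm0) dm.
pose a := Num.min r (rm + e / 2).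
have am : rm < a by rewrite /a lt_min mr/=; order_lra.
have ar : a <= r by rewrite /a ge_min lexx.
have ae : a < rm + e by rewrite (@le_lt_trans _ _ (rm + e / 2))//; [rewrite /a ge_min lexx orbT|order_lra].
have za : - z a < 0.
  have [|/(_ am) + _] := He a; first by rewrite gtr0_norm ?subr_gt0//; order_lra.
  by rewrite zrm oppr_lt0.
rewrite -oppr_lt0.
apply: (@no_return (fun t => - z t) (fun t => - (- (n%:R / t * z t) - nl p l (w t))) a r cN ar za).
- move=> x /andP[ax _]; apply: derN; apply: (sol_dz sol).
  exact: lt_le_trans (lt_trans rm0 am) ax.
- move=> x /andP[ax xr] /(congr1 -%R); rewrite opprK oppr0 => zx; rewrite oppr_lt0.
  have xr2 : x <= r2 by exact: le_trans r2r.
  have x1 : r1 < x by rewrite (lt_trans r1m)// (lt_le_trans am).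
  move: xr2; rewrite le_eqVlt => /predU1P[E|xr2].
    by have := z_r2 p2 l01'; rewrite -E zx ltxx.
  by apply: crit => //; rewrite x1.
- by rewrite ar lexx.
Qed.

End bumps.

End one_solution.

End zeros.

(** * Continuity of the second zero *)

Section stability.
Context {R : realType} (n : nat) (p : R).
Hypothesis p2 : 2 < p.

Lemma sol_close (T e : R) : 0 <= T -> 0 < e -> exists2 d, 0 < d &
  forall (l1 l2 : R) w1 z1 w2 z2, 0 <= l1 <= 1 -> 0 <= l2 <= 1 -> `|l1 - l2| < d ->
  is_sol n p l1 w1 z1 -> is_sol n p l2 w2 z2 ->
  forall r, 0 <= r <= T -> `|w1 r - w2 r| < e /\ `|z1 r - z2 r| < e.
Proof.
move=> T0 e0; pose K := expR ((p + 4) * T); have K0 : 0 < K by exact: expR_gt0.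
exists (e / K); first by rewrite divr_gt0.
move=> l1 l2 w1 z1 w2 z2 l101 l201; rewrite ltr_pdivlMr// => l12 s1 s2 r /andP[r0 rT].
have H := sol_dependence p2 l101 l201 s1 s2 r0.
have K1 : 1 <= K.
  have pT : 0 <= (p + 4) * T by rewrite mulr_ge0//; move: p2 => ?; order_lra.
  by have := expR_ge1Dx ((p + 4) * T); rewrite /K; order_lra.
have rK : expR ((p + 4) * r) <= K.
  by rewrite ler_expR ler_wpM2l//; move: p2 => ?; order_lra.
have {}H : (w1 r - w2 r) ^+ 2 + (z1 r - z2 r) ^+ 2 < e ^+ 2.
  apply: le_lt_trans H _; apply: (@le_lt_trans _ _ ((`|l1 - l2| * K) ^+ 2)).
    rewrite exprMn real_normK ?num_real//; apply: ler_wpM2l; first exact: sqr_ge0.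
    by apply: le_trans rK _; rewrite expr2 ler_peMl// ltW.
  by rewrite ltr_sqr ?nnegrE ?mulr_ge0// ltW.
split; rewrite -ltr_sqr ?nnegrE ?(ltW e0)// real_normK ?num_real//.
- by have := sqr_ge0 (z1 r - z2 r); order_lra.
- by have := sqr_ge0 (w1 r - w2 r); order_lra.
Qed.

Lemma two_zeros_unique (w : R -> R) r1 r2 s1 s2 :
  two_zeros w r1 r2 -> two_zeros w s1 s2 -> r1 = s1 /\ r2 = s2.
Proof.
move=> [/andP[r10 r12] wr1 wr2 rp rn] [/andP[s10 s12] ws1 ws2 sp sn].
have E : r1 = s1.
  apply/eqP; rewrite eq_le; apply/andP; split; rewrite leNgt; apply/negP => H.
  - by have := rp s1; rewrite ws1 ltxx (ltW s10) H => /(_ isT).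
  - by have := sp r1; rewrite wr1 ltxx (ltW r10) H => /(_ isT).
split => //; apply/eqP; rewrite eq_le; apply/andP; split; rewrite leNgt; apply/negP => H.
- by have := rn s2; rewrite ws2 ltxx E s12 H => /(_ isT).
- by have := sn r2; rewrite wr2 ltxx -E r12 H => /(_ isT).
Qed.

Lemma two_zeros_lt (w : R -> R) r1 r2 s t : continuous w ->
  two_zeros w r1 r2 -> 0 <= s -> s < t -> w s < 0 -> 0 < w t -> r2 <= t.
Proof.
move=> cw [/andP[r10 r12] wr1 wr2 rp rn] s0 st ws wt; rewrite leNgt; apply/negP => tr.
have [tr1|tr1|tr1] := ltgtP t r1.
- by have := rp s; rewrite s0 (lt_trans st) => // /(_ isT); order_lra.
- by have := rn t; rewrite tr1 tr => /(_ isT); order_lra.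
- by move: wt; rewrite tr1 wr1 ltxx.
Qed.

(** The strict signs of [w] on both sides of $r_2$ force a nearby solution to cross before $r_2+k$.
    The point is that its second zero cannot come much earlier, for instance next to $r_1$. *)
Lemma two_zeros_stable (l : R) w z r1 r2 (e : R) : 0 <= l < 1 -> is_sol n p l w z ->
  two_zeros w r1 r2 -> 0 < e -> exists2 d, 0 < d &
  forall l' w' z', 0 <= l' <= 1 -> `|l' - l| < d -> is_sol n p l' w' z' ->
  exists s1 s2, two_zeros w' s1 s2 /\ `|s2 - r2| < e.
Proof.
move=> l01 sol tz e0; have /andP[l0 l1] := l01.
have l01' : 0 <= l <= 1 by rewrite l0 ltW.
have [/andP[r10 r12] wr1 wr2 rp rn] := tz.
have cw := sol_cw sol; have cz := sol_cz sol; have zr2 := z_r2 sol tz p2 l01'.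
have [h h0 Hh] := der_pos_loc (sol_dw sol r2) zr2.
pose k := Num.min (e / 2) (Num.min (h / 2) ((r2 - r1) / 2)).
have k0 : 0 < k by rewrite !lt_min; apply/andP; split; [order_lra|apply/andP; split; order_lra].
have ke : k <= e / 2 by rewrite /k ge_min lexx.
have kh : k <= h / 2 by rewrite /k !ge_min lexx orbT.
have kr : k <= (r2 - r1) / 2 by rewrite /k !ge_min lexx !orbT.
have wp : 0 < w (r2 + k).
  have [|+ _] := Hh (r2 + k); first by rewrite addrAC subrr add0r gtr0_norm//; order_lra.
  by rewrite wr2 ltrDl => /(_ k0).
have wm : w (r2 - k) < 0 by apply: rn; apply/andP; split; order_lra.
(* Positive on $[0,r_2-k]$: [w] vanishes there only at $r_1$, where its slope is negative. At a
   second zero of a nearby solution the function vanishes and the slope is positive, so [m] would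
   have to be small there. *)
pose m r := Num.max (`|w r|) (- z r).
have cm : {within `[0, r2 - k], continuous m}.
  apply: continuous_subspaceT => x.
  apply: (@continuous_max _ _ (fun r => `|w r|) (fun r => - z r)).
    by apply: (@continuous_comp _ _ _ w (fun y => `|y|)); [exact: cw|exact: norm_continuous].
  by ct_auto.
have r2k : 0 <= r2 - k by order_lra.
have [c] := EVT_min r2k cm; rewrite in_itv/= => /andP[c0 cr] Hc.
have mc : 0 < m c.
  rewrite /m lt_max; have [wc|wc] := eqVneq (w c) 0; last by rewrite normr_gt0 wc.
  have -> : c = r1.
    have [cr1|cr1|//] := ltgtP c r1.
    - by have := rp c; rewrite c0 cr1 wc ltxx => /(_ isT).
    - by have := rn c; rewrite cr1 wc ltxx (le_lt_trans cr) => [/(_ isT)|]//; order_lra.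
  by rewrite oppr_gt0 (w_decr sol tz) ?orbT// r10/=.
pose e1 := Num.min (m c) (Num.min (w (r2 + k)) (- w (r2 - k))).
have e10 : 0 < e1 by rewrite !lt_min mc wp oppr_gt0.
have T0 : 0 <= r2 + k by order_lra.
have [d d0 Hd] := sol_close T0 e10; exists d => // l' w' z' l'01 l'd sol'.
have {}Hd := Hd _ _ _ _ _ _ l'01 l01' l'd sol' sol.
have e1c : e1 <= m c by rewrite /e1 ge_min lexx.
have e1p : e1 <= w (r2 + k) by rewrite /e1 !ge_min lexx orbT.
have e1m : e1 <= - w (r2 - k) by rewrite /e1 !ge_min lexx !orbT.
have w'p : 0 < w' (r2 + k).
  by have [|+ _] := Hd (r2 + k); [rewrite lexx T0|rewrite ltr_norml; clear - n p2 e1p; order_lra].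
have w'm : w' (r2 - k) < 0.
  have [|+ _] := Hd (r2 - k); first by apply/andP; split; clear - n p2 r2k k0; order_lra.
  by rewrite ltr_norml; clear - n p2 e1m; order_lra.
have uc : up_cross w'.
  exists (r2 - k), (r2 + k); split => //; clear - n p2 l1 kr r10 r12 k0; order_lra.
have [s1 [s2 tz']] := two_zeros_exist sol' p2 l'01 uc; exists s1, s2; split => //.
have s2p : s2 <= r2 + k.
  by apply: (two_zeros_lt (sol_cw sol') tz' r2k _ w'm w'p); clear - n p2 k0; order_lra.
suff : r2 - k < s2 by rewrite ltr_norml; clear - n p2 s2p ke e0; order_lra.
rewrite ltNge; apply/negP => s2r.
have s20 : 0 <= s2 by rewrite ltW// (r2_gt0 tz').
have [|H1 H2] := Hd s2; first by rewrite s20 s2p.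
have := Hc s2; rewrite in_itv/= s20 s2r => /(_ isT); rewrite {2}/m le_max.
have [_ _ ws2 _ _] := tz'; move: H1; rewrite ws2 sub0r normrN => H1.
case/orP; first by clear - n p2 H1 e1c; order_lra.
by have := z_r2 sol' tz' p2 l'01; move: H2; rewrite ltr_norml; clear - n p2 e1c; order_lra.
Qed.

(** Read by contraposition: if the second zeros of nearby solutions stayed below $T$, their slopes
    there would be bounded away from $0$. Those solutions would then pass through $0$ by a definite
    amount, and so would the limit. *)
Lemma two_zeros_unbounded (l : R) w z (T : R) : 0 <= l <= 1 -> is_sol n p l w z ->
  ~ up_cross w -> exists2 d, 0 < d &
  forall l' w' z' r1 r2, 0 <= l' <= 1 -> `|l' - l| < d -> is_sol n p l' w' z' ->
  two_zeros w' r1 r2 -> T < r2.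
Proof.
move=> l01 sol nuc; pose T1 := Num.max T 1.
have T10 : 1 <= T1 by rewrite /T1 le_max lexx orbT.
have TT1 : T <= T1 by rewrite /T1 le_max lexx.
(* A lower bound for the slope at a second zero below $T_1$, from [sol_nondegenerate_bound]. The
   final division by $2$ replaces $z^2$ by $2z$, as $|z|\le2$. *)
pose c := (1 / 4) ^+ (2 * n) / 4 / (T1 ^+ (2 * n) * expR (4 * T1)) / 2 : R.
have c0 : 0 < c.
  by rewrite !divr_gt0// ?mulr_gt0 ?expR_gt0 ?exprn_gt0//; order_lra.
(* Bounds the derivative of the slope for $r\ge1/4$: the damping contributes at most $4n\cdot2$ and
   the force at most $2$. *)
pose L := 8 * n%:R + 2 : R; have L2 : 2 <= L by rewrite /L lerDr mulr_ge0.
(* The slope is at least $c$ at the zero and changes at rate at most $L$, so within distance $t$ the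
   solution moves by at least $ct/2$. The cap $1/8$ keeps $r_2-t$ above $1/4$, since $r_2\ge1/2$. *)
pose t := Num.min (c / L) (1 / 8); have t0 : 0 < t by rewrite lt_min divr_gt0//; order_lra.
have tL : L * t <= c by rewrite mulrC -ler_pdivlMr; [rewrite /t ge_min lexx|order_lra].
have t8 : t <= 1 / 8 by rewrite /t ge_min lexx orbT.
have ct : 0 < c * t / 2 by rewrite divr_gt0// mulr_gt0.
have T1' : 0 <= T1 + 1 by order_lra.
have [d d0 Hd] := sol_close T1' ct; exists d => // l' w' z' r1 r2 l'01 l'd sol' tz.
have {}Hd := Hd _ _ _ _ _ _ l'01 l01 l'd sol' sol.
rewrite ltNge; apply/negP => r2T; apply: nuc.
have [/andP[r10 r12] wr1 wr2 rp rn] := tz.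
have r20 := r2_gt0 tz.
have r2h : 1 / 2 <= r2.
  by have := sol_lower sol' p2 l'01 (ltW r20); rewrite wr2; order_lra.
have zc : c <= z' r2.
  have r4 : 1 / 4 <= r2 by order_lra.
  have := sol_nondegenerate_bound sol' p2 l'01 r4; rewrite wr2 expr0n/= add0r => H.
  have zr2 := z_r2 sol' tz p2 l'01.
  have z2 : z' r2 <= 2 by apply: le_trans (ler_norm _) (sol_z2 sol' _ p2 l'01).
  have zz : z' r2 ^+ 2 <= 2 * z' r2 by rewrite expr2 ler_wpM2r// ltW.
  have K0 : 0 < T1 ^+ (2 * n) * expR (4 * T1).
    by rewrite mulr_gt0 ?expR_gt0 ?exprn_gt0// (lt_le_trans ltr01).
  rewrite /c ler_pdivrMr// [leRHS]mulrC; apply: le_trans zz; rewrite ler_pdivrMr//.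
  apply: le_trans H _; rewrite [leRHS]mulrC; apply: ler_wpM2r; first exact: sqr_ge0.
  have r2T1 : r2 <= T1 by order_lra.
  apply: ler_pM; rewrite ?exprn_ge0 ?expR_ge0 ?(ltW r20)//.
    by rewrite lerXn2r ?nnegrE// ?(ltW r20)//; clear - n p2 T10; order_lra.
  by rewrite ler_expR; clear - n p2 r2T1; order_lra.
have zL a b : 1 / 4 <= a -> a <= b -> `|z' b - z' a| <= L * b - L * a.
  move=> a4 ab; apply: (@abs_incr_le _ z' (fun t => L * t)
      (fun r => - (n%:R / r * z' r) - nl p l' (w' r)) (fun=> L) a b ab).
  - by move=> x _; exact: (sol_cz sol').
  - by move=> x _; ct_auto.
  - by move=> x /andP[ax _]; apply: (sol_dz sol'); order_lra.
  - by move=> x _; apply: der_eq; [der_auto|rewrite /=; ring].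
  - move=> x /andP[ax _]; apply: le_trans (ler_normB _ _) _; rewrite normrN normrM /L.
    apply: lerD.
      have -> : 8 * n%:R = (4 * n%:R) * 2 :> R by ring.
      apply: ler_pM => //; last exact: sol_z2 sol' _ p2 l'01.
      have x0 : 0 < x by order_lra.
      rewrite ger0_norm ?divr_ge0 ?(ltW x0)// ler_pdivrMr//.
      have : 0 <= n%:R * (4 * x - 1) :> R by rewrite mulr_ge0//; order_lra.
      by order_lra.
    apply: le_trans (nl_bound p2 l'01 (sol_w1 sol' x)) _.
    by have := sol_w1 sol' x; order_lra.
have wp : c * t / 2 <= w' (r2 + t).
  have := @nondecr _ (fun s => w' s - c * s + L / 2 * (s - r2) ^+ 2)
    (fun s => z' s - c + L * (s - r2)) r2 (r2 + t).
  rewrite subrr expr0n/= mulr0 addr0 wr2 => H.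
  have {}H : 0 - c * r2 <= w' (r2 + t) - c * (r2 + t) + L / 2 * (r2 + t - r2) ^+ 2.
    apply: H.
    - by rewrite lerDl ltW.
    - by have cw' := sol_cw sol'; move=> x _; ct_auto.
    - have dw' := sol_dw sol'; move=> x _; apply: der_eq; first by der_auto.
      by rewrite /=; field.
    - move=> x /andP[rx xt]; have := zL r2 x; rewrite (ltW rx) => H1.
      have r4 : 1 / 4 <= r2 by order_lra.
      by have := H1 r4 isT; rewrite ler_norml; clear - n p2 zc; order_lra.
  have : r2 + t - r2 = t by ring.
  by move=> E; rewrite E in H; order_nra.
have wm : w' (r2 - t) <= - (c * t / 2).
  have := @nondecr _ (fun s => w' s - c * s - L / 2 * (r2 - s) ^+ 2)
    (fun s => z' s - c + L * (r2 - s)) (r2 - t) r2.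
  rewrite subrr expr0n/= mulr0 subr0 wr2 => H.
  have {}H : w' (r2 - t) - c * (r2 - t) - L / 2 * (r2 - (r2 - t)) ^+ 2 <= 0 - c * r2.
    apply: H.
    - by rewrite gerBl ltW.
    - by have cw' := sol_cw sol'; move=> x _; ct_auto.
    - have dw' := sol_dw sol'; move=> x _; apply: der_eq; first by der_auto.
      by rewrite /=; field.
    - move=> x /andP[rx xt]; have := zL x r2; rewrite (ltW xt) => H1.
      have r4 : 1 / 4 <= x by order_lra.
      by have := H1 r4 isT; rewrite ler_norml; clear - n p2 zc; order_lra.
  have : r2 - (r2 - t) = t by ring.
  by move=> E; rewrite E in H; order_nra.
have r2t : 0 < r2 - t by clear - n p2 r2h t8; order_lra.
exists (r2 - t), (r2 + t); split; [exact: r2t|by clear - n p2 t0; order_lra| |].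
- have [|+ _] := Hd (r2 - t); first by apply/andP; split; clear - n p2 r2t r2T TT1 t0; order_lra.
  by rewrite ltr_norml; clear - n p2 wm; order_lra.
- have [|+ _] := Hd (r2 + t); first by apply/andP; split; clear - n p2 r20 r2T TT1 t0 t8; order_lra.
  by rewrite ltr_norml; clear - n p2 wp; order_lra.
Qed.

End stability.

(** * A uniform bound on the mass integral *)

Section mass_bound.
Context {R : realType} (n : nat) (p : R).
Hypothesis p2 : 2 < p.

(* Between [(p + 2) / 4 * l] and [p / 2 * l], where the potential vanishes, the nonlinearity is
   already bounded below while the potential is still negative. *)
Definition level (l : R) : R := ((p + 2) / 4 * l) `^ (p - 2)^-1.

Lemma level_powR l : 0 <= l -> level l `^ (p - 2) = (p + 2) / 4 * l.
Proof.
move=> l0; rewrite /level -powRrM mulVf ?powRr1//; last by rewrite gt_eqF//; move: p2 => ?; lra.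
by rewrite mulr_ge0//; move: p2 => ?; lra.
Qed.

Lemma level_gt0 l : 0 < l -> 0 < level l.
Proof. by move=> l0; rewrite powR_gt0// mulr_gt0//; move: p2 => ?; lra. Qed.

Lemma level_le l l' : 0 <= l -> l <= l' -> level l <= level l'.
Proof.
move=> l0 ll'; have h := p2; rewrite /level ge0_ler_powR ?nnegrE ?invr_ge0 ?mulr_ge0//; try lra.
by rewrite ler_wpM2l//; lra.
Qed.

Lemma level_lt1 l : 0 <= l -> l < 2 / p -> level l < 1.
Proof.
move=> l0 lp; have h := p2; rewrite ltNge; apply/negP => l1.
have p20 : 0 <= p - 2 by lra.
have := @ge0_ler_powR R (p - 2) p20 1 (level l); rewrite !nnegrE ler01 powR1 level_powR//.
move=> /(_ isT (le_trans ler01 l1) l1).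
have : (p + 2) / 4 * l < (p + 2) / 4 * (2 / p) by rewrite ltr_pM2l//; lra.
have -> : (p + 2) / 4 * (2 / p) = 1 / 2 + 1 / p by field; lra.
have : 1 / p <= 1 / 2 by rewrite ler_pdivrMr; lra.
by lra.
Qed.

Lemma below_level l x : 0 <= l -> `|x| <= level l ->
  Nl p l x <= - ((p - 2) / (4 * p) * l * x ^+ 2).
Proof.
move=> l0 xl; have h := p2; have p20 : 0 <= p - 2 by lra.
have := @ge0_ler_powR R (p - 2) p20 `|x| (level l).
rewrite !nnegrE normr_ge0 (le_trans (normr_ge0 x) xl) level_powR// => /(_ isT isT xl) H.
have x2 := sqr_ge0 x.
have -> : Nl p l x = (`|x| `^ (p - 2) / p - l / 2) * x ^+ 2 by rewrite /Nl /pw; field; lra.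
have -> : - ((p - 2) / (4 * p) * l * x ^+ 2) = - ((p - 2) / (4 * p) * l) * x ^+ 2 by ring.
apply: ler_wpM2r => //.
have : `|x| `^ (p - 2) / p <= ((p + 2) / 4 * l) / p by rewrite ler_pM2r// invr_gt0; lra.
have -> : - ((p - 2) / (4 * p) * l) = ((p + 2) / 4 * l) / p - l / 2 by field; lra.
by lra.
Qed.

Lemma above_level l x : 0 <= l -> level l <= x -> (p - 2) / 4 * l * x <= nl p l x.
Proof.
move=> l0 xl; have h := p2; have p20 : 0 <= p - 2 by lra.
have x0 : 0 <= x by apply: le_trans xl; exact: powR_ge0.
have := @ge0_ler_powR R (p - 2) p20 (level l) x.
rewrite !nnegrE powR_ge0 x0 level_powR// => /(_ isT isT xl) H.
rewrite /nl /pw -mulrBl ger0_norm//; apply: ler_wpM2r => //; lra.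
Qed.

(** Without the initial condition the notion is invariant under $y\mapsto-y$, so the estimates for
    positive solutions also serve on the negative bump. *)
Definition is_ode (l : R) (y v : R -> R) := [/\ continuous v, forall r, hasD y r (v r) &
  forall r : R, 0 < r -> hasD v r (- (n%:R / r * v r) - nl p l (y r))].

Lemma sol_ode l w z : is_sol n p l w z -> is_ode l w z.
Proof. by move=> s; split; [exact: (sol_cz s)|exact: (sol_dw s)|exact: (sol_dz s)]. Qed.

Lemma ode_opp l y v : is_ode l y v -> is_ode l (fun r => - y r) (fun r => - v r).
Proof.
move=> [cv dy dv]; split => [r|r|r r0]; first by ct_auto.
- exact: derN.
- by apply: der_eq (derN (dv r r0)) _; rewrite nlN; ring.
Qed.

Section times.
Variables (l : R) (y v : R -> R) (a b c : R).
Hypotheses (yv : is_ode l y v) (a0 : 0 <= a) (ab : a <= b) (c0 : 0 <= c)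
  (nlc : forall r, a <= r <= b -> c <= nl p l (y r)).

(** The flux $r^nv$ corrected by what a constant force $c$ would take from it; it is nonincreasing
    as long as the true force is at least $c$. *)
Let Q r := r ^+ n * v r + c / n.+1%:R * r ^+ n.+1.

Let dQ r : 0 < r -> hasD Q r (r ^+ n * (c - nl p l (y r))).
Proof.
have [cv dy dv] := yv; move=> r0; apply: der_eq.
  by apply: derD; [apply: (der_rnz y) => //; exact: dv|der_auto].
by rewrite /=; field; rewrite addrC natr1 pnatr_eq0.
Qed.

Let Q_nincr r s : a <= r -> r <= s -> s <= b -> Q s <= Q r.
Proof.
have [cv dy dv] := yv.
move=> ar rs sb; apply: (@nonincr _ Q _ r s rs).
- by move=> x _; rewrite /Q; ct_auto.
- by move=> x /andP[rx xs]; apply: dQ; rewrite (le_lt_trans _ rx)// (le_trans a0).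
- move=> x /andP[rx xs]; rewrite mulr_ge0_le0 ?exprn_ge0 ?subr_le0//; last first.
    by apply: nlc; rewrite (le_trans ar (ltW rx)) (le_trans (ltW xs)).
  by rewrite (le_trans a0)// (le_trans ar)// ltW.
Qed.

Let cN : 0 <= c / n.+1%:R. Proof. by rewrite divr_ge0. Qed.

(** A force of at least $c$ makes the slope at most $-\frac{c}{n+1}(r-a)$, and the descent at least
    quadratic in time. Since [y] ranges in a bounded set, this bounds the time spent where the force
    is large. *)
Lemma descent_time : v a <= 0 -> y b + c / (2 * n.+1%:R) * (b - a) ^+ 2 <= y a.
Proof.
move=> va; have [cv dy dv] := yv.
have vle r : a < r -> r <= b -> v r <= - (c / n.+1%:R) * (r - a).
  move=> ar rb; have r0 : 0 < r by exact: le_lt_trans ar.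
  have := Q_nincr (lexx a) (ltW ar) rb; rewrite /Q => H.
  have rn : 0 < r ^+ n by exact: exprn_gt0.
  have an : a ^+ n * v a <= 0 by rewrite mulr_ge0_le0// exprn_ge0.
  have aN : a ^+ n.+1 <= a * r ^+ n.
    by rewrite exprS ler_wpM2l// lerXn2r ?nnegrE ?(ltW r0)// ltW.
  have H2 : c / n.+1%:R * a ^+ n.+1 <= c / n.+1%:R * (a * r ^+ n) by rewrite ler_wpM2l.
  rewrite -(ler_pM2l rn); move: H H2; rewrite (exprS r).
  move: (c / n.+1%:R) (r ^+ n) (a ^+ n * v a) (a ^+ n.+1) (v r) an => D E F G V F0 H H2; lra.
have := @nonincr _ (fun r => y r + c / (2 * n.+1%:R) * (r - a) ^+ 2)
  (fun r => v r + (c / n.+1%:R) * (r - a)) a b ab.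
rewrite subrr expr0n/= mulr0 addr0; apply.
- by have cy : continuous y by [move=> x; exact: der_cont (dy x)]; move=> x _; ct_auto.
- move=> x _; apply: der_eq; first by der_auto.
  by rewrite /=; field; rewrite addrC natr1 pnatr_eq0.
- by move=> x /andP[ax xb]; move: (c / n.+1%:R) (vle x ax (ltW xb)) => D; lra.
Qed.

(** The same estimate run backward from the end of the interval, where the slope is still
    nonnegative. *)
Lemma ascent_time : 0 <= v b -> y a + c / (2 * n.+1%:R) * (b - a) ^+ 2 <= y b.
Proof.
move=> vb; have [cv dy dv] := yv.
have vle r : a < r -> r <= b -> (c / n.+1%:R) * (b - r) <= v r.
  move=> ar rb; have r0 : 0 < r by exact: le_lt_trans ar.
  have := Q_nincr (ltW ar) rb (lexx b); rewrite /Q => H.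
  have rn : 0 < r ^+ n by exact: exprn_gt0.
  have b0 : 0 <= b by rewrite (le_trans (ltW r0)).
  have bn : 0 <= b ^+ n * v b by rewrite mulr_ge0// exprn_ge0.
  have bN : b * r ^+ n <= b ^+ n.+1.
    by rewrite exprS ler_wpM2l// lerXn2r ?nnegrE ?(ltW r0)// ltW.
  have H2 : c / n.+1%:R * (b * r ^+ n) <= c / n.+1%:R * b ^+ n.+1 by rewrite ler_wpM2l.
  rewrite -(ler_pM2l rn); move: H H2; rewrite (exprS r).
  move: (c / n.+1%:R) (r ^+ n) (b ^+ n * v b) (b ^+ n.+1) (v r) bn => D E F G V F0 H H2; lra.
have := @nondecr _ (fun r => y r + c / (2 * n.+1%:R) * (b - r) ^+ 2)
  (fun r => v r - (c / n.+1%:R) * (b - r)) a b ab.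
rewrite subrr expr0n/= mulr0 addr0; apply.
- by have cy : continuous y by [move=> x; exact: der_cont (dy x)]; move=> x _; ct_auto.
- move=> x _; apply: der_eq; first by der_auto.
  by rewrite /=; field; rewrite addrC natr1 pnatr_eq0.
- by move=> x /andP[ax xb]; move: (c / n.+1%:R) (vle x ax (ltW xb)) => D; lra.
Qed.

End times.

Lemma le_of_sqr_bound (c t : R) : 0 < c -> 0 <= t -> c / (2 * n.+1%:R) * t ^+ 2 <= 1 ->
  t <= 1 + 2 * n.+1%:R / c.
Proof.
move=> c0 t0 H; have n0 : 0 < 2 * n.+1%:R :> R by rewrite mulr_gt0.
have {}H : t ^+ 2 <= 2 * n.+1%:R / c.
  have -> : t ^+ 2 = (c / (2 * n.+1%:R) * t ^+ 2) * (2 * n.+1%:R / c).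
    by field; rewrite gt_eqF//= addrC natr1 pnatr_eq0.
  by rewrite ler_piMl// divr_ge0// ltW.
have [t1|t1] := leP t 1; last by apply: le_trans (_ : t <= t ^+ 2) _; [rewrite expr2; nra|lra].
have : 0 <= 2 * n.+1%:R / c by rewrite divr_ge0 ?ltW.
lra.
Qed.

(** The weight $r^{2n}$ is chosen so that its derivative cancels the damping loss exactly. Only the
    potential remains, and it is negative below the level. *)
Lemma der_weighted_energy l w z (r : R) : is_sol n p l w z -> 0 < r ->
  hasD (fun t => t ^+ (2 * n) * energy_at p l w z t) r
    ((2 * n)%:R * r ^+ (2 * n).-1 * Nl p l (w r)).
Proof.
move=> sol r0; have dE := der_energy_at sol p2 r0.
apply: der_eq; first by der_auto.
rewrite /= /energy_at; case: n => [|k]; first by rewrite !mul0r; ring.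
have -> : (2 * k.+1)%:R = 2 * k.+1%:R :> R by rewrite natrM.
have -> : (2 * k.+1).-1 = (2 * k).+1 by rewrite mulnS.
have -> : r ^+ (2 * k.+1) = r * r ^+ (2 * k).+1 by rewrite -exprS mulnS.
by field; rewrite gt_eqF.
Qed.

Section bound.
Variables (l0 l : R) (w z M : R -> R) (r1 r2 : R).
Hypotheses (l00 : 0 < l0) (l0l : l0 <= l) (lp : l < 2 / p)
  (sol : is_sol n p l w z) (tz : two_zeros w r1 r2)
  (M0 : M 0 = 0) (dM : forall r, hasD M r (r ^+ n * w r ^+ 2)).

Let l_gt0 : 0 < l. Proof. exact: lt_le_trans l0l. Qed.

Lemma l_lt1 : l < 1.
Proof. by apply: lt_trans lp _; have h := p2; rewrite ltr_pdivrMr; lra. Qed.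

Let l01 : 0 <= l < 1. Proof. by rewrite ltW//= l_lt1. Qed.
Let l01' : 0 <= l <= 1. Proof. by rewrite ltW//= ltW// l_lt1. Qed.

Lemma M_le (r : R) : 0 <= r -> M r <= r ^+ n.+1.
Proof.
move=> r0; have := @nonincr _ (fun t => M t - t ^+ n.+1)
  (fun t => t ^+ n * w t ^+ 2 - n.+1%:R * t ^+ n) 0 r r0.
rewrite M0 expr0n/= subr0 subr_le0; apply.
- have cM : continuous M by move=> x; exact: der_cont (dM x).
  by move=> x _; ct_auto.
- by move=> x _; apply: der_eq; [der_auto|rewrite /=; ring].
- move=> x /andP[x0 _]; have -> : x ^+ n * w x ^+ 2 - n.+1%:R * x ^+ n = x ^+ n * (w x ^+ 2 - n.+1%:R) by ring.
  rewrite mulr_ge0_le0 ?exprn_ge0 ?(ltW x0)// subr_le0.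
  have w1 : w x ^+ 2 <= 1 by rewrite -real_normK ?num_real// expr_le1// (sol_w1 sol).
  by apply: le_trans w1 _; rewrite ler1n.
Qed.

Lemma w_nincr1 (x y : R) : 0 <= x -> x <= y -> y <= r1 -> w y <= w x.
Proof.
move=> x0 xy yr; apply: (@nonincr _ w z x y xy).
- by move=> t _; exact: (sol_cw sol).
- by move=> t _; exact: (sol_dw sol).
- move=> t /andP[xt ty]; apply: ltW; apply: (w_decr sol tz p2 l01).
  by rewrite (le_lt_trans x0 xt) (le_trans (ltW ty)).
Qed.

Lemma first_descent : exists2 t, 0 < t < r1 & w t = level l /\
  t <= 1 + 2 * n.+1%:R / ((p - 2) / 4 * l0 * level l0).
Proof.
have [/andP[r10 r12] wr1 wr2 rp rn] := tz.
have L0 := level_gt0 l_gt0; have L1 := level_lt1 (ltW l_gt0) lp.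
have [||t /andP[t0 tr] wt] := @ivt _ w 0 r1 (level l) (ltW r10).
- by move=> x _; exact: (sol_cw sol).
- by apply/orP; right; rewrite wr1 (sol_w0 sol) !ltW.
exists t.
  rewrite !lt_neqAle t0 tr !andbT; apply/andP; split; apply/eqP => E; move: wt.
  - by rewrite -E (sol_w0 sol); lra.
  - by rewrite E wr1; lra.
(* The lower bound for the force is evaluated at [l0], which makes the time bound uniform in $l\ge
   l_0$. *)
split => //; set c := _ / 4 * l0 * _.
have h := p2.
have c0 : 0 < c by rewrite /c !mulr_gt0 ?level_gt0//; lra.
apply: le_of_sqr_bound => //.
have := @descent_time l w z 0 t c (sol_ode sol) (lexx 0) t0 (ltW c0).
rewrite (sol_z0 sol (lexx 0)) lexx subr0 (sol_w0 sol) wt => H.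
have {}H := H _ isT; apply: le_trans (_ : level l + c / (2 * n.+1%:R) * t ^+ 2 <= 1); first by rewrite lerDr ltW.
apply: H => r /andP[r0 rt].
have wr : level l <= w r by rewrite -wt w_nincr1.
apply: le_trans (above_level (ltW l_gt0) wr); rewrite /c.
have Ll := level_le (ltW l00) l0l.
apply: ler_pM => //.
- by rewrite mulr_ge0 ?(ltW l00)//; lra.
- exact: ltW (level_gt0 l00).
- by rewrite ler_wpM2l//; lra.
- exact: le_trans Ll wr.
Qed.

Section second_bump.
Variable rm : R.
Hypotheses (r1m : r1 < rm < r2) (zrm : z rm = 0)
  (zneg : forall r, r1 <= r < rm -> z r < 0) (zpos : forall r, rm < r <= r2 -> 0 < z r).

Lemma w_nincr2 (x y : R) : r1 <= x -> x <= y -> y <= rm -> w y <= w x.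
Proof.
move=> x0 xy yr; apply: (@nonincr _ w z x y xy).
- by move=> t _; exact: (sol_cw sol).
- by move=> t _; exact: (sol_dw sol).
- move=> t /andP[xt ty]; apply: ltW; apply: zneg.
  by rewrite (le_trans x0 (ltW xt)) (lt_le_trans ty).
Qed.

Lemma w_ndecr3 (x y : R) : rm <= x -> x <= y -> y <= r2 -> w x <= w y.
Proof.
move=> x0 xy yr; apply: (@nondecr _ w z x y xy).
- by move=> t _; exact: (sol_cw sol).
- by move=> t _; exact: (sol_dw sol).
- move=> t /andP[xt ty]; apply: ltW; apply: zpos.
  by rewrite (le_lt_trans x0 xt) (le_trans (ltW ty)).
Qed.

(** At the peak the energy is purely potential, and it is positive, whereas the potential is
    nonpositive at or below the level. *)
Lemma peak_above_level : w rm < - level l.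
Proof.
have /andP[r1rm rmr2] := r1m.
have [/andP[r10 r12] wr1 wr2 rp rn] := tz.
have wm : w rm < 0 by apply: rn; rewrite r1rm.
have rm0 : 0 <= rm <= r2 by rewrite (ltW rmr2) andbT ltW// (lt_trans r10).
have := energy_pos sol tz p2 l01' rm0; rewrite /energy_at zrm expr0n/= mul0r add0r => H.
rewrite ltNge; apply/negP => wl.
have := @below_level l (w rm) (ltW l_gt0); rewrite ltr0_norm// => H1.
have wl' : - w rm <= level l by lra.
have := lt_le_trans H (H1 wl'); rewrite oppr_gt0 ltNge => /negP; apply.
have h := p2; apply: mulr_ge0 (sqr_ge0 _); apply: mulr_ge0 (ltW l_gt0).
by apply: divr_ge0; lra.
Qed.

Let ivtN (a b v : R) : a <= b -> (- w a <= v <= - w b) || (- w b <= v <= - w a) ->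
  exists2 c, a <= c <= b & w c = - v.
Proof.
move=> ab H; have cw := sol_cw sol; have [] := @ivt _ (fun t => - w t) a b v ab _ H.
  by move=> x _; ct_auto.
by move=> c cab wc; exists c => //; rewrite -wc opprK.
Qed.

(** All three constants depend on [l0] only. [k0] bounds the depth of the potential well between
    half the level and the level, [c0] the force above the level, and [tau] the time of a monotone
    passage above the level. *)
Let k0 := (p - 2) / (4 * p) * l0 * (level l0 / 2) ^+ 2.
Let c0 := (p - 2) / 4 * l0 * level l0.
Let tau := 1 + 2 * n.+1%:R / c0.

Let k00 : 0 < k0.
Proof.
have h := p2; rewrite /k0 mulr_gt0 ?exprn_gt0 ?divr_gt0 ?level_gt0//.
by rewrite mulr_gt0// divr_gt0//; lra.
Qed.

Let c00 : 0 < c0.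
Proof. by have h := p2; rewrite /c0 mulr_gt0 ?level_gt0// mulr_gt0//; lra. Qed.

Let tau0 : 0 <= tau.
Proof. by rewrite /tau addr_ge0// divr_ge0// ltW. Qed.

Let L0 : level l0 <= level l. Proof. exact: level_le (ltW l00) l0l. Qed.
Let L00 : 0 < level l0. Proof. exact: level_gt0. Qed.
Let L1 : level l < 1. Proof. exact: level_lt1 (ltW l_gt0) lp. Qed.

(* Uses only the hypotheses moved to the goal; [lra] fails if a section variable is cleared. *)
Local Ltac bump_lra := clear - R n p p2 l0 l w z M r1 r2 l00 l0l lp sol tz M0 dM l_gt0 l01 l01' rm r1m zrm
  zneg zpos ivtN k0 c0 tau k00 c00 tau0 L0 L00 L1; lra.

(* The bump reaches half the level at bounded distance: the weighted energy [r ^ (2 n) H] cannot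
   increase while [|w| <= level l], and it must stay positive while [|w|] climbs from
   [level l / 2] to [level l]. *)
Lemma bump_position : (0 < n)%N -> exists a2 b2, [/\ r1 < a2 < b2, b2 < rm, w b2 = - level l,
  b2 - a2 <= k0^-1 & a2 <= 1 + tau ^+ (2 * n) * 4 / (k0 * level l0)].
Proof.
move=> n0; have /andP[r1rm rmr2] := r1m; have h := p2.
have [/andP[r10 r12] wr1 wr2 rp rn] := tz.
have pk := peak_above_level; have Ll0 := level_gt0 l_gt0.
have [|b2 /andP[rb2 b2m] wb2] := @ivtN r1 rm (level l) (ltW r1rm).
  by apply/orP; left; apply/andP; split; lra.
have [|a2 /andP[ra2 ab2] wa2] := @ivtN r1 b2 (level l / 2) rb2.
  by apply/orP; left; apply/andP; split; lra.
have ra2' : r1 < a2.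
  by rewrite lt_neqAle ra2 andbT; apply/eqP => E; move: wr1; rewrite E wa2; lra.
have ab2' : a2 < b2.
  by rewrite lt_neqAle ab2 andbT; apply/eqP => E; move: wa2; rewrite E wb2; lra.
have b2m' : b2 < rm.
  by rewrite lt_neqAle b2m andbT; apply/eqP => E; move: pk; rewrite -E wb2; lra.
have k1 : 0 <= (p - 2) / (4 * p) by rewrite divr_ge0//; lra.
have Kx (x : R) : a2 <= x -> x <= b2 -> k0 <= - Nl p l (w x).
  move=> ax xb; have wx : level l / 2 <= - w x.
    by have : w x <= w a2 by [apply: w_nincr2 => //; exact: le_trans xb b2m]; rewrite wa2; lra.
  have wx' : - w x <= level l.
    have : w b2 <= w x by apply: w_nincr2 => //; exact: le_trans ra2 ax.
    by rewrite wb2; lra.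
  have := @below_level l (w x) (ltW l_gt0); rewrite ler0_norm; last by lra.
  move=> /(_ wx') Nlx.
  have w2 : (level l0 / 2) ^+ 2 <= w x ^+ 2.
    have L00' := L00; have L0' : level l0 / 2 <= - w x.
      by apply: le_trans wx; rewrite ler_pM2r//; exact: L0.
    have L2 : 0 <= level l0 / 2 by move: L00'; bump_lra.
    by rewrite -[w x ^+ 2]sqrrN lerXn2r ?nnegrE// (le_trans L2).
  have : k0 <= (p - 2) / (4 * p) * l * w x ^+ 2; last by lra.
  rewrite /k0; apply: ler_pM w2; [exact: mulr_ge0 k1 (ltW l00)|exact: sqr_ge0|].
  by apply: ler_wpM2l.
exists a2, b2; split => //; first by rewrite ra2'.
  (* Positive energy and $|z|\le2$ give $k_0\le z^2/2\le|z|$ on this stretch, so half a level, which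
     is less than $1/2$, is crossed within $1/k_0$. *)
  have := @nonincr _ (fun x => w x + k0 * x) (fun x => z x + k0) a2 b2 ab2.
  rewrite wa2 wb2 => H; have {}H : - level l + k0 * b2 <= - (level l / 2) + k0 * a2.
    apply: H.
    - by have cw := sol_cw sol; move=> x _; ct_auto.
    - by have dw := sol_dw sol; move=> x _; apply: der_eq; [der_auto|rewrite /=; ring].
    - move=> x /andP[ax xb]; have := Kx x (ltW ax) (ltW xb) => Kxx.
      have x0r : 0 <= x <= r2 by apply/andP; split; lra.
      have := energy_pos sol tz p2 l01' x0r; rewrite /energy_at => E0.
      have zx : z x < 0 by apply: zneg; apply/andP; split; move: ax xb ra2 b2m; bump_lra.
      have := sol_z2 sol x p2 l01'; rewrite ltr0_norm// => zx2.
      have : z x ^+ 2 <= 2 * - z x by rewrite expr2 -mulrNN ler_wpM2r//; move: zx zx2; bump_lra.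
      by move: Kxx E0 zx zx2; bump_lra.
  by have L1' := L1; rewrite -[leRHS]mul1r ler_pdivlMr//; lra.
case/orP: (le_total a2 1) => a21.
  apply: le_trans a21 _; rewrite lerDl; apply: divr_ge0.
    by apply: mulr_ge0 => //; exact: exprn_ge0 tau0.
  by apply: mulr_ge0; exact: ltW.
have [T1 /andP[T10 T1r] [wT1 T1tau]] := first_descent.
(* [Y] is nonincreasing from the time $T_1$ when [w] first comes down to the level, so it never
   exceeds [tau ^+ (2 * n)] before the bump. *)
pose Y r := r ^+ (2 * n) * energy_at p l w z r.
have cE := continuous_energy_at sol p2.
have cY : continuous Y by move=> x; rewrite /Y; ct_auto.
have dY (x : R) : 0 < x -> hasD Y x ((2 * n)%:R * x ^+ (2 * n).-1 * Nl p l (w x)).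
  by move=> x0; exact: der_weighted_energy.
have ble (x : R) : T1 <= x -> x <= b2 -> `|w x| <= level l.
  move=> Tx xb; rewrite ler_norml; apply/andP; split.
  - case/orP: (le_total x r1) => xr; last by rewrite -wb2; apply: w_nincr2.
    have : 0 <= w x by rewrite -wr1; apply: w_nincr1 => //; exact: le_trans (ltW T10) Tx.
    by move: Ll0; bump_lra.
  - case/orP: (le_total x r1) => xr; first by rewrite -wT1; apply: w_nincr1 => //; exact: ltW.
    have : w x <= w r1 by apply: w_nincr2 => //; exact: le_trans xb b2m.
    by move: wr1 Ll0; bump_lra.
have Nlneg (x : R) : T1 <= x -> x <= b2 -> Nl p l (w x) <= - ((p - 2) / (4 * p) * l * w x ^+ 2).
  by move=> Tx xb; apply: below_level; [exact: ltW|exact: ble].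
have T1a : T1 <= a2 by rewrite (le_trans (ltW T1r))// ltW.
have YaT : Y a2 <= Y T1.
  apply: (@nonincr _ Y _ T1 a2 T1a) => [x _|x /andP[Tx _]|x /andP[Tx xa]].
  - exact: cY.
  - by apply: dY; exact: lt_trans Tx.
  - rewrite mulr_ge0_le0 ?mulr_ge0 ?exprn_ge0 ?(ltW (lt_trans T10 Tx))//.
    apply: le_trans (Nlneg x (ltW Tx) (le_trans (ltW xa) ab2)) _.
    rewrite oppr_le0; apply: mulr_ge0 (sqr_ge0 _); exact: mulr_ge0 k1 (ltW l_gt0).
have YT : Y T1 <= tau ^+ (2 * n).
  have E1 : energy_at p l w z T1 <= 1.
    apply: le_trans (energy_at_nincr sol p2 (lexx 0) (ltW T10)) _.
    rewrite (energy_at0 sol); have : 1 / p <= 1 by rewrite ler_pdivrMr; move: h; bump_lra.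
    by have := ltW l_gt0; bump_lra.
  rewrite /Y; apply: le_trans (_ : T1 ^+ (2 * n) * 1 <= _).
    by apply: ler_wpM2l => //; rewrite exprn_ge0// ltW.
  by rewrite mulr1 lerXn2r ?nnegrE ?(ltW T10).
have Yb : 0 < Y b2.
  have b20 : 0 < b2 by rewrite (lt_trans _ ab2')// (lt_trans _ ra2').
  rewrite /Y mulr_gt0 ?exprn_gt0// (energy_pos sol tz p2 l01')//.
  by rewrite (ltW b20)/= (le_trans b2m)// ltW.
(* As $n\ge1$ and $a_2\ge1$, the factor $2n\,r^{2n-1}$ is at least $2a_2$, so a distant bump pays a
   loss proportional to its distance. *)
have Ydrop : Y b2 + 2 * k0 * a2 * b2 <= Y a2 + 2 * k0 * a2 * a2.
  apply: (@nonincr _ (fun x => Y x + 2 * k0 * a2 * x)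
    (fun x => (2 * n)%:R * x ^+ (2 * n).-1 * Nl p l (w x) + 2 * k0 * a2) a2 b2 ab2).
  - by move=> x _; ct_auto.
  - move=> x /andP[ax xb]; have x0 : 0 < x by move: ax a21; bump_lra.
    have := dY x x0 => dYx; apply: der_eq; first by der_auto.
    by rewrite /=; ring.
  - move=> x /andP[ax xb]; have := Kx x (ltW ax) (ltW xb) => Kxx.
    have x1 : 1 <= x by move: ax a21; bump_lra.
    have n1 : 2 <= (2 * n)%:R :> R by rewrite ler_nat; case: n n0 => // k _; rewrite mulnS.
    have xn : a2 <= x ^+ (2 * n).-1.
      rewrite (le_trans (ltW ax))//; case: n n0 => // k _; rewrite mulnS/= exprS.
      by rewrite ler_peMr ?exprn_ege1// (le_trans ler01).
    have : 2 * a2 * k0 <= (2 * n)%:R * x ^+ (2 * n).-1 * - Nl p l (w x).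
      apply: ler_pM => //; [by move: a21; bump_lra|exact: ltW|].
      by apply: ler_pM => //; move: a21; bump_lra.
    by bump_lra.
(* The crossing also takes a minimal time because $|z|\le2$. The loss of [Y], at least proportional
   to $a_2$, cannot exceed its initial value, which bounds $a_2$. *)
have zb : level l / 2 <= 2 * b2 - 2 * a2.
  have := @abs_incr_le _ w (fun x => 2 * x) z (fun=> 2) a2 b2 ab2.
  rewrite wb2 wa2 => H; have : `|- level l - - (level l / 2)| <= 2 * b2 - 2 * a2.
    apply: H.
    - by move=> x _; exact: (sol_cw sol).
    - by move=> x _; ct_auto.
    - by move=> x _; exact: (sol_dw sol).
    - by move=> x _; apply: der_eq; [der_auto|rewrite /=; ring].
    - by move=> x _; exact: sol_z2 sol _ p2 l01'.
  by rewrite ler_norml; bump_lra.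
have H1 : 2 * k0 * a2 * (b2 - a2) <= tau ^+ (2 * n) by move: Ydrop YaT YT Yb; bump_lra.
have H2 : k0 * level l0 * a2 <= 4 * tau ^+ (2 * n).
  have : k0 * a2 * (level l0 / 2) <= k0 * a2 * (2 * b2 - 2 * a2).
    have L0' := L0; apply: ler_wpM2l; first by rewrite mulr_ge0 ?(ltW k00)//; move: a21; bump_lra.
    by move: zb L0'; bump_lra.
  have : 0 <= tau ^+ (2 * n) by rewrite exprn_even_ge0// oddM.
  by move: H1; bump_lra.
apply: le_trans (_ : a2 <= tau ^+ (2 * n) * 4 / (k0 * level l0)) _; last by rewrite lerDr.
by rewrite ler_pdivlMr; [move: H2; bump_lra|exact: mulr_gt0].
Qed.

Let kappa := Num.sqrt ((p - 2) / (2 * p) * l0).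

Let kappa0 : 0 < kappa.
Proof.
have h := p2; rewrite sqrtr_gt0 mulr_gt0// divr_gt0//; lra.
Qed.

Let kappa2 : kappa ^+ 2 = (p - 2) / (2 * p) * l0.
Proof.
have h := p2; rewrite sqr_sqrtr// mulr_ge0 ?(ltW l00)// divr_ge0//; lra.
Qed.

(** A bound for the radius where the final decay takes over: the position $a_2$, the crossing from
    half level to level, the two passages above the level on either side of the peak, and
    $n/\kappa$, past which the growth of $r^n$ is slower than the decay of $w^2$. *)
Let radius := 1 + tau ^+ (2 * n) * 4 / (k0 * level l0) + k0^-1 + 2 * tau + n%:R / kappa.

Local Ltac tail_lra := clear - R n p p2 l0 l w z M r1 r2 l00 l0l lp sol tz M0 dM l_gt0 l01 l01' rm r1m zrm
  zneg zpos ivtN k0 c0 tau k00 c00 tau0 L0 L00 L1 kappa kappa0 kappa2 radius; lra.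

(* Once [|w| <= level l] on the last descent, [z ^ 2 >= kappa ^ 2 w ^ 2], which makes
   [M + kappa^-1 r^n w^2] nonincreasing as soon as [r >= n / kappa]. *)
Lemma M_bound_bump : (0 < n)%N -> M r2 <= radius ^+ n.+1 + radius ^+ n / kappa.
Proof.
move=> n0; have h := p2; have /andP[r1rm rmr2] := r1m.
have [/andP[r10 r12] wr1 wr2 rp rn] := tz.
have [a2 [b2 [/andP[ra2 ab2] b2m wb2 ab2k a2le]]] := bump_position n0.
have pk := peak_above_level; have Ll0 := level_gt0 l_gt0.
have rb2 : r1 <= b2 by lra.
have above x : b2 <= x -> x <= rm -> level l <= - w x.
  move=> bx xm; have : w x <= w b2 by exact: w_nincr2.
  by rewrite wb2; lra.
have nlc x : level l <= - w x -> c0 <= nl p l (- w x).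
  move=> wx; apply: le_trans (above_level (ltW l_gt0) wx); rewrite /c0.
  apply: ler_pM; rewrite ?(ltW L00)//; last exact: le_trans L0 wx.
    by rewrite mulr_ge0 ?(ltW l00)//; lra.
  by rewrite ler_wpM2l//; lra.
have sodeN := ode_opp (sol_ode sol).
have b20 : 0 <= b2 by lra.
have w1 x : - w x <= 1 by have := sol_w1 sol x; rewrite ler_norml; lra.
have time1 : rm - b2 <= tau.
  apply: le_of_sqr_bound => //; first by rewrite subr_ge0 ltW.
  have := @ascent_time l _ _ b2 rm c0 sodeN b20 (ltW b2m) (ltW c00) _.
  rewrite zrm oppr0 lexx => H.
  have {}H := H (fun x H => nlc x (above x (proj1 (andP H)) (proj2 (andP H)))) isT.
  by have := w1 rm; move: H; rewrite wb2; move: (c0 / (2 * n.+1%:R) * _) => D; lra.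
have [|b3 /andP[rmb3 b3r2] wb3] := @ivtN rm r2 (level l) (ltW rmr2).
  by apply/orP; right; rewrite wr2; apply/andP; split; lra.
have above3 x : rm <= x -> x <= b3 -> level l <= - w x.
  move=> bx xm; have : w x <= w b3 by exact: w_ndecr3.
  by rewrite wb3; lra.
have rm0 : 0 <= rm by lra.
have time2 : b3 - rm <= tau.
  apply: le_of_sqr_bound => //; first by rewrite subr_ge0.
  have := @descent_time l _ _ rm b3 c0 sodeN rm0 rmb3 (ltW c00) _.
  rewrite zrm oppr0 lexx => H.
  have {}H := H (fun x H => nlc x (above3 x (proj1 (andP H)) (proj2 (andP H)))) isT.
  by have := w1 rm; move: H; rewrite wb3; move: (c0 / (2 * n.+1%:R) * _) => D; lra.
have nk : 0 <= n%:R / kappa by rewrite divr_ge0// ltW.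
pose T := b3 + n%:R / kappa.
have T0 : 0 <= T by rewrite /T; lra.
have TR : T <= radius by rewrite /T /radius; lra.
have [r2T|Tr2] := leP r2 T.
  apply: le_trans (M_le (ltW (r2_gt0 tz))) _; apply: le_trans (_ : radius ^+ n.+1 <= _).
    by rewrite lerXn2r ?nnegrE ?(ltW (r2_gt0 tz)) ?(le_trans T0)// (le_trans r2T).
  by rewrite lerDl divr_ge0 ?(ltW kappa0)// exprn_ge0// (le_trans T0).
have := @nonincr _ (fun x => M x + kappa^-1 * (x ^+ n * w x ^+ 2))
  (fun x => x ^+ n * w x ^+ 2 + kappa^-1 * (n%:R * x ^+ n.-1 * w x ^+ 2 + x ^+ n * (2 * w x * z x)))
  T r2 (ltW Tr2).
rewrite wr2 (expr0n _ 2)/= !mulr0 addr0 => H; apply: le_trans (H _ _ _) _.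
- have cw := sol_cw sol; have cM : continuous M by move=> x; exact: der_cont (dM x).
  by move=> x _; ct_auto.
- have dw := sol_dw sol; move=> x _; apply: der_eq; first by der_auto.
  by rewrite /=; ring.
- move=> x /andP[Tx xr2]; have x0 : 0 < x by exact: le_lt_trans Tx.
  have b3x : b3 <= x by apply: le_trans (ltW Tx); rewrite /T lerDl.
  have wx : - w x <= level l by have := w_ndecr3 rmb3 b3x (ltW xr2); rewrite wb3; tail_lra.
  have wx0 : w x <= 0.
    by rewrite ltW// rn// xr2 (lt_le_trans r1rm)// (le_trans rmb3).
  have zx : 0 < z x.
    apply: zpos; rewrite (ltW xr2) andbT (le_lt_trans rmb3)//.
    by rewrite (le_lt_trans _ Tx)// /T lerDl.
  have := @below_level l (w x) (ltW l_gt0); rewrite ler0_norm// => /(_ wx) Nlx.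
  have x0r : 0 <= x <= r2 by rewrite !ltW.
  have := energy_pos sol tz p2 l01' x0r; rewrite /energy_at => E0.
  have kz : kappa * - w x <= z x.
    rewrite -ler_sqr ?nnegrE ?mulr_ge0 ?(ltW zx) ?(ltW kappa0) ?oppr_ge0//.
    rewrite exprMn sqrrN kappa2.
    have : (p - 2) / (2 * p) * l0 * w x ^+ 2 <= 2 * ((p - 2) / (4 * p) * l * w x ^+ 2).
      have -> : 2 * ((p - 2) / (4 * p) * l * w x ^+ 2) = (p - 2) / (2 * p) * l * w x ^+ 2 by field; move: h; tail_lra.
      apply: ler_wpM2r; first exact: sqr_ge0.
      by apply: ler_wpM2l => //; rewrite divr_ge0//; move: h; tail_lra.
    by move: Nlx E0; tail_lra.
  have wz : 2 * w x * z x <= - 2 * (kappa * w x ^+ 2).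
    have := ler_wpM2l (_ : 0 <= - w x) kz; rewrite oppr_ge0 => /(_ wx0); rewrite expr2; tail_lra.
  have xn : 0 <= x ^+ n by rewrite exprn_ge0// ltW.
  have w2 := sqr_ge0 (w x).
  have nx : n%:R * x ^+ n.-1 <= kappa * x ^+ n.
    have nkx : n%:R <= kappa * x.
      rewrite mulrC -ler_pdivrMr//; apply: le_trans (ltW Tx); rewrite /T lerDr; exact: le_trans rm0 rmb3.
    have -> : x ^+ n = x * x ^+ n.-1 by case: n n0 => // k _; rewrite exprS.
    by rewrite mulrA ler_wpM2r// exprn_ge0// ltW.
  have H1 : n%:R * x ^+ n.-1 * w x ^+ 2 <= kappa * x ^+ n * w x ^+ 2 by rewrite ler_wpM2r.
  have H2 : x ^+ n * (2 * w x * z x) <= x ^+ n * (- 2 * (kappa * w x ^+ 2)) by rewrite ler_wpM2l.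
  have -> : x ^+ n * w x ^+ 2 = kappa^-1 * (kappa * (x ^+ n * w x ^+ 2)) by rewrite mulKf// gt_eqF.
  rewrite -mulrDr; apply: mulr_ge0_le0; first by rewrite invr_ge0 ltW.
  by move: H1 H2; move: (x ^+ n) (w x ^+ 2) (n%:R * x ^+ n.-1) (w x * z x) => a b c d; tail_lra.
- have Tn : T ^+ n <= radius ^+ n by rewrite lerXn2r ?nnegrE// (le_trans T0).
  apply: lerD.
    apply: le_trans (M_le T0) _.
    by rewrite lerXn2r ?nnegrE// (le_trans T0).
  rewrite mulrC ler_wpM2r ?invr_ge0 ?(ltW kappa0)//; apply: le_trans Tn.
  rewrite ler_piMr ?exprn_ge0//.
  by rewrite -real_normK ?num_real// expr_le1// (sol_w1 sol).
Qed.

(** The position of the bump is irrelevant here since the weight is $1$. As $z^2\le2|z|$, the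
    integral of $z^2$ is at most twice the variation of [w], which is at most $3$ over the three
    monotone pieces; the virial identity converts this into a bound on the mass. *)
Lemma M_bound_line : n = 0%N -> M r2 <= 12 / ((1 - 2 / p) * l0).
Proof.
move=> n0; have h := p2; have /andP[r1rm rmr2] := r1m.
have [/andP[r10 r12] wr1 wr2 rp rn] := tz.
have cz := sol_cz sol; have cz2 : continuous (fun x => z x ^+ 2) by move=> x; ct_auto.
have [G G0 dG] := primitive cz2.
have cG : continuous G by move=> x; exact: der_cont (dG x).
have cM : continuous M by move=> x; exact: der_cont (dM x).
have cw := sol_cw sol; have dw := sol_dw sol.
have z2 x : `|z x| <= 2 by exact: sol_z2 sol _ p2 l01'.
have G1 : G r1 <= 2.
  have := @nonincr _ (fun x => G x + 2 * w x) (fun x => z x ^+ 2 + 2 * z x) 0 r1 (ltW r10).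
  rewrite G0 wr1 (sol_w0 sol) => H; suff : G r1 + 2 * 0 <= 0 + 2 * 1 by lra.
  apply: H => [x _|x _|x /andP[x0 xr]].
  - by ct_auto.
  - by apply: der_eq; [der_auto|rewrite /=; ring].
  - have zx : z x < 0 by apply: (w_decr sol tz p2 l01); rewrite x0 ltW.
    by have := z2 x; rewrite ltr0_norm// expr2; nra.
have G2 : G rm <= G r1 + 2 * - w rm.
  have := @nonincr _ (fun x => G x + 2 * w x) (fun x => z x ^+ 2 + 2 * z x) r1 rm (ltW r1rm).
  rewrite wr1 => H; suff : G rm + 2 * w rm <= G r1 + 2 * 0 by lra.
  apply: H => [x _|x _|x /andP[x0 xr]].
  - by ct_auto.
  - by apply: der_eq; [der_auto|rewrite /=; ring].
  - have zx : z x < 0 by apply: zneg; rewrite xr ltW.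
    by have := z2 x; rewrite ltr0_norm// expr2; nra.
have G3 : G r2 <= G rm + 2 * - w rm.
  have := @nonincr _ (fun x => G x - 2 * w x) (fun x => z x ^+ 2 - 2 * z x) rm r2 (ltW rmr2).
  rewrite wr2 => H; suff : G r2 - 2 * 0 <= G rm - 2 * w rm by lra.
  apply: H => [x _|x _|x /andP[x0 xr]].
  - by ct_auto.
  - by apply: der_eq; [der_auto|rewrite /=; ring].
  - have zx : 0 < z x by apply: zpos; rewrite x0 ltW.
    by have := z2 x; rewrite gtr0_norm// expr2; nra.
have wm : - w rm <= 1 by have := sol_w1 sol rm; rewrite ler_norml; lra.
have G6 : G r2 <= 6 by lra.
(* The derivative is twice the energy, hence positive up to $r_2$; the multiple $2/p$ of $wz$
   expresses $|w|^p$ through $z^2$ and $lw^2$. *)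
have := @nondecr _ (fun x => (1 + 2 / p) * G x - (1 - 2 / p) * l * M x - 2 / p * (w x * z x))
  (fun x => 2 * energy_at p l w z x) 0 r2 (ltW (r2_gt0 tz)).
rewrite G0 M0 wr2 (sol_z0 sol (lexx 0)) !mulr0 mul0r mulr0 !subr0 => H.
have {}H : 0 <= (1 + 2 / p) * G r2 - (1 - 2 / p) * l * M r2.
  apply: H => [x _|x /andP[x0 xr]|x /andP[x0 xr]].
  - by ct_auto.
  - have dz := sol_dz sol x0; have dGx := dG x; have dMx := dM x; have dwx := dw x.
    apply: der_eq; first by der_auto.
    have p0 : p != 0 by rewrite gt_eqF// (lt_trans _ h).
    by rewrite /energy_at /nl /Nl n0 /= expr0 !mul0r; field.
  - by rewrite mulr_ge0// ltW// (energy_pos sol tz p2 l01')// !ltW.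
have p1 : 2 / p < 1 by rewrite ltr_pdivrMr; lra.
have p0 : 0 <= 2 / p by rewrite divr_ge0//; lra.
rewrite ler_pdivlMr; last by rewrite mulr_gt0//; lra.
have H1 : (1 + 2 / p) * G r2 <= (1 + 2 / p) * 6 by apply: ler_wpM2l; lra.
have H12 : (1 - 2 / p) * l * M r2 <= 12 by lra.
have [M2|M2] := leP 0 (M r2).
  have : (1 - 2 / p) * l0 * M r2 <= (1 - 2 / p) * l * M r2.
    by apply: ler_wpM2r => //; apply: ler_wpM2l => //; lra.
  by rewrite [leLHS]mulrC; lra.
apply: (@le_trans _ _ 0) => //; apply: mulr_le0_ge0 (ltW M2) _.
by apply: mulr_ge0 (ltW l00); lra.
Qed.

End second_bump.

End bound.

Theorem mass_integral_bound (l0 : R) : 0 < l0 -> exists C, forall l w z M r1 r2,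
  l0 <= l -> l < 2 / p -> is_sol n p l w z -> two_zeros w r1 r2 -> M 0 = 0 ->
  (forall r, hasD M r (r ^+ n * w r ^+ 2)) -> M r2 <= C.
Proof.
move=> l00; have h := p2.
have [n0|n0] := posnP n.
- exists (12 / ((1 - 2 / p) * l0)) => l w z M r1 r2 l0l lp sol tz M0 dM.
  have l01 : 0 <= l < 1 by rewrite (l_lt1 lp) andbT (le_trans (ltW l00)).
  have [rm r1m [zrm zneg zpos]] := bump_shape sol tz p2 l01.
  exact (M_bound_line l00 l0l lp sol tz M0 dM r1m zneg zpos n0).
- eexists => l w z M r1 r2 l0l lp sol tz M0 dM.
  have l01 : 0 <= l < 1 by rewrite (l_lt1 lp) andbT (le_trans (ltW l00)).
  have [rm r1m [zrm zneg zpos]] := bump_shape sol tz p2 l01.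
  exact (M_bound_bump l00 l0l lp sol tz M0 dM r1m zrm zneg zpos n0).
Qed.

End mass_bound.

(** * The Lane-Emden limit *)

Section lane_emden.
Context {R : realType} (n : nat) (p : R).

Lemma nl0 (x : R) : nl p 0 x = pw p x. Proof. by rewrite /nl mul0r subr0. Qed.

Lemma pw_le (x y : R) : 2 < p -> 0 < x -> x <= y -> pw p x <= pw p y.
Proof.
move=> p2 x0 xy; have y0 := lt_le_trans x0 xy; rewrite !pw_gt0//.
by apply: ge0_ler_powR => //; rewrite ?nnegrE; [lra|exact: ltW|exact: ltW].
Qed.

Section decay.
Variables (y v : R -> R) (s : R).
Hypotheses (p2 : 2 < p) (yv : is_ode n p 0 y v) (s0 : 0 < s) (y1 : forall r, y r <= 1)
  (ypos : forall r, s <= r -> 0 < y r).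

Let cv : continuous v. Proof. by case: yv. Qed.
Let dy r : hasD y r (v r). Proof. by case: yv. Qed.
Let dv (r : R) : 0 < r -> hasD v r (- (n%:R / r * v r) - nl p 0 (y r)).
Proof. by case: yv => _ _; apply. Qed.
Let cy : continuous y. Proof. by move=> r; exact: der_cont (dy r). Qed.

(** If [y] increased forever, the force would stay above its value at [s], and [ascent_time] would
    push [y] past its bound $1$. *)
Lemma eventually_decreasing : exists2 t, s <= t & v t <= 0.
Proof.
have [//|nv] := pselect (exists2 t, s <= t & v t <= 0); exfalso.
have vpos t : s <= t -> 0 < v t.
  by move=> st; rewrite ltNge; apply/negP => vt; apply: nv; exists t.
pose c := pw p (y s); have c0 : 0 < c.
  by rewrite /c pw_gt0 ?powR_gt0//; exact: ypos.
have ynd t : s <= t -> y s <= y t.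
  move=> st; apply: (@nondecr _ y v s t st) => [x _|x _|x /andP[sx _]].
  - exact: cy.
  - exact: dy.
  - by apply: ltW; apply: vpos; exact: ltW.
pose b := s + (1 + 2 * n.+1%:R / c) + 1.
have nc : 0 <= 2 * n.+1%:R / c by rewrite divr_ge0// ltW.
have sb : s <= b by rewrite /b; lra.
have := @ascent_time R n p 0 y v s b c yv (ltW s0) sb (ltW c0).
move=> H; have {}H : y s + c / (2 * n.+1%:R) * (b - s) ^+ 2 <= y b.
  apply: H; last by apply: ltW; exact: vpos.
  move=> r /andP[sr rb]; rewrite nl0; apply: pw_le => //; [exact: ypos|exact: ynd].
have bs0 : 0 <= b - s by rewrite subr_ge0.
have : b - s <= 1 + 2 * n.+1%:R / c.
  apply: (@le_of_sqr_bound R n c (b - s) c0 bs0).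
  by have := y1 b; have := ypos (lexx s); move: H; move: (c / (2 * n.+1%:R) * _) => D; lra.
by rewrite /b; lra.
Qed.

Section after.
Variable t : R.
Hypotheses (st : s <= t) (vt : v t <= 0).

Let t0 : 0 < t. Proof. exact: lt_le_trans st. Qed.

Lemma flux_nincr (a b : R) : t <= a -> a <= b -> b ^+ n * v b <= a ^+ n * v a.
Proof.
move=> ta ab; apply: (@nonincr _ (fun r => r ^+ n * v r) (fun r => - (r ^+ n * nl p 0 (y r))) a b ab).
- by move=> x _; ct_auto.
- move=> x /andP[ax _]; apply: (der_rnz y); last apply: dv.
    by rewrite (lt_le_trans t0)// (le_trans ta)// ltW.
  by rewrite (lt_le_trans t0)// (le_trans ta)// ltW.
- move=> x /andP[ax _]; have tx : t <= x by rewrite (le_trans ta)// ltW.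
  rewrite oppr_le0; apply: mulr_ge0; first by apply: exprn_ge0; rewrite (le_trans (ltW t0)).
  by rewrite nl0 pw_gt0 ?powR_ge0// ypos// (le_trans st).
Qed.

Lemma v_le0 (r : R) : t <= r -> v r <= 0.
Proof.
move=> tr; have r0 : 0 < r by exact: lt_le_trans tr.
have := flux_nincr (lexx t) tr => H.
rewrite -(pmulr_rle0 _ (exprn_gt0 n r0)); apply: le_trans H _.
by rewrite mulr_ge0_le0// exprn_ge0// ltW.
Qed.

Lemma y_nincr (a b : R) : t <= a -> a <= b -> y b <= y a.
Proof.
move=> ta ab; apply: (@nonincr _ y v a b ab) => [x _|x _|x /andP[ax _]].
- exact: cy.
- exact: dy.
- by apply: v_le0; rewrite (le_trans ta)// ltW.
Qed.

(** Integrate the flux from [t] to [r], where the force is at least its value at [r] because [y]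
    decreases; for $r\ge2t$ at least half of the integral of $s^n$ survives. *)
Lemma slope_lower (r : R) : 2 * t <= r -> pw p (y r) * r / (2 * n.+1%:R) <= - v r.
Proof.
move=> t2r; have tr : t <= r by have := t0; lra.
have r0 : 0 < r by exact: lt_le_trans tr.
have yr : 0 < y r by apply: ypos; exact: le_trans tr.
pose c := pw p (y r); have c0 : 0 < c by rewrite /c pw_gt0// powR_gt0.
have := @nonincr _ (fun x => x ^+ n * v x + c / n.+1%:R * x ^+ n.+1)
  (fun x => x ^+ n * (c - nl p 0 (y x))) t r tr.
move=> H; have {}H : r ^+ n * v r + c / n.+1%:R * r ^+ n.+1 <= t ^+ n * v t + c / n.+1%:R * t ^+ n.+1.
  apply: H => [x _|x /andP[tx xr]|x /andP[tx xr]].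
  - by ct_auto.
  - have x0 : 0 < x by rewrite (lt_trans t0).
    apply: der_eq.
      by apply: derD; [apply: (der_rnz y) => //; exact: dv|der_auto].
    by rewrite /=; field; rewrite addrC natr1 pnatr_eq0.
  - have x0 : 0 < x by rewrite (lt_trans t0).
    rewrite mulr_ge0_le0 ?exprn_ge0 ?(ltW x0)// subr_le0 nl0; apply: pw_le => //.
    by apply: y_nincr; [exact: ltW|exact: ltW].
have tn : t ^+ n * v t <= 0 by rewrite mulr_ge0_le0// exprn_ge0// ltW.
have tN : t ^+ n.+1 <= r ^+ n.+1 / 2.
  apply: (@le_trans _ _ ((r / 2) ^+ n.+1)).
    by rewrite lerXn2r ?nnegrE ?divr_ge0 ?(ltW t0) ?(ltW r0)//; lra.
  rewrite expr_div_n; apply: ler_wpM2l; first by rewrite exprn_ge0// ltW.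
  rewrite lef_pV2 ?posrE ?exprn_gt0// exprS ler_peMr// exprn_ege1//.
  by rewrite ler1n.
have cN : 0 <= c / n.+1%:R by rewrite divr_ge0// ltW.
have H2 := ler_wpM2l cN tN.
have rn := exprn_gt0 n r0.
rewrite -(ler_pM2l rn) -/c.
have -> : r ^+ n * (c * r / (2 * n.+1%:R)) = c / n.+1%:R * (r ^+ n.+1 / 2).
  by rewrite exprS; field; rewrite addrC natr1 pnatr_eq0.
have E : c / n.+1%:R * r ^+ n.+1 = 2 * (c / n.+1%:R * (r ^+ n.+1 / 2)).
  by field; rewrite addrC natr1 pnatr_eq0.
rewrite E in H; rewrite mulrN; move: H H2 tn.
move: (c / n.+1%:R * (r ^+ n.+1 / 2)) (c / n.+1%:R * t ^+ n.+1) => X Y.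
by move: (r ^+ n * v r) (t ^+ n * v t) => U V; lra.
Qed.

(** The slope bound is a differential inequality for $y^{2-p}$, which therefore grows at least like
    $r^2$. This is the slow decay rate $r^{-2/(p-2)}$. *)
Lemma y_decay (r : R) : 4 * t <= r -> r ^+ 2 * y r `^ (p - 2) <= 8 * n.+1%:R / (p - 2).
Proof.
move=> tr; have t00 := t0; have hp := p2; have p20 : 0 < p - 2 by lra.
have ypos' (x : R) : 2 * t <= x -> 0 < y x by move=> ?; apply: ypos; have := st; lra.
have t2r : 2 * t <= r by lra.
pose a := (p - 2) / (4 * n.+1%:R) : R.
have n4 : 0 < 4 * n.+1%:R :> R by rewrite mulr_gt0.
have := @nondecr _ (fun x => y x `^ (2 - p) - a * x ^+ 2)
  (fun x => (2 - p) * y x `^ (2 - p - 1) * v x - a * (2 * x)) (2 * t) r t2r.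
move=> H; have {}H : y (2 * t) `^ (2 - p) - a * (2 * t) ^+ 2 <= y r `^ (2 - p) - a * r ^+ 2.
  apply: H => [x /andP[tx _]|x /andP[tx xr]|x /andP[tx xr]].
  - have dp := der_powR (2 - p) (ypos' x tx) (dy x).
    by apply: der_cont; apply: derD; [exact: dp|der_auto].
  - have dp := der_powR (2 - p) (ypos' x (ltW tx)) (dy x).
    by apply: der_eq; [apply: derD; [exact: dp|der_auto]|rewrite /=; ring].
  - have yx := ypos' x (ltW tx); have := slope_lower (ltW tx); rewrite pw_gt0// => sl.
    have yp : 0 < y x `^ (2 - p - 1) by exact: powR_gt0.
    have E : y x `^ (2 - p - 1) * y x `^ (p - 1) = 1.
      rewrite -powRD; last by rewrite (gt_eqF yx) implybT.
      by rewrite (_ : 2 - p - 1 + (p - 1) = 0) ?powRr0//; ring.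
    have {}sl : y x `^ (2 - p - 1) * (y x `^ (p - 1) * x / (2 * n.+1%:R)) <= y x `^ (2 - p - 1) * - v x.
      by apply: ler_wpM2l => //; exact: ltW.
    have E2 : y x `^ (2 - p - 1) * (y x `^ (p - 1) * x / (2 * n.+1%:R)) = x / (2 * n.+1%:R).
      by rewrite mulrA mulrA E mul1r.
    rewrite E2 in sl.
    have : (p - 2) * (x / (2 * n.+1%:R)) <= (p - 2) * (y x `^ (2 - p - 1) * - v x).
      by apply: ler_wpM2l => //; exact: ltW.
    have -> : (p - 2) * (x / (2 * n.+1%:R)) = a * (2 * x).
      by rewrite /a; field; rewrite addrC natr1 pnatr_eq0.
    by lra.
have yr := ypos' r t2r; have yt := ypos' (2 * t) (lexx _).
have y2 : 0 < y (2 * t) `^ (2 - p) by exact: powR_gt0.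
have a0 : 0 < a by rewrite divr_gt0.
have {}H : a / 2 * r ^+ 2 <= y r `^ (2 - p).
  have : (2 * t) ^+ 2 <= r ^+ 2 / 4.
    have -> : r ^+ 2 / 4 = (r / 2) ^+ 2 by rewrite !expr2; field.
    by rewrite lerXn2r ?nnegrE//; lra.
  by move=> H4; have := ler_wpM2l (ltW a0) H4; nra.
have E : y r `^ (2 - p) * y r `^ (p - 2) = 1.
  rewrite -powRD; last by rewrite (gt_eqF yr) implybT.
  by rewrite (_ : 2 - p + (p - 2) = 0) ?powRr0//; ring.
have yp : 0 < y r `^ (p - 2) by exact: powR_gt0.
have := ler_wpM2r (ltW yp) H; rewrite E => {}H.
have -> : r ^+ 2 * y r `^ (p - 2) = 2 / a * (a / 2 * r ^+ 2 * y r `^ (p - 2)).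
  by field; rewrite gt_eqF.
have -> : 8 * n.+1%:R / (p - 2) = 2 / a * 1.
  by rewrite /a; field; rewrite !gt_eqF// addrC natr1 ltr0Sn.
by apply: ler_wpM2l => //; rewrite divr_ge0// ltW.
Qed.

(** The flux $r^nv$ is nonincreasing, so on $[r,2r]$ the descent is at least $2^{-n}$ times as steep
    as at $r$; a steeper start would make $y(2r)$ negative. *)
Lemma v_decay (r : R) : t <= r -> r * - v r <= 2 ^+ n * y r.
Proof.
move=> tr; have t00 := t0; have r0 : 0 < r by exact: lt_le_trans tr.
have r2 : r <= 2 * r by lra.
pose D := - v r / 2 ^+ n; have n2 : 0 < 2 ^+ n :> R by exact: exprn_gt0.
have := @nonincr _ (fun x => y x + D * x) (fun x => v x + D) r (2 * r) r2.
move=> H; have {}H : y (2 * r) + D * (2 * r) <= y r + D * r.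
  apply: H => [x _|x _|x /andP[rx x2]].
  - by ct_auto.
  - by apply: der_eq; [der_auto|rewrite /=; ring].
  - have x0 : 0 < x by lra.
    have fl := flux_nincr tr (ltW rx); have vr := v_le0 tr.
    have xn : x ^+ n <= 2 ^+ n * r ^+ n.
      by rewrite -exprMn lerXn2r ?nnegrE ?(ltW x0)//; [lra|exact: ltW].
    have rn := exprn_gt0 n r0.
    have tx : t <= x by lra.
    have vx := v_le0 tx.
    suff : - v r <= 2 ^+ n * - v x.
      by rewrite /D -[- v r <= _]ler_pdivrMl// mulrC => ?; lra.
    rewrite -(ler_pM2l rn).
    have : x ^+ n * - v x <= 2 ^+ n * r ^+ n * - v x by apply: ler_wpM2r; lra.
    lra.
have y2 : 0 < y (2 * r) by apply: ypos; have := st; lra.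
have : D * r <= y r by lra.
by rewrite /D mulrAC ler_pdivrMr// mulrC [leRHS]mulrC mulrC.
Qed.

End after.

End decay.

Section pohozaev.
Variables (w z : R -> R).
Hypothesis sol : is_sol n p 0 w z.

(** Pohozaev's quantity for $l=0$ in dimension $n+1$. The coefficient $(n-1)/2$ is the one that
    cancels $z^2$ in the derivative, leaving a multiple of $|w|^p$ that is positive below the
    critical exponent. *)
Let P r := r ^+ n.+1 * energy_at p 0 w z r + (n%:R - 1) / 2 * (r ^+ n * (w r * z r)).

Let cP : 2 < p -> continuous P.
Proof.
move=> p2; have cE := continuous_energy_at sol p2; have cw := sol_cw sol; have cz := sol_cz sol.
by rewrite /P => x; ct_auto.
Qed.

Let dP (x : R) : 2 < p -> 0 < x ->
  hasD P x (x ^+ n * (pw p (w x) * w x) * (n.+1%:R / p - (n%:R - 1) / 2)).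
Proof.
move=> p2 x0.
have dE := der_energy_at sol p2 x0; have dw := sol_dw sol x; have dz := sol_dz sol x0.
have dr := der_rnz w x0 dz.
apply: der_eq.
  apply: derD; first by der_auto.
  apply: derM; first exact: der_cst.
  have -> : (fun t => t ^+ n * (w t * z t)) = (fun t => w t * (t ^+ n * z t)).
    by apply/funext => t; ring.
  by apply: derM; [exact: dw|exact: dr].
rewrite /= /energy_at /nl /Nl (exprS x n) -natr1.
have p0 : p != 0 by rewrite gt_eqF//; lra.
have x00 : x != 0 by rewrite gt_eqF.
by field; rewrite p0 x00.
Qed.

Let subc : 2 < p -> (n%:R - 1) * (p - 2) < 4 -> 0 < n.+1%:R / p - (n%:R - 1) / 2.
Proof.
move=> p2 sub; have p0 : 0 < p by lra.
by rewrite subr_gt0 ltr_pdivlMr// -[n.+1%:R]natr1; lra.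
Qed.

Lemma pohozaev_nondecr (a b : R) : 2 < p -> (n%:R - 1) * (p - 2) < 4 -> 0 <= a -> a <= b ->
  P a <= P b.
Proof.
move=> p2 sub a0 ab; apply: (@nondecr _ P (fun x => x ^+ n * (pw p (w x) * w x) * (n.+1%:R / p - (n%:R - 1) / 2)) a b ab).
- by move=> x _; exact: cP.
- by move=> x /andP[ax _]; apply: dP => //; exact: le_lt_trans ax.
- move=> x /andP[ax _]; have x0 : 0 < x by exact: le_lt_trans ax.
  apply: mulr_ge0 (ltW (subc p2 sub)); apply: mulr_ge0; first exact: exprn_ge0 (ltW x0).
  by rewrite /pw -mulrA mulr_ge0 ?powR_ge0// -expr2 sqr_ge0.
Qed.

Lemma pohozaev_gt0 : 2 < p -> (n%:R - 1) * (p - 2) < 4 -> 0 < P (1 / 4).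
Proof.
move=> p2 sub; have q0 : (0 : R) < 1 / 4 by lra.
have <- : P 0 = 0 by rewrite /P (sol_z0 sol (lexx 0)) exprS !(mul0r, mulr0) addr0.
apply: (@incr _ P (fun x => x ^+ n * (pw p (w x) * w x) * (n.+1%:R / p - (n%:R - 1) / 2)) 0 (1 / 4) q0).
- by move=> x _; exact: cP.
- by move=> x /andP[x0 _]; exact: dP.
- move=> x /andP[x0 x4]; apply: mulr_gt0 (subc p2 sub); apply: mulr_gt0; first exact: exprn_gt0.
  have l01 : 0 <= (0 : R) <= 1 by rewrite lexx ler01.
  have wx : 0 < w x by have := sol_lower sol p2 l01 (ltW x0); lra.
  by rewrite pw_gt0// mulr_gt0// powR_gt0.
Qed.

End pohozaev.

(** Without an upward crossing, [w] or its opposite is eventually positive and decays at the slow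
    rate. Then [P] is bounded by a negative power of $r$, although it is nondecreasing and already
    positive at $1/4$. *)
Theorem lane_emden_up_cross w z : 2 < p -> (n%:R - 1) * (p - 2) < 4 -> is_sol n p 0 w z ->
  up_cross w.
Proof.
move=> p2 sub sol; have [//|nuc] := pselect (up_cross w); exfalso.
have l01 : 0 <= (0 : R) <= 1 by rewrite lexx ler01.
have cw := sol_cw sol.
(* One function [y] covers both ways of not crossing: it is [w] if [w] never becomes negative, and
   [-w] beyond a negative value otherwise. The terms of [P] are even, so they do not see the
   sign. *)
have [y [v [s [s0 yv ywz y1 yge]]]] : exists (y v : R -> R) (s : R), [/\ 0 < s, is_ode n p 0 y v,
    (forall r, y r ^+ 2 = w r ^+ 2 /\ y r * v r = w r * z r /\ v r ^+ 2 = z r ^+ 2 /\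
      pw p (y r) * y r = pw p (w r) * w r),
    forall r, y r <= 1 & forall r, s <= r -> 0 <= y r].
  have [[s1 [s10 ws1]]|nneg] := pselect (exists s1 : R, 0 < s1 /\ w s1 < 0).
  - exists (fun r => - w r), (fun r => - z r), s1; split => //.
    + exact: ode_opp (sol_ode sol).
    + by move=> r; rewrite !sqrrN mulrNN pwN mulrNN.
    + by move=> r; have := sol_w1 sol r; rewrite ler_norml; lra.
    + move=> r; rewrite le_eqVlt oppr_ge0 => /predU1P[<-|sr]; first exact: ltW.
      by rewrite leNgt; apply/negP => wr; apply: nuc; exists s1, r.
  - exists w, z, 1; split => //; first exact: sol_ode sol.
    + by move=> r; have := sol_w1 sol r; rewrite ler_norml; lra.
    + move=> r r1; rewrite leNgt; apply/negP => wr; apply: nneg; exists r; split => //; lra.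
have [cv dy dv] := yv.
(* A nonnegative function has zero slope at an interior zero, but zeros of solutions are simple. The
   shift from [s] to [s + 1] makes the point interior. *)
have ypos (r : R) : s + 1 <= r -> 0 < y r.
  move=> sr; have r0 : 0 < r by lra.
  have sr' : s <= r by lra.
  have := yge r sr'; rewrite le_eqVlt => /predU1P[yr|//].
  have := sol_neq0 sol p2 l01 r0; have [<- [_ [<- _]]] := ywz r.
  rewrite -yr expr0n/= add0r => vr; exfalso.
  have : v r = 0; last by move=> E; move: vr; rewrite E expr0n/= ltxx.
  apply/eqP; rewrite eq_le; apply/andP; split; rewrite leNgt; apply/negP => vr0.
  - have [e e0 He] := der_pos_loc (dy r) vr0.
    pose x := Num.max s (r - e / 2).
    have xr : x < r by rewrite /x gt_max; apply/andP; split; lra.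
    have sx : s <= x by rewrite /x le_max lexx.
    have ex : r - e / 2 <= x by rewrite /x le_max lexx orbT.
    have [|_ /(_ xr)] := He x; first by rewrite ltr0_norm ?subr_lt0//; lra.
    by have := yge x sx; lra.
  - have vN : 0 < - v r by rewrite oppr_gt0.
    have [e e0 He] := der_pos_loc (derN (dy r)) vN.
    have [|+ _] := He (r + e / 2); first by rewrite addrAC subrr add0r gtr0_norm//; lra.
    have rr : r < r + e / 2 by lra.
    by move=> /(_ rr); have := yge (r + e / 2); lra.
have s10 : 0 < s + 1 by lra.
have [t st vt] := eventually_decreasing p2 yv s10 y1 ypos.
have t0 : 0 < t by lra.
pose P r := r ^+ n.+1 * energy_at p 0 w z r + (n%:R - 1) / 2 * (r ^+ n * (w r * z r)).
have P0 : 0 < P (1 / 4) by exact: pohozaev_gt0.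
(* The decay exponent of $r^{n-1}y^2$ when $y$ is of order $r^{-2/(p-2)}$; its positivity is exactly
   subcriticality. *)
pose e := 4 / (p - 2) - (n%:R - 1).
have e0 : 0 < e by rewrite subr_gt0 ltr_pdivlMr//; lra.
pose C1 := 8 * n.+1%:R / (p - 2).
have C10 : 0 <= C1 by rewrite divr_ge0 ?mulr_ge0//; lra.
have n2 : 0 < 2 ^+ n :> R by exact: exprn_gt0.
pose C := (2 ^+ n) ^+ 2 / 2 + C1 / p + `|(n%:R - 1) / 2| * 2 ^+ n.
have p00 : 0 <= p by lra.
have C0 : 0 <= C.
  rewrite /C; apply: addr_ge0; last by apply: mulr_ge0 => //; exact: ltW.
  by apply: addr_ge0; [apply: divr_ge0 => //; exact: sqr_ge0|exact: divr_ge0].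
have PB (r : R) : 4 * t <= r -> P r <= C * (r ^+ n / r * y r ^+ 2).
  move=> tr; have r0 : 0 < r by lra.
  have tr1 : t <= r by lra.
  have yr : 0 < y r by apply: ypos; lra.
  have vd := v_decay yv s10 ypos st vt tr1.
  have yd := y_decay p2 yv s10 ypos st vt tr.
  have vr := v_le0 yv s10 ypos st vt tr1.
  have [Ew [Ewz [Ez Ep]]] := ywz r.
  pose B := r ^+ n / r * y r ^+ 2; have rnr : 0 <= r ^+ n / r by rewrite divr_ge0 ?exprn_ge0 ?ltW.
  have B1 : r ^+ n.+1 * v r ^+ 2 <= (2 ^+ n) ^+ 2 * B.
    have -> : r ^+ n.+1 * v r ^+ 2 = r ^+ n / r * (r * - v r) ^+ 2.
      by rewrite exprS; field; rewrite gt_eqF.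
    have -> : (2 ^+ n) ^+ 2 * B = r ^+ n / r * (2 ^+ n * y r) ^+ 2 by rewrite /B; ring.
    apply: ler_wpM2l => //; rewrite lerXn2r ?nnegrE//; first by rewrite mulr_ge0 ?(ltW r0)//; lra.
    by rewrite mulr_ge0 ?(ltW yr)// ltW.
  have B2 : r ^+ n.+1 * (pw p (y r) * y r) <= C1 * B.
    have -> : r ^+ n.+1 * (pw p (y r) * y r) = r ^+ n / r * (y r ^+ 2) * (r ^+ 2 * y r `^ (p - 2)).
      by rewrite /pw (gtr0_norm yr) exprS; field; rewrite gt_eqF.
    by rewrite mulrC; apply: ler_wpM2r => //; rewrite mulr_ge0// sqr_ge0.
  have B3 : (n%:R - 1) / 2 * (r ^+ n * (y r * v r)) <= `|(n%:R - 1) / 2| * 2 ^+ n * B.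
    apply: le_trans (ler_norm _) _; rewrite normrM -mulrA; apply: ler_wpM2l => //.
    rewrite ler0_norm; last by rewrite mulr_ge0_le0 ?exprn_ge0 ?(ltW r0)// mulr_ge0_le0// ltW.
    have -> : - (r ^+ n * (y r * v r)) = r ^+ n / r * y r * (r * - v r).
      by field; rewrite gt_eqF.
    have -> : 2 ^+ n * B = r ^+ n / r * y r * (2 ^+ n * y r) by rewrite /B; ring.
    by apply: ler_wpM2l => //; rewrite mulr_ge0// ltW.
  rewrite /P /energy_at /Nl mul0r mul0r subr0 -Ez -Ep -Ewz.
  have -> : C * (r ^+ n / r * y r ^+ 2) = (2 ^+ n) ^+ 2 * B / 2 + C1 * B / p + `|(n%:R - 1) / 2| * 2 ^+ n * B.
    by rewrite /C -/B; ring.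
  apply: lerD B3; rewrite mulrDr; apply: lerD.
    by rewrite mulrA; apply: ler_wpM2r.
  by rewrite mulrA; apply: ler_wpM2r => //; rewrite invr_ge0; lra.
have YB (r : R) : 4 * t <= r -> r ^+ n / r * y r ^+ 2 <= C1 `^ (2 / (p - 2)) * r `^ (- e).
  move=> tr; have r0 : 0 < r by lra.
  have yr : 0 < y r by apply: ypos; lra.
  have yd := y_decay p2 yv s10 ypos st vt tr.
  have p20 : p - 2 != 0 by rewrite gt_eqF//; lra.
  have q0 : 0 <= 2 / (p - 2) by rewrite divr_ge0//; lra.
  have := @ge0_ler_powR R (2 / (p - 2)) q0 (r ^+ 2 * y r `^ (p - 2)) C1.
  rewrite !nnegrE C10 (mulr_ge0 (sqr_ge0 r) (powR_ge0 _ _)) => /(_ isT isT yd).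
  rewrite powRM ?sqr_ge0 ?powR_ge0// -powR_mulrn ?(ltW r0)// -!powRrM.
  rewrite [X in y r `^ X](_ : _ = 2%:R); last by field.
  rewrite powR_mulrn ?(ltW yr)// => H.
  have E : r ^+ n / r = r `^ (- e) * r `^ (2%:R * (2 / (p - 2))).
    rewrite -powR_mulrn ?(ltW r0)// -[in r^-1](powRr1 (ltW r0)) -powRN -!powRD ?(gt_eqF r0) ?implybT//.
    by congr (_ `^ _); rewrite /e; field.
  by rewrite E -mulrA mulrC; apply: ler_wpM2r => //; exact: powR_ge0.
(* Once $r^e\ge A$ the upper bound for [P r] falls strictly below [P (1 / 4)]; the added $1$ makes
   it strict. *)
pose A := C * C1 `^ (2 / (p - 2)) / P (1 / 4) + 1.
have A1 : 1 <= A by rewrite lerDr divr_ge0 ?(ltW P0)// mulr_ge0// powR_ge0.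
have A0 : 0 < A by lra.
pose r := Num.max (4 * t) (Num.max (1 / 4) (A `^ e^-1)).
have r1 : 4 * t <= r by rewrite /r le_max lexx.
have r2 : 1 / 4 <= r by rewrite /r !le_max lexx orbT.
have r3 : A `^ e^-1 <= r by rewrite /r !le_max lexx !orbT.
have r0 : 0 < r by lra.
have rA : A <= r `^ e.
  have -> : A = (A `^ e^-1) `^ e by rewrite -powRrM mulVf ?gt_eqF// powRr1// ltW.
  by apply: ge0_ler_powR; rewrite ?nnegrE ?powR_ge0 ?(ltW e0) ?(ltW r0).
have q0 : (0 : R) <= 1 / 4 by lra.
have PP := pohozaev_nondecr sol p2 sub q0 r2.
have := le_trans PP (PB _ r1) => H.
have {}H : P (1 / 4) <= C * (C1 `^ (2 / (p - 2)) * r `^ (- e)).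
  by apply: le_trans H _; apply: ler_wpM2l => //; exact: YB.
have re : 0 < r `^ e by exact: powR_gt0.
rewrite powRN mulrA ler_pdivlMr// in H.
have : A * P (1 / 4) <= P (1 / 4) * r `^ e by rewrite mulrC; apply: ler_wpM2l => //; exact: ltW.
have : A * P (1 / 4) = C * C1 `^ (2 / (p - 2)) + P (1 / 4) by rewrite /A; field; rewrite gt_eqF.
lra.
Qed.

End lane_emden.

(** * The one-parameter family *)

Section family.
Context {R : realType} (n : nat) (p : R).

Definition is_mass_integral (w M : R -> R) :=
  M 0 = 0 /\ forall r, hasD M r (r ^+ n * w r ^+ 2).

Lemma mass_integral_exists l w z : is_sol n p l w z -> exists M, is_mass_integral w M.
Proof.
move=> sol; have cw := sol_cw sol.
have cf : continuous (fun r : R => r ^+ n * w r ^+ 2) by move=> r; ct_auto.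
by have [M M0 dM] := primitive cf; exists M.
Qed.

Lemma mass_integral_nondecr (w M : R -> R) (a b : R) : is_mass_integral w M -> 0 <= a -> a <= b ->
  M a <= M b.
Proof.
move=> [M0 dM] a0 ab; apply: (@nondecr _ M (fun r => r ^+ n * w r ^+ 2) a b ab).
- by move=> x _; exact: der_cont (dM x).
- by move=> x _; exact: dM.
- by move=> x /andP[ax _]; rewrite mulr_ge0 ?sqr_ge0// exprn_ge0// (le_trans a0)// ltW.
Qed.

Lemma mass_integral_lower l w z M : 2 < p -> 0 <= l <= 1 -> is_sol n p l w z ->
  is_mass_integral w M -> (1 / 4) ^+ n.+1 / (4 * n.+1%:R) <= M (1 / 4).
Proof.
move=> p2 l01 sol [M0 dM]; have q0 : (0 : R) <= 1 / 4 by order_lra.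
have cM : continuous M by move=> r; exact: der_cont (dM r).
have := @nondecr _ (fun r => M r - r ^+ n.+1 / (4 * n.+1%:R))
  (fun r => r ^+ n * (w r ^+ 2 - 1 / 4)) 0 (1 / 4) q0.
rewrite M0 expr0n/= mul0r subr0 subr_ge0; apply.
- by move=> x _; ct_auto.
- move=> x _; apply: der_eq; first by der_auto.
  by rewrite /=; field; rewrite addrC natr1 pnatr_eq0.
- move=> x /andP[x0 x4]; have := sol_lower sol p2 l01 (ltW x0) => wx.
  by rewrite mulr_ge0 ?exprn_ge0 ?(ltW x0)// expr2; order_nra.
Qed.

Lemma mass_integral_close l w z M r e : 2 < p -> 0 <= l <= 1 -> is_sol n p l w z ->
  is_mass_integral w M -> 0 < r -> 0 < e -> exists2 d, 0 < d &
  forall l' w' z' M' r', 0 <= l' <= 1 -> `|l' - l| < d -> is_sol n p l' w' z' ->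
  is_mass_integral w' M' -> 0 <= r' -> `|r' - r| < d -> `|M' r' - M r| < e.
Proof.
move=> p2 l01 sol [M0 dM] r0 e0; have e2 : 0 < e / 2 by rewrite divr_gt0.
have [d1 d10 Hd1] := epsdeltaP (der_cont (dM r)) e2.
have rN : 0 < (r + 1) ^+ n.+1 by rewrite exprn_gt0//; order_lra.
have e3 : 0 < e / 4 / (r + 1) ^+ n.+1 by rewrite !divr_gt0.
have r10 : 0 <= r + 1 by order_lra.
have [d2 d20 Hd2] := sol_close n p2 r10 e3.
exists (Num.min 1 (Num.min d1 d2)); first by rewrite !lt_min ltr01 d10.
move=> l' w' z' M' r' l'01 l'd sol' [M'0 dM'] r'0 r'd.
have [r'1 [r'd1 _]] : `|r' - r| < 1 /\ `|r' - r| < d1 /\ `|r' - r| < d2.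
  by move: r'd; rewrite !lt_min => /and3P[].
have l'd2 : `|l' - l| < d2 by move: l'd; rewrite !lt_min => /and3P[].
have {}Hd2 := Hd2 _ _ _ _ _ _ l'01 l01 l'd2 sol' sol.
set e' := e / 4 / _ in e3 Hd2.
have r'r : r' <= r + 1 by move: r'1; rewrite ltr_norml; order_lra.
have := @abs_incr_le _ (fun x => M' x - M x) (fun x => 2 * e' * x ^+ n.+1)
  (fun x => x ^+ n * w' x ^+ 2 - x ^+ n * w x ^+ 2) (fun x => 2 * e' * (n.+1%:R * x ^+ n)) 0 r' r'0.
rewrite M0 M'0 expr0n/= mulr0 !subr0 => H.
have {}H : `|M' r' - M r'| <= 2 * e' * r' ^+ n.+1.
  apply: H.
  - have cM : continuous M by move=> x; exact: der_cont (dM x).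
    by have cM' : continuous M' by [move=> x; exact: der_cont (dM' x)]; move=> x _; ct_auto.
  - by move=> x _; ct_auto.
  - by move=> x _; der_auto.
  - by move=> x _; apply: der_eq; [der_auto|rewrite /=; ring].
  - move=> x /andP[x0 xr]; rewrite -mulrBr normrM (ger0_norm (exprn_ge0 n (ltW x0))).
    have xx : 0 <= x <= r + 1 by rewrite (ltW x0) (le_trans (ltW xr)).
    have [H1 _] := Hd2 x xx.
    have ww : `|w' x ^+ 2 - w x ^+ 2| <= 2 * e'.
      rewrite subr_sqr normrM mulrC; apply: ler_pM => //; last exact: ltW.
      by apply: le_trans (ler_normD _ _) _; have := sol_w1 sol x; have := sol_w1 sol' x; clear - n p; order_lra.
    rewrite mulrCA mulrA [leRHS]mulrC; have xn := exprn_ge0 n (ltW x0).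
    apply: ler_wpM2l => //; apply: le_trans ww _; rewrite ler_peMl ?ler1n// mulr_ge0// ltW//.
have e'r : 2 * e' * r' ^+ n.+1 <= e / 2.
  have : r' ^+ n.+1 <= (r + 1) ^+ n.+1 by rewrite lerXn2r ?nnegrE.
  move=> H1; have := ler_wpM2l (ltW e3) H1; rewrite /e' divfK ?gt_eqF//; clear - n p; order_lra.
have := Hd1 r' r'd1 => H2.
have -> : M' r' - M r = (M' r' - M r') + (M r' - M r) by ring.
by apply: le_lt_trans (ler_normD _ _) _; clear - n p H H2 e'r; order_lra.
Qed.

(** The initial energy $1/p-l/2$ is zero for this parameter, too low for a second zero. *)
Lemma no_up_cross w z : 2 < p -> is_sol n p (2 / p) w z -> ~ up_cross w.
Proof.
move=> p2 sol uc; have p0 : 0 < p by order_lra.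
have l01 : 0 <= 2 / p <= 1 by rewrite divr_ge0 ?(ltW p0)//= ler_pdivrMr//; order_lra.
have [r1 [r2 tz]] := two_zeros_exist sol p2 l01 uc.
have r20 : 0 <= (0 : R) <= r2 by rewrite lexx/= ltW// (r2_gt0 tz).
have := energy_pos sol tz p2 l01 r20; rewrite (energy_at0 sol).
by rewrite (_ : 1 / p - 2 / p / 2 = 0) ?ltxx//; field; rewrite gt_eqF.
Qed.

Theorem radial_family : 2 < p -> (n%:R - 1) * (p - 2) < 4 -> 4 / (p - 2) < n.+1%:R ->
  exists l0 m0 : R, 0 < l0 /\ 0 < m0 /\ forall m, 0 < m -> m < m0 ->
  exists l w z M r1 r2, l0 <= l < 2 / p /\ [/\ is_sol n p l w z, two_zeros w r1 r2,
    is_mass_integral w M & r2 `^ (- (n.+1%:R - 4 / (p - 2))) * M r2 = m].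
Proof.
move=> p2 sub sup; have p0 : 0 < p by order_lra.
set q := n.+1%:R - 4 / (p - 2); have q0 : 0 < q by rewrite subr_gt0.
have lp1 : 2 / p < 1 by rewrite ltr_pdivrMr//; order_lra.
have lp0 : 0 < 2 / p by rewrite divr_gt0.
(* An arbitrary choice of solutions suffices, because [sol_dependence] makes any such family
   continuous in $l$. *)
have /choice[S HS] (l : R) : exists wzM : (R -> R) * (R -> R) * (R -> R), 0 <= l < 1 ->
    is_sol n p l wzM.1.1 wzM.1.2 /\ is_mass_integral wzM.1.1 wzM.2.
  have [l01|nl] := pselect (0 <= l < 1 : Prop); last by exists (id, id, id).
  have [[w z] sol] := @sol_exists R n p l p2 l01.
  by have [M HM] := mass_integral_exists sol; exists (w, z, M).
pose W l := (S l).1.1; pose Z l := (S l).1.2; pose M l := (S l).2.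
have sol l : 0 <= l < 1 -> is_sol n p l (W l) (Z l) by move=> /HS[].
have mi l : 0 <= l < 1 -> is_mass_integral (W l) (M l) by move=> /HS[].
(* Requiring a crossing on the whole of $[0,l]$ makes [A] an interval, so that its supremum is the
   first failure rather than just some failure. *)
pose A := [set l : R | 0 <= l <= 2 / p /\ forall l', 0 <= l' <= l -> up_cross (W l')].
have A0 : A 0.
  split; first by rewrite lexx ltW.
  move=> l'; rewrite andbC -eq_le => /eqP ->; apply: (lane_emden_up_cross p2 sub (z := Z 0)).
  by apply: sol; rewrite lexx ltr01.
have hA : has_sup A by split; [exists 0|exists (2 / p) => x [/andP[]]].
pose ls := reals.sup A.
have ls0 : 0 <= ls by apply: ub_le_sup => //; exists (2 / p) => x [/andP[]].
have lsp : ls <= 2 / p by apply: ge_sup; [exists 0|move=> x [/andP[]]].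
have below l : 0 <= l -> l < ls -> up_cross (W l).
  move=> l0 ll; have ll' : 0 < ls - l by rewrite subr_gt0.
  have [x [x2 Hx]] := sup_adherent ll' hA; rewrite -/ls opprB addrC subrK => lx.
  by apply: Hx; rewrite l0 ltW.
have l01 l : 0 <= l -> l <= 2 / p -> 0 <= l < 1 by move=> -> h; rewrite (le_lt_trans h).
have l01' l : 0 <= l -> l <= 2 / p -> 0 <= l <= 1 by move=> -> h; rewrite ltW// (le_lt_trans h).
(* A crossing at the supremum would persist slightly to its right by stability, and there is room to
   the right since $2/p$ itself does not cross. *)
have nuc : ~ up_cross (W ls).
  move=> uc; have lsp' : ls < 2 / p.
    rewrite lt_neqAle lsp andbT; apply/eqP => E; apply: (@no_up_cross (W ls) (Z ls)) => //.
    by rewrite -[X in is_sol _ _ X]E; apply: sol; exact: l01.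
  have sls := sol _ (l01 _ ls0 lsp).
  have [r1 [r2 tz]] := two_zeros_exist sls p2 (l01' _ ls0 lsp) uc.
  have [d d0 Hd] := two_zeros_stable p2 (l01 _ ls0 lsp) sls tz ltr01.
  pose x := Num.min (ls + d / 2) (2 / p).
  have lx : ls < x by rewrite /x lt_min lsp' andbT; order_lra.
  have xp : x <= 2 / p by rewrite /x ge_min lexx orbT.
  have xd : x <= ls + d / 2 by rewrite /x ge_min lexx.
  have : A x.
    split; first by rewrite xp andbT (le_trans ls0)// ltW.
    move=> l' /andP[l'0 l'x]; have [ll|ll] := ltP l' ls; first exact: below.
    have l'p : l' <= 2 / p by exact: le_trans xp.
    have [|s1 [s2 [tz' _]]] := Hd l' (W l') (Z l') (l01' _ l'0 l'p) _ (sol _ (l01 _ l'0 l'p)).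
      by rewrite ger0_norm ?subr_ge0//; order_lra.
    have zr := z_r2 (sol _ (l01 _ l'0 l'p)) tz' p2 (l01' _ l'0 l'p).
    have [/andP[s10 s12] ws1 ws2 _ wn] := tz'.
    have [e e0 He] := der_pos_loc (sol_dw (sol _ (l01 _ l'0 l'p)) s2) zr.
    exists ((s1 + s2) / 2), (s2 + e / 2); split; [by clear - n p s10 s12; order_lra|by clear - n p s12 e0; order_lra| |].
    - by apply: wn; apply/andP; split; clear - n p s12; order_lra.
    - have [|+ _] := He (s2 + e / 2); first by rewrite addrAC subrr add0r gtr0_norm//; clear - n p e0; order_lra.
      by rewrite ws2 ltrDl; apply; clear - n p e0; order_lra.
  by move=> Ax; have : x <= ls by [apply: ub_le_sup => //; exists (2 / p) => y [/andP[]]]; order_lra.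
have ls_gt0 : 0 < ls.
  rewrite lt_neqAle ls0 andbT; apply/eqP => E; apply: nuc; rewrite -E.
  by case: A0 => _; apply; rewrite lexx.
have /choice[r2 Hr2] (l : R) : exists r2, 0 <= l < ls -> exists r1, two_zeros (W l) r1 r2.
  have [ll|nl] := pselect (0 <= l < ls : Prop); last by exists 0.
  have /andP[l0 lls] := ll; have lp := le_trans (ltW lls) lsp.
  have [r1 [r2 tz]] := two_zeros_exist (sol _ (l01 _ l0 lp)) p2 (l01' _ l0 lp) (below _ l0 lls).
  by exists r2 => _; exists r1.
pose mf l := r2 l `^ (- q) * M l (r2 l).
have cr2 l : 0 < l -> l < ls -> ctat r2 l.
  move=> l0 lls; have lp := le_trans (ltW lls) lsp; have ll : 0 <= l < ls by rewrite ltW.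
  have [r1 tz] := Hr2 l ll.
  apply: epsdelta => e e0.
  have [d d0 Hd] := two_zeros_stable p2 (l01 _ (ltW l0) lp) (sol _ (l01 _ (ltW l0) lp)) tz e0.
  exists (Num.min d (Num.min l (ls - l))); first by rewrite !lt_min d0 l0 subr_gt0.
  move=> l'; rewrite !lt_min => /and3P[l'd l'l l'ls].
  have l'0 : 0 <= l' by move: l'l; rewrite ltr_norml; order_lra.
  have l's : l' < ls by move: l'ls; rewrite ltr_norml; order_lra.
  have l'p := le_trans (ltW l's) lsp; have ll' : 0 <= l' < ls by rewrite l'0.
  have [s1 [s2 [tz' s2r]]] := Hd l' _ _ (l01' _ l'0 l'p) l'd (sol _ (l01 _ l'0 l'p)).
  have [r1' tz''] := Hr2 l' ll'.
  by have [_ <-] := two_zeros_unique tz' tz''.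
have cmf l : 0 < l -> l < ls -> {for l, continuous mf}.
  move=> l0 lls; have lp := le_trans (ltW lls) lsp; have ll : 0 <= l < ls by rewrite ltW.
  have [r1 tz] := Hr2 l ll; have r20 := r2_gt0 tz.
  apply: (@ctM _ (fun l => r2 l `^ (- q)) (fun l => M l (r2 l))).
    apply: (@ct_comp _ r2 (fun x => x `^ (- q))); first exact: cr2.
    exact: der_cont (der_powR (- q) r20 (der_id (r2 l))).
  apply: epsdelta => e e0.
  have [d1 d10 Hd1] := mass_integral_close p2 (l01' _ (ltW l0) lp) (sol _ (l01 _ (ltW l0) lp))
    (mi _ (l01 _ (ltW l0) lp)) r20 e0.
  have [d2 d20 Hd2] := epsdeltaP (cr2 l l0 lls) d10.
  exists (Num.min (Num.min d1 d2) (Num.min l (ls - l))); first by rewrite !lt_min d10 d20 l0 subr_gt0.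
  move=> l'; rewrite !lt_min => /andP[/andP[l'd1 l'd2] /andP[l'l l'ls]].
  have l'0 : 0 <= l' by move: l'l; rewrite ltr_norml; order_lra.
  have l's : l' < ls by move: l'ls; rewrite ltr_norml; order_lra.
  have l'p := le_trans (ltW l's) lsp; have ll' : 0 <= l' < ls by rewrite l'0.
  have [r1' tz'] := Hr2 l' ll'.
  apply: (Hd1 l' (W l') (Z l')); [exact: l01'|exact: l'd1|exact: sol (l01 _ l'0 l'p)| | |].
  - exact: mi (l01 _ l'0 l'p).
  - exact: ltW (r2_gt0 tz').
  - exact: Hd2.
(* Any value strictly between $0$ and [ls] would do. It bounds $l$ from below, for the mass estimate
   and for lambda, and the mass at [l0] becomes the threshold. *)
pose l0 := ls / 2; have l00 : 0 < l0 by rewrite divr_gt0.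
have l0s : l0 < ls by rewrite /l0; order_lra.
have [C HC] := mass_integral_bound n p2 l00.
pose C1 := `|C| + 1; have C10 : 0 < C1 by rewrite ltr_wpDl.
have bound l : l0 <= l -> l < ls -> M l (r2 l) <= C1.
  move=> l0l lls; have l0' : 0 <= l by rewrite (le_trans (ltW l00)).
  have ll : 0 <= l < ls by rewrite l0'.
  have lp := le_trans (ltW lls) lsp; have [r1 tz] := Hr2 l ll.
  have [M0 dM] := mi _ (l01 _ l0' lp).
  have := HC l (W l) (Z l) (M l) r1 (r2 l) l0l (lt_le_trans lls lsp) (sol _ (l01 _ l0' lp)) tz M0 dM.
  by have := ler_norm C; rewrite /C1; order_lra.
have l0p := le_trans (ltW l0s) lsp; have ll0 : 0 <= l0 < ls by rewrite (ltW l00).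
exists l0, (mf l0); split; first exact: l00.
split.
  have [r1 tz] := Hr2 l0 ll0; have r20 := r2_gt0 tz.
  rewrite /mf mulr_gt0 ?powR_gt0//.
  have so := sol _ (l01 _ (ltW l00) l0p); have mo := mi _ (l01 _ (ltW l00) l0p).
  have h4 : (0 : R) <= 1 / 4 by order_lra.
  have r24 : 1 / 4 <= r2 l0.
    have := sol_lower so p2 (l01' _ (ltW l00) l0p) (ltW r20).
    by have [_ _ -> _ _] := tz; order_lra.
  apply: lt_le_trans (mass_integral_nondecr mo h4 r24).
  apply: lt_le_trans (mass_integral_lower p2 (l01' _ (ltW l00) l0p) so mo).
  by rewrite divr_gt0 ?mulr_gt0// exprn_gt0//; order_lra.
move=> m m0 mm0; have Cm : 0 < C1 / m by rewrite divr_gt0.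
(* A second zero beyond this radius brings the mass factor times the uniform integral bound below
   [m]. *)
pose T := (C1 / m) `^ q^-1 + 1; have T0 : 0 < T by rewrite /T ltr_wpDl ?powR_ge0.
have CT : C1 * T `^ (- q) < m.
  rewrite powRN ltr_pdivrMr ?powR_gt0// mulrC -ltr_pdivrMr//.
  have -> : C1 / m = ((C1 / m) `^ q^-1) `^ q by rewrite -powRrM mulVf ?gt_eqF// powRr1// ltW.
  by rewrite gt0_ltr_powR ?nnegrE ?powR_ge0 ?(ltW T0)// /T ltrDl.
have sls := sol _ (l01 _ ls0 lsp).
have [d d0 Hd] := two_zeros_unbounded p2 T (l01' _ ls0 lsp) sls nuc.
pose l1 := Num.max l0 (ls - d / 2).
have l1s : l1 < ls by rewrite /l1 gt_max l0s/=; order_lra.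
have l01l : l0 <= l1 by rewrite /l1 le_max lexx.
have l1d : ls - d / 2 <= l1 by rewrite /l1 le_max lexx orbT.
have l10 : 0 <= l1 by order_lra.
have l1p := le_trans (ltW l1s) lsp; have ll1 : 0 <= l1 < ls by rewrite l10.
have mf1 : mf l1 <= m.
  have [r1 tz] := Hr2 l1 ll1; have r20 := r2_gt0 tz.
  have Tr : T < r2 l1.
    apply: (Hd l1 (W l1) (Z l1) r1 (r2 l1)) => //; [exact: l01'| |exact: sol (l01 _ l10 l1p)].
    by rewrite ltr0_norm ?subr_lt0//; clear - n p d0 l1d; order_lra.
  apply: le_trans (ltW CT); rewrite /mf mulrC; apply: ler_pM.
  - have h4 : (0 : R) <= r2 l1 by exact: ltW.
    have mo := mi _ (l01 _ l10 l1p); have [M0 _] := mo.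
    by rewrite -M0; exact: mass_integral_nondecr mo (lexx 0) h4.
  - exact: powR_ge0.
  - exact: bound.
  - rewrite !powRN lef_pV2 ?posrE ?powR_gt0// ge0_ler_powR ?nnegrE ?(ltW q0) ?(ltW T0) ?(ltW r20)//.
    exact: ltW.
have [||l /andP[l0l ll1'] ml] := @ivt _ mf l0 l1 m l01l.
- move=> x /andP[x0 x1]; apply: cmf; [exact: lt_le_trans x0|exact: le_lt_trans l1s].
- by apply/orP; right; rewrite mf1 ltW.
have lls : l < ls by exact: le_lt_trans l1s.
have l0' : 0 <= l by rewrite (le_trans (ltW l00)).
have lp := le_trans (ltW lls) lsp; have ll : 0 <= l < ls by rewrite l0'.
have [r1 tz] := Hr2 l ll.
exists l, (W l), (Z l), (M l), r1, (r2 l); rewrite l0l (lt_le_trans lls lsp); split => //; split => //.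
- exact: sol (l01 _ l0' lp).
- exact: mi (l01 _ l0' lp).
Qed.

End family.

(** * The Pohozaev identity *)

Section radial_energy.
Context {R : realType} (n : nat) (p : R).

Definition is_energy_integral (w z G P : R -> R) :=
  [/\ G 0 = 0, P 0 = 0, forall r, hasD G r (r ^+ n * z r ^+ 2) &
    forall r, hasD P r (r ^+ n * `|w r| `^ p)].

Lemma powR_pw (x : R) : 2 < p -> `|x| `^ p = pw p x * x.
Proof.
move=> p2; have [->|x0] := eqVneq x 0.
  by rewrite normr0 powR0 ?mulr0// gt_eqF//; order_lra.
have nx : 0 < `|x| by rewrite normr_gt0.
rewrite /pw -mulrA -expr2 -real_normK ?num_real// -powR_mulrn ?normr_ge0// -powRD; last first.
  by rewrite (gt_eqF nx) implybT.
by congr (_ `^ _); ring.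
Qed.

Variables (l : R) (w z : R -> R).
Hypothesis sol : is_sol n p l w z.

Lemma continuous_powR_sol : 2 < p -> continuous (fun r : R => `|w r| `^ p).
Proof.
move=> p2; have -> : (fun r => `|w r| `^ p) = fun r => pw p (w r) * w r.
  by apply/funext => r; exact: powR_pw.
have cw := sol_cw sol; have cpw := @continuous_pw R p p2.
move=> r; apply ctat_cont; apply: ctM; last exact: ct_hyp.
by apply: (@ct_comp _ w (pw p)); exact: ct_hyp.
Qed.

Lemma energy_integral_exists : 2 < p -> exists G P, is_energy_integral w z G P.
Proof.
move=> p2; have cz := sol_cz sol; have cwp := continuous_powR_sol p2.
have cg : continuous (fun r : R => r ^+ n * z r ^+ 2) by move=> r; ct_auto.
have cp : continuous (fun r : R => r ^+ n * `|w r| `^ p).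
  by move=> r; apply ctat_cont; apply: ctM; [apply: ctX; exact: ct_id|exact: ct_hyp].
have [G G0 dG] := primitive cg; have [P P0 dP] := primitive cp.
by exists G, P.
Qed.

Variables (G P : R -> R).
Hypothesis GP : is_energy_integral w z G P.

Lemma potential_lower r : 2 < p -> 0 <= l <= 1 -> 1 / 4 <= r ->
  (1 / 2) `^ p * (1 / 4) ^+ n.+1 / n.+1%:R <= P r.
Proof.
move=> p2 l01 r4; have [_ P0 _ dP] := GP; have q0 : (0 : R) <= 1 / 4 by order_lra.
have cP : continuous P by move=> x; exact: der_cont (dP x).
have h0 : (0 : R) < 1 / 2 by order_lra.
have H1 : P (1 / 4) <= P r.
  apply: (@nondecr _ P (fun r => r ^+ n * `|w r| `^ p) _ _ r4) => [x _|x _|x /andP[x4 _]].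
  - exact: cP.
  - exact: dP.
  - by rewrite mulr_ge0 ?powR_ge0// exprn_ge0//; order_lra.
apply: le_trans H1.
have := @nondecr _ (fun r => P r - (1 / 2) `^ p / n.+1%:R * r ^+ n.+1)
  (fun r => r ^+ n * (`|w r| `^ p - (1 / 2) `^ p)) 0 (1 / 4) q0.
rewrite P0 expr0n/= mulr0 subr0 subr_ge0 mulrAC; apply.
- by move=> x _; ct_auto.
- move=> x _; apply: der_eq; first by der_auto.
  by rewrite /=; field; rewrite addrC natr1 pnatr_eq0.
- move=> x /andP[x0 x4]; have := sol_lower sol p2 l01 (ltW x0) => wx.
  apply: mulr_ge0; first exact: exprn_ge0 (ltW x0).
  have p0 : 0 <= p by order_lra.
  rewrite subr_ge0; apply: (ge0_ler_powR p0); rewrite ?nnegrE ?normr_ge0 ?(ltW h0)//.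
  by apply: le_trans (ler_norm _); order_lra.
Qed.

(** The multiple $\frac{n+1}{2}r^nwz$ is now chosen to cancel $lw^2$, so that the inequality is free
    of the parameter. [D] is constant, and of its boundary terms at $r_2$ only the energy is
    left. *)
Lemma pohozaev_ball r1 r2 : 2 < p -> 0 <= l <= 1 -> two_zeros w r1 r2 ->
  n.+1%:R * (1 / 2 - 1 / p) * P r2 <= G r2.
Proof.
move=> p2 l01 tz; have [G0 P0 dG dP] := GP; have r20 := r2_gt0 tz.
have cw := sol_cw sol; have cz := sol_cz sol; have ce := continuous_energy_at sol p2.
have cG : continuous G by move=> x; exact: der_cont (dG x).
have cP : continuous P by move=> x; exact: der_cont (dP x).
pose E := energy_at p l w z.
pose D r := G r - n.+1%:R * (1 / 2 - 1 / p) * P r - (r ^+ n.+1 * E r + n.+1%:R / 2 * (r ^+ n * z r * w r)).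
have D0 : D 0 = 0.
  by rewrite /D G0 P0 (sol_z0 sol (lexx 0)) (expr0n _ n.+1)/=; ring.
have cE : continuous E by exact: ce.
have : D 0 <= D r2.
  apply: (@nondecr _ D (fun=> 0) _ _ (ltW r20)) => [x _|x /andP[x0 _]|//].
    by rewrite /D; ct_auto.
  have dE : hasD E x (- (n%:R / x * z x ^+ 2)) by exact: der_energy_at.
  have dz := sol_dz sol x0; have drz := der_rnz w x0 dz; have dw := sol_dw sol x.
  apply: der_eq; first by rewrite /D; der_auto.
  rewrite /E /energy_at /Nl powR_pw//= /nl -[n.+1%:R]natr1 (exprS x n).
  have pp : p != 0 by rewrite gt_eqF//; order_lra.
  by field; rewrite pp gt_eqF.
have := energy_pos sol tz p2 l01; rewrite D0 /D => /(_ r2); rewrite lexx ltW// => /(_ isT) Ep.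
have [_ _ -> _ _] := tz; rewrite mulr0 mulr0 addr0 => H.
have : 0 <= r2 ^+ n.+1 * E r2 by rewrite mulr_ge0 ?exprn_ge0 ?ltW.
by move: H; move: (r2 ^+ _ * _) (_ * P r2) => a b; order_lra.
Qed.
End radial_energy.

(** * Smooth functions and test functions *)

Section flat.
Context {R : realType}.
Implicit Types (Q : {poly R}) (t : R).

(** Carrying a polynomial in $1/t$ makes the family closed under differentiation, with [bump_der] as
    the new polynomial; the usual flat function is the case $Q=1$. *)
Definition flat Q t : R := if 0 < t then Q.[t^-1] * expR (- t^-1) else 0.
Definition bump_der Q : {poly R} := 'X^2 * (Q - Q^`()).

Lemma poly_expR_bound Q : exists2 C : R, 0 <= C & forall y, 0 <= y -> `|Q.[y]| * expR (- y) <= C.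
Proof.
(* The extra power of $y$ is needed for the induction, where each Horner step multiplies by $y$. *)
suff H m : exists2 C : R, 0 <= C & forall y, 0 <= y -> `|Q.[y]| * y ^+ m * expR (- y) <= C.
  by have [C C0 HC] := H 0%N; exists C => // y /HC; rewrite expr0 mulr1.
elim/poly_ind: Q m => [|Q c IH] m.
  by exists 0 => // y _; rewrite horner0 normr0 !mul0r.
have [C C0 HC] := IH m.+1; exists (C + `|c| * (m.+1)`!%:R * 2).
  by rewrite addr_ge0// mulr_ge0// mulr_ge0.
move=> y y0; rewrite !hornerE; have ym := exprn_ge0 m y0; have e0 := expR_ge0 (- y).
have ye : y ^+ m * expR (- y) <= (m.+1)`!%:R * 2.
  have f1 : 1 <= (m.+1)`!%:R :> R by rewrite ler1n fact_gt0.
  have f0 : 0 < (m.+1)`!%:R :> R by rewrite ltr0n fact_gt0.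
  have := expR_ge1Dxn m y0; rewrite expRN ler_pdivrMr ?expR_gt0// => H.
  have {}H : (m.+1)`!%:R + y ^+ m.+1 <= (m.+1)`!%:R * expR y.
    by have := ler_wpM2l (ltW f0) H; rewrite mulrDr mulr1 mulrCA divff ?mulr1// gt_eqF.
  have [y1|y1] := leP y 1.
    by have := exprn_ile1 m y0 y1; have := exprn_ge0 m.+1 y0; order_lra.
  have : y ^+ m <= y ^+ m.+1 by rewrite exprS ler_peMl// ltW.
  by have := expR_ge0 y; order_nra.
have := HC y y0; rewrite exprS => H.
apply: le_trans (_ : (`|Q.[y] * y| + `|c|) * y ^+ m * expR (- y) <= _).
  by rewrite ler_wpM2r// ler_wpM2r// ler_normD.
rewrite normrM (ger0_norm y0) !mulrDl; apply: lerD; first by rewrite -!mulrA; rewrite -!mulrA in H.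
by rewrite -!mulrA ler_wpM2l// mulrA.
Qed.

(** Quadratic vanishing gives the derivative $0$ at the origin, for every polynomial at once; it is
    the boundedness of $Q(y)y^2e^{-y}$ at $y=1/t$. *)
Lemma bump_sqr_bound Q : exists2 C : R, 0 <= C & forall t, `|flat Q t| <= C * t ^+ 2.
Proof.
have [C C0 HC] := poly_expR_bound (Q * 'X^2); exists C => // t; rewrite /flat.
case: ifPn => t0; last by rewrite normr0 mulr_ge0// sqr_ge0.
have ti : 0 <= t^-1 by rewrite invr_ge0 ltW.
have := HC _ ti; rewrite hornerM hornerXn normrM (ger0_norm (exprn_ge0 2 ti)).
rewrite normrM (ger0_norm (expR_ge0 _)) => H.
have t2 : 0 < t ^+ 2 by rewrite exprn_gt0.
have := ler_wpM2r (ltW t2) H; congr (_ <= _).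
by field; rewrite gt_eqF.
Qed.

Lemma der_bump Q t : hasD (flat Q) t (flat (bump_der Q) t).
Proof.
have [t0|t0|t0] := ltgtP 0 t; last rewrite -t0.
- apply: (@near_eq_is_derive _ _ _ (fun t => Q.[t^-1] * expR (- t^-1))).
    near=> s; rewrite /flat ifT//; near: s; exact: lt_nbhsr.
  have tn : t != 0 by rewrite gt_eqF.
  have dV := derV tn (der_id t).
  have dQ : hasD (horner Q) t^-1 (Q^`()).[t^-1].
    exact: is_derive_poly.
  apply: der_eq.
    by apply: derM; [exact: der_comp dV dQ|apply: der_expR; apply: derN; exact: dV].
  rewrite /flat t0 /bump_der /= hornerM hornerXn hornerD hornerN.
  by field.
- rewrite {2}/flat ltNge ltW//=.
  apply: (near_eq_is_derive _ (der_cst 0 t)).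
  near=> s; rewrite /flat ifF//; apply/negbTE; rewrite -leNgt ltW//; near: s; exact: lt_nbhsl.
- rewrite {2}/flat ltxx.
  have [C C0 HC] := bump_sqr_bound Q; apply: hasD_eps => e e0.
  exists (e / (C + 1)); first by rewrite divr_gt0// ltr_wpDl.
  move=> y; rewrite !subr0 mul0r subr0 {2}/flat ltxx subr0 => yd.
  apply: le_trans (HC y) _; rewrite -real_normK ?num_real// expr2 mulrA ler_wpM2r//.
  move: yd; rewrite ltr_pdivlMr ?ltr_wpDl//; have := normr_ge0 y; order_lra.
Unshelve. all: by end_near. Qed.

Lemma bump1 t : 0 < t -> flat 1 t = expR (- t^-1).
Proof. by move=> t0; rewrite /flat t0 hornerC mul1r. Qed.

Lemma bump1_bound t : 0 <= flat 1 t <= 1.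
Proof.
rewrite /flat; case: ifPn => t0; last by rewrite lexx ler01.
by rewrite hornerC mul1r expR_ge0/= -expR0 ler_expR oppr_le0 invr_ge0 ltW.
Qed.

Lemma bump_le0 Q t : t <= 0 -> flat Q t = 0.
Proof. by move=> t0; rewrite /flat ltNge t0. Qed.

End flat.

(** * Calculus of partial derivatives *)

Section partial_derivatives.
Context {R : realType} {n : nat}.
Implicit Types (f g : 'rV[R]_n -> R) (i : 'I_n) (x : 'rV[R]_n) (a b d : R).

Definition has_partial i f x d := is_derive x (delta_mx 0 i : 'rV[R]_n) f d.

Lemma hasP_line i f x d : has_partial i f x d <-> hasD (fun t : R => f (x + t *: delta_mx 0 i)) 0 d.
Proof.
have E : (fun h : R => h^-1 *: ((f \o shift x) (h *: (delta_mx 0 i : 'rV[R]_n)) - f x)) =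
  (fun h : R => h^-1 *: (((fun t : R => f (x + t *: delta_mx 0 i)) \o shift 0) (h *: (1 : R)) - f (x + 0 *: delta_mx 0 i))).
  apply/funext => h /=; rewrite scale0r !addr0; congr (_ *: (f _ - _)).
  by rewrite addrC; congr (_ + _ *: _); rewrite [_ *: _]mulr1.
split => -[h1 h2]; split.
- by rewrite /derivable -E.
- by rewrite -h2 /derive -E.
- by rewrite /derivable E.
- by rewrite -h2 /derive E.
Qed.

Lemma hasP_along i f (D : 'rV[R]_n -> R) x (t : R) : (forall y, has_partial i f y (D y)) ->
  hasD (fun t : R => f (x + t *: delta_mx 0 i)) t (D (x + t *: delta_mx 0 i)).
Proof.
move=> H; have /hasP_line h := H (x + t *: delta_mx 0 i).
have tt : hasD (fun s => s - t) t 1 by have := derD (der_id t) (der_cst (- t) t); rewrite addr0.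
have h' : hasD (fun s : R => f (x + t *: delta_mx 0 i + s *: delta_mx 0 i)) (t - t)
  (D (x + t *: delta_mx 0 i)) by rewrite subrr.
have := der_comp tt h'; rewrite /= ?mulr1 ?mul1r.
suff -> : (fun s : R => f (x + t *: delta_mx 0 i + (s - t) *: delta_mx 0 i)) =
  (fun s : R => f (x + s *: delta_mx 0 i)) by [].
by apply/funext => s; rewrite -addrA -scalerDl [t + _]addrC subrK.
Qed.

Lemma hasP_partial i f x d : has_partial i f x d -> partial i f x = d.
Proof. by case. Qed.

Lemma hasP_eq i f x a b : has_partial i f x a -> a = b -> has_partial i f x b.
Proof. by move=> ? <-. Qed.

Lemma hasP_differentiable i f x : differentiable f x -> has_partial i f x (partial i f x).
Proof. by move=> df; split => //; exact: diff_derivable. Qed.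

Lemma hasP_cst i (c : R) x : has_partial i (fun=> c) x 0.
Proof. by apply/hasP_line; exact: der_cst. Qed.

Lemma hasP_coord i j x : has_partial i (fun y => y 0 j) x (i == j)%:R.
Proof.
apply/hasP_line.
have h := derD (der_cst (x 0 j) 0) (derM (der_id 0) (der_cst (i == j)%:R (0 : R))).
rewrite [X in hasD _ _ X](_ : _ = 0 + (1 * (i == j)%:R + 0 * 0)); last by rewrite mul0r mul1r addr0 add0r.
rewrite (_ : (fun t : R => _) = (fun t => x 0 j + t * (i == j)%:R)); first exact: h.
by apply/funext => t; rewrite !mxE eqxx/= eq_sym.
Qed.

Lemma hasPD i f g x a b : has_partial i f x a -> has_partial i g x b -> has_partial i (fun y => f y + g y) x (a + b).
Proof. by move=> /hasP_line df /hasP_line dg; apply/hasP_line; exact: derD. Qed.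

Lemma hasPN i f x a : has_partial i f x a -> has_partial i (fun y => - f y) x (- a).
Proof. by move=> /hasP_line df; apply/hasP_line; exact: derN. Qed.

Lemma hasPM i f g x a b : has_partial i f x a -> has_partial i g x b ->
  has_partial i (fun y => f y * g y) x (a * g x + f x * b).
Proof.
move=> /hasP_line df /hasP_line dg; apply/hasP_line; apply: der_eq; first exact: derM df dg.
by rewrite /= scale0r addr0.
Qed.

Lemma hasP_comp i f (h : R -> R) x a b : has_partial i f x a -> hasD h (f x) b ->
  has_partial i (fun y => h (f y)) x (b * a).
Proof.
move=> /hasP_line df dh; apply/hasP_line.
have dh' : hasD h ((fun t : R => f (x + t *: delta_mx 0 i)) 0) b by rewrite /= scale0r addr0.
exact: der_comp df dh'.
Qed.

Lemma hasP_sum (I : finType) i (f : I -> 'rV[R]_n -> R) x (a : I -> R) :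
  (forall j, has_partial i (f j) x (a j)) -> has_partial i (fun y => \sum_j f j y) x (\sum_j a j).
Proof.
move=> H; rewrite !unlock.
elim: (index_enum I) => [|j s IH] /=; first exact: hasP_cst.
exact: hasPD.
Qed.

Lemma hasP_norm2 i x : has_partial i norm2 x (2 * x 0 i).
Proof.
apply: hasP_eq.
  by apply: hasP_sum => j; apply: hasPM; exact: hasP_coord.
rewrite (bigD1 i)//= big1 ?addr0; last first.
  by move=> j ji; rewrite eq_sym (negbTE ji) mul0r mulr0 addr0.
by rewrite eqxx mul1r mulr1; ring.
Qed.

End partial_derivatives.

(** * A class of smooth functions closed under partial derivatives *)

Section smooth_functions.
Context {R : realType} {n : nat}.
Implicit Types (f g : 'rV[R]_n -> R) (i : 'I_n) (x : 'rV[R]_n).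

(** A syntactic class: since partial derivatives stay inside it, smoothness, which speaks of all
    iterated derivatives, reduces to differentiability of its members. Sums, products and [flat] are
    enough for every test function below. *)
Inductive sm : ('rV[R]_n -> R) -> Prop :=
| sm_cst c : sm (fun=> c)
| sm_coord i : sm (fun x => x 0 i)
| sm_add f g : sm f -> sm g -> sm (fun x => f x + g x)
| sm_mul f g : sm f -> sm g -> sm (fun x => f x * g x)
| sm_bump Q f : sm f -> sm (fun x => flat Q (f x)).

Lemma sm_differentiable f x : sm f -> differentiable f x.
Proof.
elim=> {f} [c|i|f g _ df _ dg|f g _ df _ dg|Q f _ df].
- exact: differentiable_cst.
- exact: differentiable_coord.
- exact: differentiableD.
- exact: differentiableM.
- apply: differentiable_comp => //; apply/derivable1_diffP.
  by have [] := der_bump Q (f x).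
Qed.

Lemma sm_partial f i : sm f -> sm (partial i f).
Proof.
have P h x : sm h -> has_partial i h x (partial i h x).
  by move=> sh; apply: hasP_differentiable; exact: sm_differentiable.
elim=> {f} [c|j|f g sf df sg dg|f g sf df sg dg|Q f sf df].
- rewrite (_ : partial i _ = fun=> 0); first exact: sm_cst.
  by apply/funext => x; apply: hasP_partial; exact: hasP_cst.
- rewrite (_ : partial i _ = fun=> (i == j)%:R); first exact: sm_cst.
  by apply/funext => x; apply: hasP_partial; exact: hasP_coord.
- rewrite (_ : partial i _ = fun x => partial i f x + partial i g x); first exact: sm_add.
  by apply/funext => x; apply: hasP_partial; apply: hasPD; exact: P.
- rewrite (_ : partial i _ = fun x => partial i f x * g x + f x * partial i g x).
    by apply: sm_add; exact: sm_mul.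
  by apply/funext => x; apply: hasP_partial; apply: hasPM; exact: P.
- rewrite (_ : partial i _ = fun x => flat (bump_der Q) (f x) * partial i f x).
    by apply: sm_mul => //; exact: sm_bump.
  by apply/funext => x; apply: hasP_partial; apply: hasP_comp; [exact: P|exact: der_bump].
Qed.

Lemma sm_smooth f : sm f -> smooth f.
Proof.
move=> sf s x; apply: sm_differentiable.
by elim: s => //= i s; exact: sm_partial.
Qed.

Lemma sm_sum (I : finType) (f : I -> 'rV[R]_n -> R) : (forall j, sm (f j)) ->
  sm (fun x => \sum_j f j x).
Proof.
move=> H; rewrite unlock; elim: (index_enum I) => [|j s IH] /=; first exact: sm_cst.
exact: sm_add.
Qed.

Lemma sm_prod (I : finType) (f : I -> 'rV[R]_n -> R) : (forall j, sm (f j)) ->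
  sm (fun x => \prod_j f j x).
Proof.
move=> H; rewrite unlock; elim: (index_enum I) => [|j s IH] /=; first exact: sm_cst.
exact: sm_mul.
Qed.

Lemma sm_norm2 : sm norm2.
Proof. by apply: sm_sum => i; apply: sm_mul; exact: sm_coord. Qed.

Lemma sm_horner (P : {poly R}) f : sm f -> sm (fun x => P.[f x]).
Proof.
move=> sf; elim/poly_ind: P => [|P c IH].
  rewrite (_ : (fun _ => _) = fun=> 0); first exact: sm_cst.
  by apply/funext => x; rewrite horner0.
rewrite (_ : (fun _ => _) = fun x => P.[f x] * f x + c).
  by apply: sm_add; [exact: sm_mul|exact: sm_cst].
by apply/funext => x; rewrite !hornerE.
Qed.

Lemma sm_continuous f : sm f -> continuous f.
Proof. by move=> sf x; apply: differentiable_continuous; exact: sm_differentiable. Qed.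

Lemma norm2_ge0 x : 0 <= norm2 x.
Proof. by apply: sumr_ge0 => i _; rewrite -expr2 sqr_ge0. Qed.

Lemma coord_norm2 x i : x 0 i ^+ 2 <= norm2 x.
Proof.
rewrite /norm2 /dot (bigD1 i)//= expr2 lerDl; apply: sumr_ge0 => j _.
by rewrite -expr2 sqr_ge0.
Qed.

Lemma unit_ballE x : unit_ball n x <-> norm2 x < 1.
Proof. by rewrite /unit_ball /norm2 /dot /=; under eq_bigr do rewrite expr2. Qed.

Definition cube (M : R) : set 'rV[R]_n := [set v | forall j, `[- M, M]%classic (v 0 j)].

Lemma compact_cube M : compact (cube M).
Proof. exact (@rV_compact R n (fun=> `[- M, M]%classic) (fun=> @segment_compact R (- M) M)). Qed.

Lemma norm2_cube x : norm2 x <= 1 -> cube 1 x.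
Proof.
move=> x1 j; rewrite /= in_itv/= -ler_norml -(@expr_le1 _ 2)// real_normK ?num_real//.
exact: le_trans (coord_norm2 x j) x1.
Qed.

Lemma sm_test f (d : R) : 0 < d -> sm f -> (forall x, 1 - d <= norm2 x -> f x = 0) ->
  test_function f.
Proof.
move=> d0 sf f0; pose A := [set x : 'rV[R]_n | norm2 x <= 1 - d].
have clA : closed A.
  rewrite (_ : A = norm2 @^-1` [set y | y <= 1 - d]); last by [].
  by apply: closed_comp => [x _|]; [exact: sm_continuous sm_norm2 _|exact: closed_le].
have sA : closure [set x | f x != 0] `<=` A.
  rewrite [X in _ `<=` X](closure_id A).1//; apply: closure_subset => x /= /eqP fx.
  by rewrite /A/= leNgt; apply/negP => /ltW /f0.
split; first exact: sm_smooth.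
- apply: subclosed_compact sA; first exact: closed_closure.
  by apply: subclosed_compact clA (@compact_cube 1) _ => x /= xA; apply: norm2_cube; rewrite /A/= in xA; order_lra.
- by move=> x /sA xA; apply/unit_ballE; apply: le_lt_trans xA _; order_lra.
Qed.

End smooth_functions.

(** * Lebesgue measure and integration by parts *)

Section continuous_measurable.
Context {R : realType} {n : nat}.

Lemma measurable_box (A : 'I_n -> set R) : (forall i, measurable (A i)) ->
  measurable [set v : 'rV[R]_n | forall i, A i (v 0 i)].
Proof.
move=> mA; rewrite (_ : mkset _ = \big[setI/setT]_(i < n) (@rV_coord R n i @^-1` A i)).
  apply: bigsetI_measurable => i _; rewrite -[X in measurable X]setTI.
  exact: measurable_rV_coord.
rewrite -bigcap_seq; apply/seteqP; split=> x /= xA i; first by move=> _; exact: xA.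
by apply: (xA i); rewrite /= mem_index_enum.
Qed.

Lemma measurable_cube (M : R) : measurable (cube M : set 'rV[R]_n).
Proof. by apply: (measurable_box (A := fun=> _)) => i; exact: measurable_itv. Qed.

Lemma cube_measure (M : R) : 0 < M -> lebesgue_rV n (cube M) = ((2 * M) ^+ n)%:E.
Proof.
move=> M0; rewrite (@lebesgue_rV_box R n (fun=> `[(- M : R), M]%classic)); last first.
  by move=> i; exact: measurable_itv.
rewrite lebesgue_measure_itv/= lte_fin ifT; last by order_lra.
by rewrite -EFinB prodEFin prodr_const card_ord opprK; congr (_ ^+ _)%:E; ring.
Qed.

(* [f] is the pointwise limit of its values at the grid points of mesh [1/k.+1]. *)
Lemma continuous_measurable_rV (f : 'rV[R]_n -> R) : continuous f -> measurable_fun setT f.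
Proof.
move=> cf; pose q (k : nat) (v : 'rV[int]_n) : 'rV[R]_n := \row_i ((v 0 i)%:~R / k.+1%:R).
pose fl (k : nat) (x : 'rV[R]_n) : 'rV[int]_n := \row_i Num.floor (k.+1%:R * x 0 i).
apply: (@measurable_realfun.measurable_fun_cvg _ _ _ _ (fun k x => f (q k (fl k x)))).
- move=> k _ B mB; rewrite setTI.
  rewrite (_ : _ @^-1` B = \bigcup_(v : 'rV[int]_n) [set x | fl k x = v /\ B (f (q k v))]); last first.
    by apply/seteqP; split=> x /=; [move=> Bx; exists (fl k x)|move=> [v _ [<-]]].
  apply: countable_bigcupT_measurable; first exact: countableP.
  move=> v; have [Bv|Bv] := pselect (B (f (q k v))); last first.
    by rewrite (_ : [set _ | _] = set0)//; apply/seteqP; split=> x //= [].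
  rewrite (_ : [set _ | _] = [set x : 'rV[R]_n | forall i,
      `[(v 0 i)%:~R / k.+1%:R, (v 0 i + 1)%:~R / k.+1%:R[%classic (x 0 i)]).
    by apply: (measurable_box (A := fun i => `[_, _[%classic)) => i; exact: measurable_itv.
  apply/seteqP; split=> x /=.
    move=> [flx _] i; rewrite in_itv/= ler_pdivrMr// ltr_pdivlMr// mulrC.
    by have := congr1 (fun w : 'rV[int]_n => w 0 i) flx; rewrite !mxE => <-; exact: floor_itv.
  move=> H; split => //; apply/rowP => i; rewrite !mxE; apply: floor_def.
  by have := H i; rewrite in_itv/= ler_pdivrMr// ltr_pdivlMr// mulrC.
- move=> x _; apply: (@cvg_comp _ _ _ (fun k => q k (fl k x)) f _ (nbhs (x : 'rV[R]_n)) _ _ (cf x)).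
  apply/cvgrPdist_lt => e e0; near=> k.
  rewrite [X in X < _]mx_normrE; apply/bigmax_ltP; split => //= -[i j] _ /=.
  rewrite !mxE/= ord1; have k0 : 0 < k.+1%:R :> R by [].
  have /andP[f1 f2] := floor_itv (k.+1%:R * x 0 j).
  rewrite -(ltr_pM2l k0) -[X in X * `|_|](gtr0_norm k0) -normrM mulrBr mulrCA divff ?gt_eqF// mulr1.
  have ke : 1 < k.+1%:R * e.
    have : k.+1%:R^-1 < e by near: k; exact: (near_infty_natSinv_lt (PosNum e0)).
    by rewrite -(ltr_pM2l k0) divff ?gt_eqF.
  rewrite ger0_norm ?subr_ge0//; move: f2; rewrite intrD; order_lra.
Unshelve. all: by end_near. Qed.

End continuous_measurable.

Section ball_integrals.
Context d (T : measurableType d) {R : realType} (mu : {measure set T -> \bar R}).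

(** The measure is the sum of its restrictions to [B] and to the complement, and the integral
    against the second vanishes. *)
Lemma integral_restr (B : set T) (mB : measurable B) (f : T -> R) :
  mu.-integrable setT (EFin \o f) -> (forall x, ~ B x -> f x = 0) ->
  \int[mrestr mu mB]_x f x = \int[mu]_x f x.
Proof.
move=> intf f0; congr fine; have mC := measurableC mB.
have /integrableP[mf intf'] := intf.
pose m1 : {measure set T -> \bar R} := mrestr mu mB.
pose m2 : {measure set T -> \bar R} := mrestr mu mC.
have muE A : measurable A -> A `<=` setT -> mu A = measure_add m1 m2 A.
  move=> mA _; rewrite measure_addE /m1 /m2/= /mrestr -measureU//; last 3 first.
  - exact: measurableI.
  - exact: measurableI.
  - by rewrite setIACA setICr setI0.
  by rewrite -setIUr setUv setIT.
have mnf : measurable_fun [set: T] (fun x => `|(EFin \o f) x|%E) by apply: measurableT_comp.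
have fin : (\int[m1]_x `|(EFin \o f) x| + \int[m2]_x `|(EFin \o f) x| < +oo)%E.
  rewrite -ge0_integral_measure_add//.
  by rewrite -(eq_measure_integral (measure_add m1 m2) (m1 := mu)).
have int1 : m1.-integrable setT (EFin \o f).
  apply/integrableP; split => //; apply: le_lt_trans fin; rewrite leeDl//.
  exact: integral_ge0.
have int2 : m2.-integrable setT (EFin \o f).
  apply/integrableP; split => //; apply: le_lt_trans fin; rewrite leeDr//.
  exact: integral_ge0.
rewrite [RHS](eq_measure_integral (measure_add m1 m2))// integral_measure_add//.
rewrite [X in (_ + X)%E](_ : _ = 0%E) ?adde0//.
rewrite (negligible_integral mB measurableT int2); last first.
  by rewrite /m2/= /mrestr setICr measure0.
by rewrite setTD; apply: integral0_eq => x Bx /=; rewrite f0.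
Qed.

End ball_integrals.

Section integration_by_parts.
Context {R : realType}.

Lemma integral_derivative (F G : R -> R) (M : R) : continuous G -> (forall t, hasD F t (G t)) ->
  (forall t, M < `|t| -> F t = 0 /\ G t = 0) -> (\int[lebesgue_measure]_t (G t)%:E = 0)%E.
Proof.
move=> cG dF FG0; pose L := `|M| + 1; have ML : M < L.
  by have := ler_norm M; rewrite /L; order_lra.
have L0 : 0 < L by rewrite /L ltr_wpDl.
have cF : continuous F by move=> t; exact: der_cont (dF t).
pose I : set R := `[- L, L]%classic.
have -> : (\int[lebesgue_measure]_t (G t)%:E = \int[lebesgue_measure]_(t in I) (G t)%:E)%E.
  rewrite [RHS]integral_mkcond; apply: eq_integral => t _; rewrite patchE.
  case: ifPn => //; rewrite notin_setE/= /I/= in_itv/= => /negP; rewrite -ler_norml -ltNge => tL.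
  by have [_ ->] := FG0 t (lt_trans ML tL).
have LL : - L < L by order_lra.
rewrite /I (@continuous_FTC2 _ G F)//.
- have [|-> _] := FG0 L; first by rewrite gtr0_norm.
  by have [|-> _] := FG0 (- L); [rewrite normrN gtr0_norm|rewrite subee].
- by apply: continuous_subspaceT => t; exact: cG.
- split => [t _|t|]; first by have [] := dF t.
  + by apply: cvg_at_right_filter; exact: cF.
  + by apply: cvg_at_left_filter; exact: cF.
- by move=> t _; rewrite derive1E; have [_] := dF t.
Qed.

Lemma rV_cons_line0 n (t s : R) (v : 'rV[R]_n) :
  rV_cons (t, v) + s *: delta_mx 0 ord0 = rV_cons (t + s, v).
Proof.
apply/rowP => i; rewrite !mxE eqxx/=; case: unliftP => [j|] ->.
  by rewrite eq_sym (negbTE (neq_lift _ _)) mulr0 addr0.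
by rewrite eqxx mulr1.
Qed.

Lemma rV_cons_line n (t s : R) (v : 'rV[R]_n) (j : 'I_n) :
  rV_cons (t, v) + s *: delta_mx 0 (lift ord0 j) = rV_cons (t, v + s *: delta_mx 0 j).
Proof.
apply/rowP => i; rewrite !mxE eqxx/=; case: unliftP => [k|] -> /=.
  by rewrite !mxE eqxx/= (inj_eq lift_inj).
by rewrite mulr0 addr0.
Qed.

Lemma rV_cons0 n (t : R) (v : 'rV[R]_n) : rV_cons (t, v) 0 ord0 = t.
Proof. by rewrite mxE unlift_none. Qed.

Lemma rV_consS n (t : R) (v : 'rV[R]_n) j : rV_cons (t, v) 0 (lift ord0 j) = v 0 j.
Proof. by rewrite mxE liftK. Qed.

Lemma rV_cont_coord (S : topologicalType) n (g : S -> 'rV[R]_n) :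
  (forall j, continuous (fun s => g s 0 j)) -> continuous g.
Proof.
move=> cg s; apply/cvgrPdist_lt => e e0.
have : \forall y \near s, forall j, `|g s 0 j - g y 0 j| < e.
  by apply: filter_forall => j; move: e e0; apply/cvgrPdist_lt; exact: cg.
apply: filterS => y Hy; rewrite [X in X < _]mx_normrE; apply/bigmax_ltP; split => //= -[i j] _ /=.
by rewrite !mxE ord1.
Qed.

Lemma integrable_cube n (D : 'rV[R]_n -> R) (M : R) : 0 < M -> continuous D ->
  (forall (x : 'rV[R]_n) (j : 'I_n), M < `|x 0 j| -> D x = 0) ->
  (lebesgue_rV n).-integrable setT (EFin \o D).
Proof.
move=> M0 cD D0; have mA := @measurable_cube R n M.
have -> : EFin \o D = (EFin \o D) \_ (cube M).
  apply/funext => x; rewrite patchE; case: ifPn => //; rewrite notin_setE/= => nA.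
  have [j] : exists j, ~ `[(- M : R), M]%classic (x 0 j) by apply/existsNP.
  by rewrite /= in_itv/= -ler_norml => /negP; rewrite -ltNge => /D0 ->.
apply/(integrable_mkcond _ mA); apply: measurable_bounded_integrable => //.
- have cM : (((2 * M) ^+ n)%:E < +oo :> \bar R)%E by exact: ltry.
  by apply: le_lt_trans cM; rewrite -(@cube_measure R n M M0).
- by apply: measurable_funTS; exact: continuous_measurable_rV.
have : bounded_set (D @` cube M).
  apply: compact_bounded; apply: continuous_compact (@compact_cube R n M).
  exact: continuous_subspaceT.
by move=> [C [C1 C2]]; exists C; split => // K CK x Ax; apply: C2 CK _ _; exists x.
Qed.

(** True by conversion; stated to expose the pushforward to the change of variables. *)
Lemma integral_lebesgue_rVS n (f : 'rV[R]_n.+1 -> \bar R) :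
  (\int[lebesgue_rV n.+1]_x f x =
   \int[pushforward (@lebesgue_measure R \x lebesgue_rV n) (@rV_cons R n)]_x f x)%E.
Proof. by []. Qed.
Lemma ge0_integral_rV_cons n (f : 'rV[R]_n.+1 -> \bar R) : measurable_fun setT f -> (forall x, 0 <= f x)%E ->
  (\int[lebesgue_rV n.+1]_x f x = \int[@lebesgue_measure R \x lebesgue_rV n]_p f (rV_cons p))%E.
Proof.
move=> mf f0; rewrite integral_lebesgue_rVS.
rewrite ge0_integral_pushforward//; last exact: measurable_rV_cons.
Qed.
Lemma integral_rV_cons n (f : 'rV[R]_n.+1 -> \bar R) : measurable_fun setT f -> 
  (@lebesgue_measure R \x lebesgue_rV n)%E.-integrable setT (f \o @rV_cons R n) ->
  (\int[lebesgue_rV n.+1]_x f x = \int[@lebesgue_measure R \x lebesgue_rV n]_p f (rV_cons p))%E.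
Proof.
move=> mf intf; rewrite integral_lebesgue_rVS.
rewrite integral_pushforward//; last exact: measurable_rV_cons.
Qed.

(** Induction on the dimension along the recursive construction of the measure: for the first
    coordinate Fubini reduces to the fundamental theorem of calculus on lines, for any other to the
    induction hypothesis on slices. *)
Lemma integral_partial n (i : 'I_n) (F D : 'rV[R]_n -> R) (M : R) : 0 < M -> continuous D ->
  (forall x, has_partial i F x (D x)) ->
  (forall (x : 'rV[R]_n) (j : 'I_n), M < `|x 0 j| -> F x = 0 /\ D x = 0) ->
  (\int[lebesgue_rV n]_x (D x)%:E = 0)%E.
Proof.
move=> M0; elim: n i F D => [[]//|n IH] i F D cD dF FD0.
have intD : (lebesgue_rV n.+1).-integrable setT (EFin \o D).
  by apply: (@integrable_cube _ _ M) => // x j /FD0[].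
have mD := continuous_measurable_rV cD.
have mED : measurable_fun setT (EFin \o D) by exact/measurable_EFinP.
have intDc : (lebesgue_measure \x lebesgue_rV n)%E.-integrable setT (EFin \o D \o @rV_cons R n).
  have := integrableP _ _ _ intD; case => _ intD'; apply/integrableP; split.
    by apply: measurableT_comp mED _; exact: measurable_rV_cons.
  have mA : measurable_fun setT (fun x => `|(EFin \o D) x|)%E.
    exact: (@measurableT_comp _ _ _ _ _ _ abse _ (EFin \o D)).
  by move: intD'; rewrite (ge0_integral_rV_cons mA (fun x => abse_ge0 _)).
rewrite (integral_rV_cons mED intDc).
case: (unliftP ord0 i) => [j ij|i0].
- rewrite -(integral12_prod_meas1 intDc).
  apply: integral0_eq => t _; rewrite /fubini_F/=.
  apply: (IH j (fun v => F (rV_cons (t, v))) (fun v => D (rV_cons (t, v)))).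
  + move=> v; apply: (@continuous_comp _ _ _ (fun v => rV_cons (t, v)) D); last exact: cD.
    apply: rV_cont_coord => k; case: (unliftP ord0 k) => [k'|] ->.
      by under eq_fun do rewrite rV_consS; exact: coord_continuous.
    by under eq_fun do rewrite rV_cons0; exact: cst_continuous.
  + move=> v; apply/hasP_line; have /hasP_line := dF (rV_cons (t, v)); rewrite ij.
    by under eq_fun do rewrite rV_cons_line.
  + by move=> v k Mk; apply: (FD0 _ (lift ord0 k)); rewrite rV_consS.
- rewrite -(integral21_prod_meas1 intDc).
  apply: integral0_eq => v _; rewrite /fubini_G/=.
  apply: (@integral_derivative (fun t => F (rV_cons (t, v))) (fun t => D (rV_cons (t, v))) M).
  + move=> t; apply: (@continuous_comp _ _ _ (fun t => rV_cons (t, v)) D); last exact: cD.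
    apply: rV_cont_coord => k; case: (unliftP ord0 k) => [k'|] ->.
      by under eq_fun do rewrite rV_consS; exact: cst_continuous.
    by under eq_fun do rewrite rV_cons0; move=> s; exact: cvg_id.
  + move=> t; have := hasP_along (rV_cons (0, v)) t dF.
    by rewrite i0; under eq_fun do rewrite rV_cons_line0 add0r; rewrite rV_cons_line0 add0r.
  + by move=> t Mt; apply: (FD0 _ ord0); rewrite rV_cons0.
Qed.

End integration_by_parts.

(** * Integration on the ball *)

Section continuity.
Context {R : realType} {T : topologicalType}.
Implicit Types (f g : T -> R).

Lemma contD f g : continuous f -> continuous g -> continuous (fun x => f x + g x).
Proof. by move=> cf cg x; apply: cvgD; [exact: cf|exact: cg]. Qed.

Lemma contN f : continuous f -> continuous (fun x => - f x).
Proof. by move=> cf x; apply: cvgN; exact: cf. Qed.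

Lemma contM f g : continuous f -> continuous g -> continuous (fun x => f x * g x).
Proof. by move=> cf cg x; apply: cvgM; [exact: cf|exact: cg]. Qed.

Lemma cont_cst (c : R) : continuous (fun _ : T => c).
Proof. by move=> x; exact: cst_continuous. Qed.

Lemma cont_comp f (h : R -> R) : continuous f -> continuous h -> continuous (fun x => h (f x)).
Proof. by move=> cf ch x; apply: continuous_comp; [exact: cf|exact: ch]. Qed.

End continuity.

Section ball.
Context {R : realType} {N : nat}.
Local Notation muB := (@ball_measure R N).
Implicit Types (f g : 'rV[R]_N -> R).

Lemma ball_null : muB (~` @unit_ball R N) = 0%E.
Proof. by rewrite /ball_measure/= /mrestr setICl measure0. Qed.

Lemma ball_lty : (muB setT < +oo)%E.
Proof.
rewrite /ball_measure/= /mrestr setTI.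
apply: (@le_lt_trans _ _ (lebesgue_rV N (cube 1))).
  apply: le_measure; rewrite ?inE; [exact: measurable_unit_ball|exact: measurable_cube|].
  by move=> x /unit_ballE x1; apply: norm2_cube; exact: ltW.
by rewrite cube_measure ?ltr01// ltry.
Qed.

Lemma ball_ae (P : 'rV[R]_N -> Prop) : (forall x, norm2 x < 1 -> P x) -> {ae muB, forall x, P x}.
Proof.
move=> H; exists (~` @unit_ball R N); split; [|exact: ball_null|].
  by apply: measurableC; exact: measurable_unit_ball.
by move=> x /= nP Bx; apply: nP; apply: H; apply/unit_ballE.
Qed.

(** Bounded only on the ball, because [ball_measure] ignores the complement; every continuous
    function then qualifies. *)
Definition bdd f := measurable_fun setT f /\ exists C, forall x, norm2 x < 1 -> `|f x| <= C.

Lemma bdd_cont f : continuous f -> bdd f.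
Proof.
move=> cf; split; first exact: continuous_measurable_rV.
have : bounded_set (f @` cube 1).
  apply: compact_bounded; apply: continuous_compact (@compact_cube R N 1).
  exact: continuous_subspaceT.
move=> [C [C1 C2]]; exists (C + 1) => x x1; apply: (C2 (C + 1)); first by rewrite ltrDl.
by exists x => //; apply: norm2_cube; exact: ltW.
Qed.

Lemma bddM f g : bdd f -> bdd g -> bdd (fun x => f x * g x).
Proof.
move=> [mf [C HC]] [mg [D HD]]; split; first exact: measurable_funM.
by exists (C * D) => x x1; rewrite normrM ler_pM// ?HC// HD.
Qed.

Lemma bdd_integrable f : bdd f -> muB.-integrable setT (EFin \o f).
Proof.
move=> [mf [C HC]]; apply/integrableP; split; first exact/measurable_EFinP.
apply: le_lt_trans (_ : (`|C|%:E * muB setT < +oo)%E).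
  apply: integral_le_bound => //; first exact/measurable_EFinP.
  apply: (@ball_ae (fun x => _ -> (`|(EFin \o f) x| <= `|C|%:E)%E)) => x x1 _ /=.
  by rewrite lee_fin (le_trans (HC x x1))// ler_norm.
by rewrite lte_mul_pinfty//; exact: ball_lty.
Qed.

Lemma ball_dominated (f_ : nat -> 'rV[R]_N -> R) f (C : R) : (forall k, measurable_fun setT (f_ k)) ->
  measurable_fun setT f -> (forall k x, norm2 x < 1 -> `|f_ k x| <= C) ->
  (forall x, norm2 x < 1 -> f_ k x @[k --> \oo] --> f x) ->
  (\int[muB]_x (f_ k x)%:E @[k --> \oo] --> \int[muB]_x (f x)%:E)%E /\
  \int[muB]_x f_ k x @[k --> \oo] --> \int[muB]_x f x.
Proof.
move=> mf_ mf HC Hf.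
have [|||||i1 _ i3] := @dominated_convergence _ _ R muB setT measurableT
  (fun k x => (f_ k x)%:E) (fun x => (f x)%:E) (fun=> C%:E).
- by move=> k; exact/measurable_EFinP.
- exact/measurable_EFinP.
- by apply: (@ball_ae (fun x => _ -> _)) => x x1 _; apply: cvg_EFin; [exact: nearW|exact: Hf].
- by apply: (@bdd_integrable (fun=> C)); apply: bdd_cont; exact: cont_cst.
- by apply: (@ball_ae (fun x => forall k, _ -> _)) => x x1 k _; rewrite lee_fin; exact: HC.
split => //; move: i3 => /=.
have fin : (\int[muB]_x (f x)%:E)%E \is a fin_num by exact: integrable_fin_num.
by rewrite -(fineK fin) => /fine_cvgP[].
Qed.

Lemma ball_sum (I : finType) (f : I -> 'rV[R]_N -> R) :
  (forall i, muB.-integrable setT (EFin \o f i)) ->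
  \int[muB]_x (\sum_i f i x) = \sum_i \int[muB]_x f i x.
Proof.
move=> H; have S (s : seq I) : muB.-integrable setT (EFin \o (fun x => \sum_(i <- s) f i x)) /\
    \int[muB]_x (\sum_(i <- s) f i x) = \sum_(i <- s) \int[muB]_x f i x.
  elim: s => [|j s [bs IH]].
    have -> : (fun x => \sum_(i <- [::]) f i x) = fun=> 0 by apply/funext => x; rewrite big_nil.
    split; first by apply: bdd_integrable; apply: bdd_cont; exact: cont_cst.
    by rewrite Rintegral_cst// mul0r big_nil.
  have E : (fun x => \sum_(i <- j :: s) f i x) = fun x => f j x + \sum_(i <- s) f i x.
    by apply/funext => x; rewrite big_cons.
  split.
    have := integrableD measurableT (H j) bs; rewrite E; congr (_.-integrable _ _).
  under eq_Rintegral do rewrite big_cons.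
  by rewrite RintegralD// big_cons IH.
by have [_] := S (index_enum I).
Qed.

Lemma ball_div i (F D : 'rV[R]_N -> R) : continuous D -> (forall x, has_partial i F x (D x)) ->
  (forall x, 1 <= norm2 x -> F x = 0 /\ D x = 0) -> \int[muB]_x D x = 0.
Proof.
move=> cD dF FD0.
have out (x : 'rV[R]_N) (j : 'I_N) : 1 < `|x 0 j| -> F x = 0 /\ D x = 0.
  move=> xj; apply: FD0; apply: le_trans (coord_norm2 x j); apply: ltW.
  by rewrite -real_normK ?num_real// expr_gt1.
rewrite integral_restr.
- by rewrite /Rintegral (@integral_partial R N i F D 1).
- by apply: (@integrable_cube R N D 1) => // x j /out[].
- move=> x nB; have [] := FD0 x => //; rewrite leNgt; apply/negP => x1; apply: nB.
  exact/unit_ballE.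
Qed.

Section test.
Variable phi : 'rV[R]_N -> R.
Hypothesis tphi : test_function phi.

Lemma test_partial i x : has_partial i phi x (partial i phi x).
Proof. by case: tphi => sphi _ _; apply: hasP_differentiable; exact: (sphi [::]). Qed.

Lemma test_cont : continuous phi.
Proof. by case: tphi => sphi _ _ x; apply: differentiable_continuous; exact: (sphi [::]). Qed.

Lemma test_partial_cont i : continuous (partial i phi).
Proof. by case: tphi => sphi _ _ x; apply: differentiable_continuous; exact: (sphi [:: i]). Qed.

Lemma test_out i x : 1 <= norm2 x -> phi x = 0 /\ partial i phi x = 0.
Proof.
move=> x1; case: tphi => _ _ sB; set S := closure _ in sB.
have nS : ~ S x by move=> /sB /unit_ballE; rewrite ltNge x1.
have oS : open (~` S) by rewrite openC; exact: closed_closure.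
have near0 : \forall y \near x, phi y = 0.
  have : nbhs x (~` S) by exact: open_nbhs_nbhs.
  apply: filterS => y nSy; apply/eqP/negPn/negP => py; apply: nSy; exact: subset_closure.
split; first exact: nbhs_singleton near0.
apply: hasP_partial; apply: (near_eq_is_derive _ (hasP_cst i 0 x)).
by apply: filterS near0 => y ->.
Qed.

Lemma test_ibp i g (dg : 'rV[R]_N -> R) : continuous g -> continuous dg ->
  (forall x, has_partial i g x (dg x)) ->
  \int[muB]_x (g x * partial i phi x) = - \int[muB]_x (dg x * phi x).
Proof.
move=> cg cdg Hg; have cp := test_cont; have cdp := @test_partial_cont i.
have := @ball_div i (fun x => g x * phi x) (fun x => dg x * phi x + g x * partial i phi x).
rewrite RintegralD//; [|by apply: bdd_integrable; apply: bdd_cont; exact: contM..].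
move=> H; apply/eqP; rewrite -subr_eq0 opprK addrC; apply/eqP; apply: H.
- by apply: contD; exact: contM.
- by move=> x; apply: hasPM; [exact: Hg|exact: test_partial].
- by move=> x x1; have [-> ->] := test_out i x1; rewrite !mulr0 addr0.
Qed.

End test.

End ball.

(** * Radial functions *)

Lemma flat1_cvg (R : realType) (u : nat -> R) : (forall A : R, \forall m \near \oo, A <= u m) ->
  flat 1 (u m) @[m --> \oo] --> (1 : R).
Proof.
move=> Hu; apply/cvgrPdist_le => e e0; near=> m.
have He : Num.max 1 e^-1 <= u m by near: m; exact: Hu.
move: He; set t := u m; rewrite ge_max => /andP[t1 te].
have t0 : 0 < t by lra.
rewrite bump1// ger0_norm; last first.
  by rewrite subr_ge0 -expR0 ler_expR oppr_le0 invr_ge0 ltW.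
have := expR_ge1Dx (- t^-1); have : t^-1 <= e by rewrite invf_ple ?posrE.
by lra.
Unshelve. all: by end_near. Qed.

Section cutoff.
Context {R : realType} {N : nat}.
Implicit Types (x : 'rV[R]_N).

(** The argument is negative near the sphere, so the support stays inside the ball, and it tends to
    infinity at each interior point, where the cutoff tends to $1$. [dcutoff] is minus the
    derivative with respect to $|x|^2$. *)
Definition cutoff (m : nat) x : R := flat 1 (m.+2%:R * (1 - norm2 x) - 1).
Definition dcutoff (m : nat) x : R := flat (bump_der 1) (m.+2%:R * (1 - norm2 x) - 1) * m.+2%:R.

Lemma bump_der1 (t : R) : 0 < t -> flat (bump_der 1) t = t ^- 2 * expR (- t^-1).
Proof.
move=> t0; rewrite /flat t0 /bump_der -[1]/(1%:P) derivC subr0 mulr1 hornerXn exprVn//.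
Qed.

Lemma bump_der1_bound : exists C : R, forall t, `|(t + 1) * flat (bump_der 1) t| <= C.
Proof.
have [C C0 HC] := @bump_sqr_bound R (bump_der 1); exists (2 * C + 2) => t.
have [t0|t0] := leP t 0; first by rewrite bump_le0// mulr0 normr0; lra.
rewrite normrM gtr0_norm; last by lra.
have [t1|t1] := leP t 1.
  have := HC t; have : t ^+ 2 <= 1 by rewrite expr_le1// ltW.
  by have := normr_ge0 (flat (bump_der 1) t); nra.
rewrite bump_der1// gtr0_norm ?mulr_gt0 ?invr_gt0 ?exprn_gt0 ?expR_gt0//.
have : expR (- t^-1) <= 1 by rewrite -expR0 ler_expR oppr_le0 invr_ge0 ltW.
have : t ^- 2 * (t + 1) <= 2.
  by rewrite mulrC ler_pdivrMr ?exprn_gt0// expr2; nra.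
have : 0 <= t ^- 2 * (t + 1) by rewrite mulr_ge0 ?invr_ge0 ?exprn_ge0 ?ltW//; lra.
by have := expR_ge0 (- t^-1); rewrite mulrCA mulrA; move: (t ^- 2 * _) => a; nra.
Qed.

Lemma bump_der1_small (t : R) : 1 <= t -> `|(t + 1) * flat (bump_der 1) t| <= 2 / t.
Proof.
move=> t1; have t0 : 0 < t by lra.
rewrite bump_der1// gtr0_norm ?mulr_gt0 ?invr_gt0 ?exprn_gt0 ?expR_gt0//; last by lra.
have e1 : expR (- t^-1) <= 1 by rewrite -expR0 ler_expR oppr_le0 invr_ge0 ltW.
rewrite mulrA; apply: le_trans (_ : (t + 1) / t ^+ 2 * 1 <= _).
  by rewrite ler_wpM2l// divr_ge0 ?exprn_ge0 ?ltW//; lra.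
rewrite mulr1 ler_pdivrMr ?exprn_gt0// expr2 mulrA divfK ?gt_eqF//; lra.
Qed.

Lemma sm_cut_arg m : sm (fun x => m.+2%:R * (1 - norm2 x) - 1).
Proof.
apply: sm_add; last exact: sm_cst.
apply: sm_mul; first exact: sm_cst.
apply: sm_add; first exact: sm_cst.
rewrite (_ : (fun x => - norm2 x) = fun x => (-1) * norm2 x); last by apply/funext => x; rewrite mulN1r.
by apply: sm_mul; [exact: sm_cst|exact: sm_norm2].
Qed.

Lemma sm_cut m : sm (cutoff m). Proof. by apply: sm_bump; exact: sm_cut_arg. Qed.

Lemma cut_out m x : 1 - m.+2%:R^-1 <= norm2 x -> cutoff m x = 0.
Proof.
move=> x1; apply: bump_le0; rewrite subr_le0 mulrC -ler_pdivlMr// mul1r.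
by move: x1; rewrite !lerBlDr addrC.
Qed.

Lemma cut_test m (g : 'rV[R]_N -> R) : sm g -> test_function (fun x => g x * cutoff m x).
Proof.
move=> sg; apply: (@sm_test _ _ _ m.+2%:R^-1); first by rewrite invr_gt0.
- by apply: sm_mul => //; exact: sm_cut.
- by move=> x /cut_out ->; rewrite mulr0.
Qed.

Lemma cut_bound m x : 0 <= cutoff m x <= 1. Proof. exact: bump1_bound. Qed.

Lemma dcut_cont m : continuous (dcutoff m).
Proof.
apply: contM; last exact: cont_cst.
by apply: sm_continuous; apply: sm_bump; exact: sm_cut_arg.
Qed.

Lemma cut_partial m i x : has_partial i (cutoff m) x (- (2 * x 0 i * dcutoff m x)).
Proof.
apply: hasP_eq.
  apply: (@hasP_comp _ _ i (fun x => m.+2%:R * (1 - norm2 x) - 1)); last exact: der_bump.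
  apply: hasPD; last exact: hasP_cst.
  apply: hasPM; first exact: hasP_cst.
  by apply: hasPD; [exact: hasP_cst|apply: hasPN; exact: hasP_norm2].
by rewrite /dcutoff; ring.
Qed.

(** The derivative of the cutoff blows up only like the inverse distance to the sphere, uniformly in
    [m]. So a function that vanishes to first order on the sphere can be cut off at bounded cost;
    with $t$ the argument of [flat], the product is $(t+1)$ times the flat derivative at $t$. *)
Lemma dcut_bound : exists C : R, forall m x, `|(1 - norm2 x) * dcutoff m x| <= C.
Proof.
have [C HC] := bump_der1_bound; exists C => m x.
have := HC (m.+2%:R * (1 - norm2 x) - 1); rewrite subrK; congr (`|_| <= _).
by rewrite /dcutoff; ring.
Qed.

Lemma cut_arg_large x (A : R) : norm2 x < 1 -> \forall m \near \oo, A <= m.+2%:R * (1 - norm2 x) - 1.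
Proof.
move=> x1; have d0 : 0 < 1 - norm2 x by rewrite subr_gt0.
near=> m; rewrite lerBrDr -ler_pdivrMr//.
have : (A + 1) / (1 - norm2 x) <= m%:R by near: m; exact: nbhs_infty_ger.
by rewrite -[m.+2%:R]natr1 -[m.+1%:R]natr1; lra.
Unshelve. all: by end_near. Qed.

Lemma cut_cvg x : norm2 x < 1 -> cutoff m x @[m --> \oo] --> (1 : R).
Proof. by move=> x1; apply: flat1_cvg => A; exact: cut_arg_large. Qed.

Lemma dcut_cvg x : norm2 x < 1 -> (1 - norm2 x) * dcutoff m x @[m --> \oo] --> (0 : R).
Proof.
move=> x1; apply/cvgrPdist_le => e e0; near=> m.
have He : Num.max 1 (2 / e) <= m.+2%:R * (1 - norm2 x) - 1 by near: m; exact: cut_arg_large.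
rewrite sub0r normrN; move: He; set t := _ - 1; rewrite ge_max => /andP[t1 te].
have t0 : 0 < t by lra.
have -> : (1 - norm2 x) * dcutoff m x = (t + 1) * flat (bump_der 1) t by rewrite /dcutoff /t; ring.
apply: le_trans (bump_der1_small t1) _; rewrite ler_pdivrMr// mulrC -ler_pdivrMr//.
Unshelve. all: by end_near. Qed.

End cutoff.

Lemma continuous_dominated (R : realType) (T : topologicalType) (g q : T -> R) (x : T) : q x = 0 ->
  {for x, continuous q} -> (forall y, `|g y| <= `|q y|) -> {for x, continuous g}.
Proof.
move=> qx cq gq; have gx : g x = 0 by apply/eqP; rewrite -normr_le0 (le_trans (gq x))// qx normr0.
suff : g y @[y --> x] --> g x by [].
rewrite gx; apply/cvgrPdist_lt => e e0.
have : \forall y \near x, `|q x - q y| < e by move: e e0; apply/cvgrPdist_lt.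
by apply: filterS => y; rewrite qx !sub0r !normrN; apply: le_lt_trans.
Qed.

Lemma contM_at (R : realType) (T : topologicalType) (f g : T -> R) (x : T) :
  {for x, continuous f} -> {for x, continuous g} -> {for x, continuous (fun y => f y * g y)}.
Proof. by move=> cf cg; exact: cvgM. Qed.

Lemma contV_at (R : realType) (T : topologicalType) (f : T -> R) (x : T) : f x != 0 ->
  {for x, continuous f} -> {for x, continuous (fun y => (f y)^-1)}.
Proof. by move=> fx cf; exact: cvgV. Qed.

Section radial.
Context {R : realType} {N : nat}.
Implicit Types (x : 'rV[R]_N) (i : 'I_N).

Definition nrm x : R := Num.sqrt (norm2 x).

Lemma nrm_ge0 x : 0 <= nrm x. Proof. exact: sqrtr_ge0. Qed.

Lemma nrm_sqr x : nrm x ^+ 2 = norm2 x. Proof. by rewrite sqr_sqrtr// norm2_ge0. Qed.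

Lemma nrm_cont : continuous nrm.
Proof.
by apply: (@cont_comp _ _ norm2); [apply: sm_continuous; exact: sm_norm2|exact: sqrt_continuous].
Qed.

Lemma nrm_lt1 x : norm2 x < 1 -> nrm x < 1.
Proof. by move=> x1; rewrite -(@expr_lt1 _ 2)// ?nrm_sqr// nrm_ge0. Qed.

Lemma nrm0 : nrm 0 = 0.
Proof. by rewrite /nrm /norm2 /dot big1 ?sqrtr0// => i _; rewrite mxE mul0r. Qed.

Lemma nrm_eq0 x : nrm x = 0 -> x = 0.
Proof.
move=> x0; apply/rowP => i; rewrite mxE; have := coord_norm2 x i.
rewrite -nrm_sqr x0 expr0n/= => H; apply/eqP; by rewrite -sqrf_eq0 eq_le H sqr_ge0.
Qed.

Lemma nrm_gt0 x : x != 0 -> 0 < nrm x.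
Proof. by move=> x0; rewrite lt_neqAle nrm_ge0 andbT eq_sym; apply: contra_neq x0; exact: nrm_eq0. Qed.

Lemma nrm_axis i (t : R) : nrm (0 + t *: delta_mx 0 i) = `|t|.
Proof.
rewrite /nrm -sqrtr_sqr; congr Num.sqrt; rewrite /norm2 /dot (bigD1 i)//= big1 ?addr0.
  by rewrite !mxE !eqxx/= add0r mulr1 expr2.
by move=> j ji; rewrite !mxE eqxx/= (negbTE ji) mulr0 addr0 mulr0.
Qed.

Lemma nrm_partial i x : x != 0 -> has_partial i nrm x (x 0 i / nrm x).
Proof.
move=> x0; have n0 := nrm_gt0 x0; have n20 : 0 < norm2 x by rewrite -nrm_sqr exprn_gt0.
apply: hasP_eq.
  by apply: (@hasP_comp _ _ i norm2 (@Num.sqrt R)); [exact: hasP_norm2|exact: is_derive1_sqrt].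
by rewrite -/(nrm x); field; rewrite gt_eqF.
Qed.

Lemma coord_nrm x i : `|x 0 i| <= nrm x.
Proof. by rewrite -(@ler_pXn2r _ 2)// ?nnegrE// ?nrm_ge0// real_normK ?num_real// nrm_sqr coord_norm2. Qed.

(* The gradient of [w(|x|)] is [k(|x|) x] with [k(r) = w'(r)/r]; [w'(0) = 0] makes it differentiable at 0. *)
Lemma radial_partial i (w z k : R -> R) x : (forall r, hasD w r (z r)) -> z 0 = 0 ->
  (forall r, 0 <= r -> z r = r * k r) -> has_partial i (fun y => w (nrm y)) x (x 0 i * k (nrm x)).
Proof.
move=> dw z0 zk; have [->|x0] := eqVneq x 0.
  rewrite mxE mul0r; apply/hasP_line; under eq_fun do rewrite nrm_axis.
  apply: hasD_eps => e e0; have dw0 := dw 0; rewrite z0 in dw0.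
  have [d d0 Hd] := hasD_epsP dw0 e0; exists d => // y; rewrite subr0 => yd.
  have := Hd `|y|; rewrite !subr0 normr_id => /(_ yd).
  by rewrite !mul0r !subr0 normr0.
apply: hasP_eq; first exact: hasP_comp (nrm_partial i x0) (dw _).
by rewrite zk ?nrm_ge0//; field; rewrite gt_eqF// nrm_gt0.
Qed.

(* [div (x psi(|x|)) = N psi(|x|) + q(|x|)] where [q(r) = r psi'(r)]. *)
Lemma radial_field_partial i (psi q : R -> R) x : continuous psi ->
  (forall r, 0 < r -> hasD psi r (q r / r)) ->
  has_partial i (fun y => y 0 i * psi (nrm y)) x
    (psi (nrm x) + x 0 i ^+ 2 / norm2 x * q (nrm x)).
Proof.
move=> cpsi dpsi; have [->|x0] := eqVneq x 0.
  rewrite mxE expr0n/= !mul0r addr0 nrm0; apply/hasP_line.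
  under eq_fun do rewrite nrm_axis.
  rewrite (_ : (fun _ => _) = fun t => t * psi `|t|); last first.
    by apply/funext => t; rewrite !mxE !eqxx/= add0r mulr1.
  apply: hasD_eps => e e0; have [d d0 Hd] := epsdeltaP (cpsi 0) e0; exists d => // y.
  rewrite !subr0 => yd; rewrite mul0r subr0 [_ * y]mulrC -mulrBr normrM mulrC ler_wpM2r//.
  by apply: ltW; apply: Hd; rewrite subr0 normr_id.
have n0 := nrm_gt0 x0; apply: hasP_eq.
  apply: hasPM; first exact: hasP_coord.
  exact: hasP_comp (nrm_partial i x0) (dpsi _ n0).
rewrite eqxx mul1r -nrm_sqr; congr (_ + _); field; rewrite gt_eqF//.
Qed.

Lemma radial_field_cont i (psi q : R -> R) : continuous psi -> continuous q -> q 0 = 0 ->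
  continuous (fun x => psi (nrm x) + x 0 i ^+ 2 / norm2 x * q (nrm x)).
Proof.
move=> cpsi cq q0; apply: contD; first by apply: cont_comp => //; exact: nrm_cont.
have cqn : continuous (fun x => q (nrm x)) by apply: cont_comp => //; exact: nrm_cont.
move=> x; have [x0|x0] := eqVneq x 0.
  have qx : q (nrm x) = 0 by rewrite x0 nrm0.
  apply: (continuous_dominated qx); first exact: cqn.
  move=> y; rewrite normrM.
  rewrite ler_piMl// normrM normfV !ger0_norm ?sqr_ge0 ?norm2_ge0//.
  have [->|y0] := eqVneq (norm2 y) 0; first by rewrite invr0 mulr0.
  by rewrite ler_pdivrMr ?mul1r ?coord_norm2// lt_neqAle eq_sym y0 norm2_ge0.
have c1 : {for x, continuous (fun y : 'rV[R]_N => y 0 i ^+ 2)}.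
  by apply: sm_continuous; under eq_fun do rewrite expr2; apply: sm_mul; exact: sm_coord.
have c2 : {for x, continuous (fun y : 'rV[R]_N => (norm2 y)^-1)}.
  apply: contV_at; last by apply: sm_continuous; exact: sm_norm2.
  by rewrite gt_eqF// -nrm_sqr exprn_gt0// nrm_gt0.
exact (contM_at (contM_at c1 c2) (cqn x)).
Qed.

Lemma radial_field_div (psi q : R -> R) x : q 0 = 0 ->
  \sum_(i < N) (psi (nrm x) + x 0 i ^+ 2 / norm2 x * q (nrm x)) = N%:R * psi (nrm x) + q (nrm x).
Proof.
move=> q0; rewrite big_split/= sumr_const card_ord mulr_natl; congr (_ + _).
have [->|x0] := eqVneq x 0.
  by rewrite nrm0 q0 big1// => i _; rewrite mulr0.
rewrite -mulr_suml -mulr_suml; under eq_bigr do rewrite expr2.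
by rewrite -/(dot x x) -/(norm2 x) divff ?mul1r// gt_eqF// -nrm_sqr exprn_gt0// nrm_gt0.
Qed.

End radial.

(** * Radial fields with prescribed divergence *)

Section mean_value.
Context {R : realType} (n : nat) (f Phi : R -> R).
Hypotheses (cf : continuous f) (Phi0 : Phi 0 = 0) (dPhi : forall r, hasD Phi r (r ^+ n * f r)).

(** The factor $\psi$ for which the field $x\,\psi(|x|)$ has divergence $f(|x|)$ in dimension $n+1$;
    the default value is its limit at $0$. [mean_q] is $r\psi'(r)$. *)
Definition mean (r : R) : R := if 0 < r then Phi r / r ^+ n.+1 else f 0 / n.+1%:R.
Definition mean_q (r : R) : R := f r - n.+1%:R * mean r.

Lemma primitive_close e : 0 < e -> exists2 d, 0 < d & forall r, 0 < r < d ->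
  `|Phi r / r ^+ n.+1 - f 0 / n.+1%:R| <= e / n.+1%:R.
Proof.
move=> e0; have [d d0 Hd] := epsdeltaP (@cf 0) e0; exists d => // r /andP[r0 rd].
have rn : 0 < r ^+ n.+1 by rewrite exprn_gt0.
have cPhi : continuous Phi by move=> x; exact: der_cont (@dPhi x).
have := @abs_incr_le _ (fun x => Phi x - f 0 / n.+1%:R * x ^+ n.+1) (fun x => e / n.+1%:R * x ^+ n.+1)
  (fun x => x ^+ n * (f x - f 0)) (fun x => x ^+ n * e) 0 r (ltW r0).
rewrite Phi0 (expr0n _ n.+1)/= !mulr0 !subr0 => H.
have {}H : `|Phi r - f 0 / n.+1%:R * r ^+ n.+1| <= e / n.+1%:R * r ^+ n.+1.
  apply: H => [x _|x _|x _|x _|x /andP[x0 xr]].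
  - by ct_auto.
  - by ct_auto.
  - apply: der_eq; first by der_auto.
    by rewrite /=; field; rewrite addrC natr1 pnatr_eq0.
  - apply: der_eq; first by der_auto.
    by rewrite /=; field; rewrite addrC natr1 pnatr_eq0.
  - rewrite normrM (ger0_norm (exprn_ge0 n (ltW x0))) ler_wpM2l ?exprn_ge0 ?(ltW x0)//.
    by apply/ltW/Hd; rewrite subr0 gtr0_norm// (lt_trans xr).
rewrite -(ler_pM2r rn) -[X in `|_| * X](gtr0_norm rn) -normrM mulrBl divfK ?gt_eqF//.
Qed.

Lemma mean_cont : continuous mean.
Proof.
move=> r; apply: epsdelta => e e0; have [r0|r0|r0] := ltgtP 0 r.
- have cF : {for r, continuous (fun x => Phi x / x ^+ n.+1)}.
    have rn : r ^+ n.+1 != 0 by rewrite gt_eqF// exprn_gt0.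
    apply ctat_cont; apply: ctM; first exact: der_cont (@dPhi r).
    exact: der_cont (@derV _ (fun t => t ^+ n.+1) r _ rn (derX n.+1 (der_id r))).
  have [d d0 Hd] := epsdeltaP cF e0.
  exists (Num.min r d); first by rewrite lt_min r0.
  move=> y; rewrite lt_min => /andP[yr yd]; rewrite /mean r0 ifT; first exact: Hd.
  by move: yr; rewrite ltr_norml; lra.
- exists (- r); first by rewrite oppr_gt0.
  move=> y yr; have y0 : y <= 0 by move: yr; rewrite ltr_norml; lra.
  have -> : mean y = mean r by rewrite /mean !ltNge y0 (ltW r0).
  by rewrite subrr normr0.
- have e2 : 0 < e / 2 by rewrite divr_gt0.
  have [d d0 Hd] := primitive_close e2; exists d => // y; rewrite -r0 subr0 => yd.
  rewrite /mean ltxx; case: ifPn => y0; last by rewrite subrr normr0.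
  apply: le_lt_trans (Hd y _) _; first by rewrite y0 -(gtr0_norm y0).
  rewrite ltr_pdivrMr//; have : 1 <= n.+1%:R :> R by rewrite ler1n.
  by nra.
Qed.

Lemma mean_der r : 0 < r -> hasD mean r (mean_q r / r).
Proof.
move=> r0; have rn : r ^+ n.+1 != 0 by rewrite gt_eqF// exprn_gt0.
apply: (@near_eq_is_derive _ _ _ (fun x => Phi x / x ^+ n.+1)).
  by near=> y; rewrite /mean ifT//; near: y; exact: lt_nbhsr.
apply: der_eq.
  by apply: derM; [exact: dPhi|apply: derV => //; apply: derX; exact: der_id].
rewrite /mean_q /mean r0 /= -[n.+1%:R]natr1 !exprS.
by field; rewrite gt_eqF// expf_neq0// gt_eqF.
Unshelve. all: by end_near. Qed.

Lemma mean_q_cont : continuous mean_q.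
Proof.
apply: contD => //; apply: contN; apply: contM; first exact: cont_cst.
exact: mean_cont.
Qed.

Lemma mean_q0 : mean_q 0 = 0.
Proof. by rewrite /mean_q /mean ltxx mulrCA divff ?mulr1 ?subrr// pnatr_eq0. Qed.

Lemma mean_div r : n.+1%:R * mean r + mean_q r = f r.
Proof. by rewrite /mean_q addrC subrK. Qed.

End mean_value.

(** * Integration in polar coordinates *)

Lemma continuous_bounded_itv (R : realType) (f : R -> R) (a b : R) : continuous f ->
  exists2 C : R, 0 <= C & forall x, a <= x <= b -> `|f x| <= C.
Proof.
move=> cf; have : bounded_set (f @` `[a, b]).
  apply: compact_bounded; apply: continuous_compact; last exact: segment_compact.
  exact: continuous_subspaceT.
move=> [C [C1 C2]]; exists (`|C| + 1) => [|x xab]; first by rewrite addr_ge0.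
apply: (C2 (`|C| + 1)); first by have := ler_norm C; lra.
by exists x; rewrite //= in_itv.
Qed.

Section polar.
Context {R : realType} (n : nat).
Local Notation muB := (@ball_measure R n.+1).

Section source.
Variables (f Phi : R -> R).
Hypotheses (cf : continuous f) (Phi0 : Phi 0 = 0) (dPhi : forall r, hasD Phi r (r ^+ n * f r)).
Local Notation psi := (mean n f Phi).
Local Notation q := (mean_q n f Phi).

Lemma radial_ibp phi : test_function phi ->
  \int[muB]_x (\sum_i x 0 i * psi (nrm x) * partial i phi x) = - \int[muB]_x (f (nrm x) * phi x).
Proof.
move=> tphi; have cpsi := mean_cont cf Phi0 dPhi; have cq := mean_q_cont cf Phi0 dPhi.
have q0 := mean_q0 n f Phi; have cphi := test_cont tphi.
pose V i (x : 'rV[R]_n.+1) := x 0 i * psi (nrm x).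
pose D i (x : 'rV[R]_n.+1) := psi (nrm x) + x 0 i ^+ 2 / norm2 x * q (nrm x).
have cV i : continuous (V i).
  by apply: contM; [apply: sm_continuous; exact: sm_coord|apply: cont_comp => //; exact: nrm_cont].
have cD i : continuous (D i) by exact: radial_field_cont.
have dV i x : has_partial i (V i) x (D i x).
  by apply: radial_field_partial => //; exact: mean_der.
rewrite ball_sum; last by move=> i; apply: bdd_integrable; apply: bdd_cont; apply: (contM (cV i)); exact: (test_partial_cont tphi).
rewrite (eq_bigr (fun i => - \int[muB]_x (D i x * phi x))); last first.
  by move=> i _; exact: (test_ibp tphi (cV i) (cD i) (dV i)).
rewrite sumrN -ball_sum; last by move=> i; apply: bdd_integrable; apply: bdd_cont; exact: contM.
congr (- _); apply: eq_Rintegral => x _; rewrite -mulr_suml (radial_field_div _ _ q0).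
by rewrite mean_div.
Qed.

Lemma mean_bound : Phi 1 = 0 -> exists2 C : R, 0 <= C & forall r, 0 <= r <= 1 -> `|psi r| <= C * (1 - r).
Proof.
move=> Phi1; have cpsi := mean_cont cf Phi0 dPhi; have cq := mean_q_cont cf Phi0 dPhi.
have [A A0 HA] := continuous_bounded_itv 0 1 cpsi.
have [B B0 HB] := continuous_bounded_itv 0 1 cq.
exists (2 * A + 2 * B); first by lra.
move=> r /andP[r0 r1]; have [r2|r2] := leP r (1 / 2).
  have := HA r; rewrite r0 r1 => /(_ isT); nra.
have psi1 : psi 1 = 0 by rewrite /mean ltr01 Phi1 mul0r.
have := @abs_incr_le _ psi (fun x => 2 * B * x) (fun x => q x / x) (fun=> 2 * B) r 1 r1.
rewrite psi1 sub0r normrN => H.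
have {}H : `|psi r| <= 2 * B * 1 - 2 * B * r.
  apply: H => [x _|x _|x /andP[rx _]|x _|x /andP[rx x1]].
  - exact: cpsi.
  - by ct_auto.
  - by apply: (mean_der dPhi); lra.
  - by apply: der_eq; [der_auto|rewrite /=; ring].
  - have x0 : 0 < x by lra.
    rewrite normrM normfV (gtr0_norm x0) ler_pdivrMr//.
    have x01 : 0 <= x <= 1 by lra.
    by have := HB x x01; nra.
by nra.
Qed.

Lemma sm_test_cut m : test_function (@cutoff R n.+1 m).
Proof.
rewrite (_ : cutoff m = fun x => 1 * cutoff m x); first by apply: cut_test; exact: sm_cst.
by apply/funext => x; rewrite mul1r.
Qed.

(** The integrand is the divergence of $x\,\psi(|x|)$, tested against the cutoffs. Zero total flux
    means $\psi(1)=0$, so $|\psi|\le C(1-r)$ compensates the gradient of the cutoff and the boundary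
    term tends to $0$ by dominated convergence. *)
Lemma polar0 : Phi 1 = 0 -> \int[muB]_x f (nrm x) = 0.
Proof.
move=> Phi1; have [C C0 HC] := mean_bound Phi1; have [C' HC'] := @dcut_bound R n.+1.
have cpsi := mean_cont cf Phi0 dPhi.
have cf' : continuous (fun x : 'rV[R]_n.+1 => f (nrm x)) by apply: cont_comp => //; exact: nrm_cont.
have cs : continuous (@norm2 R n.+1) by apply: sm_continuous; exact: sm_norm2.
pose g m (x : 'rV[R]_n.+1) := - (2 * norm2 x * psi (nrm x) * dcutoff m x).
have cg m : continuous (g m).
  apply: contN; apply: contM; last exact: dcut_cont.
  apply: contM; last by apply: cont_comp => //; exact: nrm_cont.
  by apply: contM => //; exact: cont_cst.
have gE m : \int[muB]_x g m x = - \int[muB]_x (f (nrm x) * cutoff m x).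
  rewrite -(radial_ibp (sm_test_cut m)); apply: eq_Rintegral => x _.
  rewrite (eq_bigr (fun i => x 0 i * x 0 i * (- 2 * psi (nrm x) * dcutoff m x))).
    by rewrite -mulr_suml -/(dot x x) -/(norm2 x) /g; ring.
  by move=> i _; rewrite (hasP_partial (cut_partial m i x)); ring.
have gb m x : norm2 x < 1 -> `|g m x| <= 2 * C * `|(1 - norm2 x) * dcutoff m x|.
  move=> x1; have n1 := nrm_lt1 x1; have n0 := nrm_ge0 x; have s0 := norm2_ge0 x.
  rewrite /g normrN !normrM (ger0_norm s0) normr_nat (ger0_norm (_ : 0 <= 1 - norm2 x)); last by lra.
  rewrite [leRHS]mulrA ler_wpM2r//.
  have := HC (nrm x); rewrite n0 ltW// => /(_ isT).
  have : 1 - nrm x <= 1 - norm2 x by rewrite -nrm_sqr expr2; nra.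
  by have := normr_ge0 (psi (nrm x)); nra.
have g0 : \int[muB]_x g m x @[m --> \oo] --> (0 : R).
  have [||||_] := @ball_dominated R n.+1 g (fun=> 0) (2 * C * C').
  - by move=> m; exact: continuous_measurable_rV.
  - exact: measurable_cst.
  - move=> m x x1; apply: le_trans (gb m x x1) _; rewrite ler_wpM2l//; lra.
  - move=> x x1; apply/cvgrPdist_le => e e0.
    have e1 : 0 < e / (2 * C + 1) by rewrite divr_gt0//; lra.
    have /cvgrPdist_le/(_ _ e1) := dcut_cvg x1.
    apply: filterS => m; rewrite sub0r normrN sub0r [`|- g m x|]normrN => H.
    apply: le_trans (gb m x x1) _; move: H; rewrite ler_pdivlMr; last by lra.
    by have := normr_ge0 ((1 - norm2 x) * dcutoff m x); nra.
  - by rewrite Rintegral_cst// mul0r.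
have f0 : \int[muB]_x g m x @[m --> \oo] --> - \int[muB]_x f (nrm x).
  have [mf [A HA]] := bdd_cont cf'.
  have [||||_] := @ball_dominated R n.+1 (fun m x => f (nrm x) * cutoff m x) (fun x => f (nrm x)) A.
  - move=> m; apply: continuous_measurable_rV; apply: contM => //; apply: sm_continuous; exact: sm_cut.
  - by [].
  - move=> m x x1; have /andP[c0 c1] := cut_bound m x; rewrite normrM (ger0_norm c0).
    by apply: le_trans (HA x x1); rewrite ler_piMr.
  - move=> x x1; rewrite -[X in _ --> X]mulr1; apply: cvgMr; exact: cut_cvg.
  - by under [X in _ -> X @ _ --> _]eq_fun do rewrite gE; move=> H; exact: cvgN.
by apply/eqP; rewrite -oppr_eq0; apply/eqP; exact: cvg_unique f0 g0.
Qed.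

End source.

Definition omega : R := fine (muB setT).

(** Subtracting the constant with the same total flux reduces to [polar0]. Only the volume [omega]
    of the ball appears, and no measure on the sphere has to be constructed. *)
Lemma polar (f Phi : R -> R) : continuous f -> Phi 0 = 0 ->
  (forall r, hasD Phi r (r ^+ n * f r)) -> \int[muB]_x f (nrm x) = n.+1%:R * omega * Phi 1.
Proof.
move=> cf Phi0 dPhi; pose c := n.+1%:R * Phi 1.
have cf' : continuous (fun x : 'rV[R]_n.+1 => f (nrm x)) by apply: cont_comp => //; exact: nrm_cont.
have := @polar0 (fun r => f r - c) (fun r => Phi r - Phi 1 * r ^+ n.+1).
rewrite RintegralB//; [|exact/bdd_integrable/bdd_cont|by apply/bdd_integrable/bdd_cont; exact: cont_cst].
rewrite Rintegral_cst// -/omega => H; apply/eqP.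
rewrite (_ : n.+1%:R * omega * Phi 1 = c * omega); last by rewrite /c; ring.
rewrite -subr_eq0; apply/eqP; apply: H.
- by move=> r; ct_auto.
- by rewrite Phi0 expr0n/= mulr0 subr0.
- move=> r; apply: der_eq; first by der_auto.
  by rewrite /c /=; ring.
- by rewrite expr1n mulr1 subrr.
Qed.

Lemma omega_gt0 : 0 < omega.
Proof.
(* A cube small enough to fit in the ball, as $(n+1)/(n+2)^2<1$. *)
pose M : R := n.+2%:R^-1; have M0 : 0 < M by rewrite invr_gt0.
rewrite /omega fine_gt0// ball_lty andbT.
apply: (@lt_le_trans _ _ ((2 * M) ^+ n.+1)%:E); first by rewrite lte_fin exprn_gt0// mulr_gt0.
rewrite -cube_measure// /ball_measure/= /mrestr setTI.
apply: le_measure; rewrite ?inE; [exact: measurable_cube|exact: measurable_unit_ball|].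
move=> x xM; apply/unit_ballE; rewrite /norm2 /dot.
apply: (@le_lt_trans _ _ (\sum_(i < n.+1) M ^+ 2)).
  apply: ler_sum => i _; have := xM i; rewrite /= in_itv/= -ler_norml => H.
  by rewrite -expr2 -real_normK ?num_real// lerXn2r ?nnegrE ?(ltW M0).
rewrite sumr_const card_ord -mulr_natl /M exprVn -[n.+2%:R]natr1 ltr_pdivrMr ?mul1r; last by rewrite exprn_gt0//; lra.
have : 0 <= n.+1%:R :> R by [].
by move: (n.+1%:R) => a a0; rewrite expr2; nra.
Qed.

End polar.

(** * Uniqueness of weak gradients *)

Section fundamental_lemma.
Context {R : realType} {N : nat}.
Local Notation muB := (@ball_measure R N).

(** These sets form a generating family stable under intersection, and their indicators are
    pointwise limits of products of one-variable flat functions. *)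
Definition orthant (a : 'rV[R]_N) := [set x : 'rV[R]_N | forall i, a 0 i < x 0 i].

Definition orthants : set (set 'rV[R]_N) := range orthant.

Lemma orthantE a : orthant a = [set x : 'rV[R]_N | forall i, `]a 0 i, +oo[%classic (x 0 i)].
Proof. by apply/seteqP; split=> x /= H i; have := H i; rewrite in_itv/= andbT. Qed.

Lemma measurable_orthant a : measurable (orthant a).
Proof.
rewrite orthantE; apply: (measurable_box (A := fun i => `]a 0 i, +oo[%classic)) => i.
exact: measurable_itv.
Qed.

Lemma orthants_setI : setI_closed orthants.
Proof.
move=> _ _ [a _ <-] [b _ <-]; exists (\row_i Num.max (a 0 i) (b 0 i)) => //.
apply/seteqP; split=> x /=.
  by move=> H; split=> i; have := H i; rewrite mxE gt_max => /andP[].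
by move=> [xa xb] i; rewrite mxE gt_max xa xb.
Qed.

Lemma sigma_orthants (E : set 'rV[R]_N) : measurable E -> <<s orthants>> E.
Proof.
have mc i : measurable_fun (setT : set (g_sigma_algebraType orthants)) (@rV_coord R N i).
  apply: (measurability (@RGenOInfty.G R)).
    exact: RGenOInfty.measurableE.
  move=> _ [_ [a ->] <-]; rewrite setTI.
  rewrite (_ : _ @^-1` _ = \bigcup_k orthant (\row_j (if j == i then a else - k%:R))).
    by apply: bigcup_measurable => k _; apply: sub_sigma_algebra; eexists.
  apply/seteqP; split=> x /=; rewrite in_itv/= andbT /rV_coord.
    move=> ax; have [k Hk] : exists k : nat, forall j, - k%:R < x 0 j.
      exists (Num.truncn (nrm x)).+1 => j; rewrite ltrNl.
      apply: le_lt_trans (ler_norm _) _; rewrite normrN; apply: le_lt_trans (coord_nrm x j) _.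
      exact: truncnS_gt.
    by exists k => // j; rewrite mxE; case: eqP => [->|].
  by move=> [k _ /(_ i)]; rewrite mxE eqxx.
move: E; apply: smallest_sub; first exact: smallest_sigma_algebra.
by rewrite -bigcup_seq; apply: bigcup_sub => i _ _ [B mB <-]; exact: mc.
Qed.

Lemma cvg_prod1 (I : finType) (f : I -> nat -> R) : (forall i, f i m @[m --> \oo] --> (1 : R)) ->
  \prod_i f i m @[m --> \oo] --> (1 : R).
Proof.
move=> H; rewrite unlock; elim: (index_enum I) => [|j s IH] /=; first exact: cvg_cst.
by rewrite -[X in _ --> X]mulr1; apply: cvgM.
Qed.

Definition orthant_bump (a : 'rV[R]_N) (m : nat) (x : 'rV[R]_N) : R :=
  \prod_(i < N) flat 1 (m.+1%:R * (x 0 i - a 0 i)).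

Lemma orthant_bump_bound a m x : 0 <= orthant_bump a m x <= 1.
Proof.
rewrite /orthant_bump; apply/andP; split.
  by apply: prodr_ge0 => i _; have /andP[] := bump1_bound (m.+1%:R * (x 0 i - a 0 i)).
by apply: prodr_ile1 => i _; exact: bump1_bound.
Qed.

Lemma orthant_bump_cvg a x :
  orthant_bump a m x @[m --> \oo] --> (\1_(orthant a) x : R).
Proof.
rewrite indicE; have [H|H] := pselect (orthant a x); [rewrite mem_set//|rewrite memNset//].
  apply: cvg_prod1 => i; apply: flat1_cvg => A; have xa : 0 < x 0 i - a 0 i by rewrite subr_gt0.
  near=> m; rewrite -ler_pdivrMr//.
  have : A / (x 0 i - a 0 i) <= m%:R by near: m; exact: nbhs_infty_ger.
  by rewrite -[m.+1%:R]natr1; order_lra.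
have [i /negP xi] : exists i, ~ a 0 i < x 0 i by exact/existsNP.
rewrite (_ : (fun m => _) = fun=> 0); first exact: cvg_cst.
apply/funext => m; rewrite /orthant_bump (bigD1 i)//= bump_le0 ?mul0r//.
by rewrite mulr_ge0_le0// subr_le0 leNgt.
Unshelve. all: by end_near. Qed.

(** Testing against smoothed indicators of orthants, cut off near the sphere, makes the integral of
    [g] vanish on every orthant; the Dynkin class argument extends this to all measurable sets. *)
Lemma fundamental_lemma (g : 'rV[R]_N -> R) : muB.-integrable setT (EFin \o g) ->
  (forall phi, test_function phi -> \int[muB]_x (g x * phi x) = 0) ->
  {ae muB, forall x, g x = 0}.
Proof.
move=> ig Hg; have mg : measurable_fun setT g by have /integrableP[/measurable_EFinP] := ig.
have iE E : measurable E -> muB.-integrable E (EFin \o g).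
  by move=> mE; apply: (integrableS measurableT).
have orth (a : 'rV[R]_N) : (\int[muB]_(x in orthant a) (g x)%:E = 0)%E.
  pose A := orthant a; have mA : measurable A by exact: measurable_orthant.
  have mphi m : measurable_fun setT (fun x => g x * (orthant_bump a m x * cutoff m x)).
    apply: measurable_funM => //; apply: continuous_measurable_rV; apply: sm_continuous.
    apply: sm_mul; last exact: sm_cut.
    apply: sm_prod => i; apply: sm_bump; apply: sm_mul; first exact: sm_cst.
    by apply: sm_add; [exact: sm_coord|exact: sm_cst].
  have [|||||_ _] := @dominated_convergence _ _ R muB setT measurableT
    (fun m x => (g x * (orthant_bump a m x * cutoff m x))%:E) (fun x => (g x * \1_A x)%:E) (fun x => `|g x|%:E).
  - by move=> m; exact/measurable_EFinP.
  - apply/measurable_EFinP; apply: measurable_funM => //.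
  - apply: (@ball_ae _ _ (fun x => _ -> _)) => x x1 _; apply: cvg_EFin; first exact: nearW.
    apply: cvgMr; rewrite -[X in _ --> X]mulr1; apply: cvgM; first exact: orthant_bump_cvg.
    exact: cut_cvg.
  - exact: integrable_norm.
  - apply: (@ball_ae _ _ (fun x => forall m, _ -> _)) => x x1 m _; rewrite lee_fin normrM ler_piMr//.
    have /andP[b0 b1] := orthant_bump_bound a m x; have /andP[c0 c1] := cut_bound m x.
    by rewrite ger0_norm ?mulr_ge0// mulr_ile1.
  have E0 m : (\int[muB]_x (g x * (orthant_bump a m x * cutoff m x))%:E = 0)%E.
    have tp : test_function (fun x => orthant_bump a m x * cutoff m x).
      apply: cut_test; apply: sm_prod => i; apply: sm_bump; apply: sm_mul; first exact: sm_cst.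
      by apply: sm_add; [exact: sm_coord|exact: sm_cst].
    have := Hg _ tp; rewrite /Rintegral => Hf.
    rewrite -(fineK (_ : (\int[muB]_x (g x * (orthant_bump a m x * cutoff m x))%:E)%E \is a fin_num)) ?Hf//.
    apply: integrable_fin_num => //; apply: (le_integrable measurableT _ _ (integrable_norm ig)).
      exact/measurable_EFinP.
    move=> x _; rewrite /= lee_fin normr_id normrM ler_piMr//.
    have /andP[b0 b1] := orthant_bump_bound a m x; have /andP[c0 c1] := cut_bound m x.
    by rewrite ger0_norm ?mulr_ge0// mulr_ile1.
  rewrite /=; under [X in X @ _ --> _ -> _]eq_fun do rewrite E0.
  move=> Hc; have := cvg_lim (@ereal_hausdorff R) Hc; rewrite lim_cst//.
  move=> H0; rewrite integral_mkcond [RHS]H0.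
  apply: eq_integral => x _; rewrite patchE indicE; case: ifPn => xA; first by rewrite mulr1.
  by rewrite mulr0.
have allE E : measurable E -> (\int[muB]_(x in E) (g x)%:E = 0)%E.
  move=> mE; suff [] : measurable E /\ (\int[muB]_(x in E) (g x)%:E = 0)%E by [].
  move: mE => /sigma_orthants; rewrite -(setI_closed_g_dynkin_g_sigma_algebra orthants_setI).
  move: E; apply: smallest_sub; last first.
    by move=> _ [a _ <-]; split; [exact: measurable_orthant|exact: orth].
  (* The orthant with corner $-2$ in every coordinate contains the ball, hence has full measure.
     Closure under complements rests on this vanishing total integral. *)
  have I0 : (\int[muB]_x (g x)%:E = 0)%E.
    have mo := measurable_orthant (const_mx (- 2)).
    rewrite -(orth (const_mx (- 2))) (negligible_integral (measurableC mo) measurableT ig).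
      by rewrite setTD setCK.
    apply/eqP; rewrite eq_le measure_ge0 andbT -[leRHS](@ball_null R N).
    apply: le_measure; rewrite ?inE; [exact: measurableC|by apply: measurableC; exact: measurable_unit_ball|].
    apply: subsetC => x /unit_ballE x1 i; rewrite mxE.
    have : `|x 0 i| < 1 by apply: le_lt_trans (coord_nrm x i) _; exact: nrm_lt1.
    by rewrite ltr_norml; order_lra.
  split; first by split.
  - move=> E [mE E0]; split; first exact: measurableC.
    move: I0; rewrite -(setUv E) integral_setU//=; last 3 first.
    + exact: measurableC.
    + by rewrite setUv; exact/measurable_EFinP.
    + by rewrite disj_set2E setICr.
    by rewrite E0 add0e.
  - move=> F tF HF; split; first by apply: bigcup_measurable => k _; have [] := HF k.
    rewrite integral_bigcup//; last 2 first.
    + by move=> k; have [] := HF k.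
    + by apply: iE; apply: bigcup_measurable => k _; have [] := HF k.
    by apply: eseries0 => k _ _; have [] := HF k.
have := @integral_ae_eq _ _ R muB setT measurableT (cst 0%E) _ ig (measurable_cst _).
have EE E : E `<=` setT -> measurable E ->
    (\int[muB]_(x in E) (EFin \o g) x = \int[muB]_(x in E) (cst 0%E : _ -> \bar R) x)%E.
  by move=> _ mE; rewrite integral0; exact: allE.
by move=> /(_ EE); apply: filterS => x /(_ I) /= [].
Qed.

End fundamental_lemma.

Section sobolev_facts.
Context {R : realType} {N : nat}.
Local Notation muB := (@ball_measure R N).

Lemma bdd_Lfun2 (f : 'rV[R]_N -> R) : bdd f -> f \in Lfun muB 2%:E.
Proof.
move=> bf; have [mf _] := bf; rewrite inE/=; apply/andP; split; rewrite inE//=.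
rewrite /finite_norm unlock poweR_lty//.
have := integrable_lty measurableT (bdd_integrable (bddM bf bf)); apply: le_lt_trans.
rewrite le_eqVlt; apply/orP; left; apply/eqP; apply: eq_integral => x _ /=.
by congr EFin; rewrite (@powR_mulrn _ _ 2)// real_normK ?num_real// expr2.
Qed.

Lemma Lfun2_measurable (f : 'rV[R]_N -> R) : f \in Lfun muB 2%:E -> measurable_fun setT f.
Proof. by rewrite inE => /andP[]; rewrite inE. Qed.

Lemma Lfun2_integrable (f : 'rV[R]_N -> R) : f \in Lfun muB 2%:E -> muB.-integrable setT (EFin \o f).
Proof.
move=> Lf; apply/Lfun1_integrable; apply: Lfun_subset12 Lf.
by rewrite ge0_fin_numE ?measure_ge0// ball_lty.
Qed.

Lemma integrable_bddM (f b : 'rV[R]_N -> R) : muB.-integrable setT (EFin \o f) -> bdd b ->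
  muB.-integrable setT (EFin \o (fun x => b x * f x)).
Proof.
move=> ig [mb [C HC]]; have mf : measurable_fun setT f by have /integrableP[/measurable_EFinP] := ig.
have mbf : measurable_fun setT (fun x => b x * f x) by exact: measurable_funM.
apply/integrableP; split; first exact/measurable_EFinP.
have iC := integrableZl measurableT `|C| (integrable_norm ig).
apply: le_lt_trans (integrable_lty measurableT iC); apply: ae_ge0_le_integral => //.
- by apply: measurableT_comp => //; exact/measurable_EFinP.
- by move=> x _; rewrite /= -EFinM lee_fin mulr_ge0.
- by have /integrableP[] := iC.
- apply: (@ball_ae _ _ (fun x => _ -> _)) => x x1 _.
  rewrite /= -EFinM lee_fin normrM ler_wpM2r//; apply: le_trans (HC x x1) _; exact: ler_norm.
Qed.

Implicit Types (u : 'rV[R]_N -> R) (G : 'rV[R]_N -> 'rV[R]_N).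

Lemma weak_gradient_unique u G1 G2 : is_weak_gradient u G1 -> is_weak_gradient u G2 ->
  {ae muB, forall x, G1 x = G2 x}.
Proof.
move=> [L1 H1] [L2 H2].
have Hi i : {ae muB, forall x, G1 x 0 i - G2 x 0 i = 0}.
  have i1 := Lfun2_integrable (L1 i); have i2 := Lfun2_integrable (L2 i).
  apply: fundamental_lemma.
    have := integrableB measurableT i1 i2; congr (_.-integrable _ _).
  move=> phi tphi; have bphi : bdd phi by apply: bdd_cont; exact: test_cont.
  have E (G : 'rV[R]_N -> 'rV[R]_N) : (fun x => G x 0 i * phi x) = fun x => phi x * G x 0 i.
    by apply/funext => x; rewrite mulrC.
  under eq_Rintegral do rewrite mulrBl.
  rewrite RintegralB//; [|by rewrite E; exact: integrable_bddM..].
  by apply/eqP; rewrite subr_eq0 -eqr_opp -(H1 i phi tphi) (H2 i phi tphi).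
have : {ae muB, forall x, forall i, G1 x 0 i - G2 x 0 i = 0} by exact: filter_forall.
by apply: filterS => x H; apply/rowP => i; apply/eqP; rewrite -subr_eq0 H.
Qed.

Lemma weak_gradientP u G : is_weak_gradient u G -> is_weak_gradient u (weak_gradient u).
Proof. by move=> H; exact: (xgetPex (fun=> 0) (ex_intro _ G H)). Qed.

Lemma weak_gradientE u G : is_weak_gradient u G -> {ae muB, forall x, weak_gradient u x = G x}.
Proof. by move=> H; exact: weak_gradient_unique (weak_gradientP H) H. Qed.

(** Convergence in $L^2$ implies convergence against bounded functions because the measure is
    finite; the inequality $|y|\le d+y^2/d$, with $d$ small, stands in for Cauchy-Schwarz. *)
Lemma cvg_integral_bddM (h b : 'rV[R]_N -> R) (h_ : nat -> 'rV[R]_N -> R) (e : nat -> \bar R) :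
  muB.-integrable setT (EFin \o h) -> (forall k, bdd (h_ k)) -> bdd b ->
  (forall k, \int[muB]_x ((h x - h_ k x) ^+ 2)%:E <= e k)%E -> (e k @[k --> \oo] --> 0%E) ->
  \int[muB]_x (b x * h_ k x) @[k --> \oo] --> \int[muB]_x (b x * h x).
Proof.
move=> ih bh bb he e0; have [mb [C HC]] := bb.
have mh : measurable_fun setT h by have /integrableP[/measurable_EFinP] := ih.
pose om := fine (muB setT).
have om0 : 0 <= om by rewrite fine_ge0.
apply/cvgrPdist_le => eta eta0.
pose c := (`|C| + 1) * (om + 1); have c0 : 0 < c by rewrite mulr_gt0// ltr_wpDl.
pose d := eta / (2 * c); have d0 : 0 < d by rewrite divr_gt0// mulr_gt0.
have small : \forall k \near \oo, (e k <= (d * d)%:E)%E.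
  move: e0 => /fine_cvgP[ef /cvgrPdist_le/(_ _ (mulr_gt0 d0 d0))].
  apply: filterS2 ef => k kf; rewrite /= sub0r normrN => H.
  by rewrite -(fineK kf) lee_fin; apply: le_trans (ler_norm _) H.
apply: filterS small => k ek; have [mhk _] := bh k.
have ihk := bdd_integrable (bh k).
rewrite -RintegralB//; [|exact: integrable_bddM..].
have idiff : muB.-integrable setT (EFin \o (fun x => b x * h x - b x * h_ k x)).
  have := integrableB measurableT (integrable_bddM ih bb) (integrable_bddM ihk bb).
  by congr (_.-integrable _ _).
apply: le_trans (le_normr_Rintegral measurableT idiff) _.
have mD : measurable_fun setT (fun x => h x - h_ k x) by exact: measurable_funB.
have ie : (\int[muB]_x (`|C|%:E * (d%:E + d^-1%:E * ((h x - h_ k x) ^+ 2)%:E)) <= eta%:E)%E.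
  rewrite ge0_integralZl//; last 2 first.
  - apply: emeasurable_funD => //; apply: emeasurable_funM => //.
    by apply/measurable_EFinP; exact: measurable_funX.
  - by move=> x _; rewrite -EFinM -EFinD lee_fin addr_ge0 ?(ltW d0)// mulr_ge0 ?sqr_ge0// invr_ge0 ltW.
  rewrite ge0_integralD//; last 3 first.
  - by move=> x _; rewrite lee_fin ltW.
  - by move=> x _; rewrite mule_ge0// lee_fin ?sqr_ge0// invr_ge0 ltW.
  - apply: emeasurable_funM => //.
    by apply/measurable_EFinP; exact: measurable_funX.
  rewrite integral_cst// ge0_integralZl//; last 3 first.
  - by apply/measurable_EFinP; exact: measurable_funX.
  - by move=> x _; rewrite lee_fin sqr_ge0.
  - by rewrite lee_fin invr_ge0 ltW.
  have Ik := le_trans (he k) ek.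
  have omE : muB setT = om%:E by rewrite fineK// ge0_fin_numE// ball_lty.
  rewrite omE; apply: (@le_trans _ _ (`|C| * (d * om + d^-1 * (d * d)))%:E).
    rewrite (EFinM `|C|) (EFinD (d * om)) (EFinM d om) (EFinM d^-1).
    apply: lee_wpmul2l; first by rewrite lee_fin.
    apply: leeD2l; apply: lee_wpmul2l; first by rewrite lee_fin invr_ge0 ltW.
    exact: Ik.
  rewrite lee_fin mulrA mulVf ?gt_eqF// mul1r.
  have -> : eta = 2 * (d * c) by rewrite /d; field; rewrite gt_eqF.
  have -> : `|C| * (d * om + d) = d * c - d * (om + 1) by rewrite /c; ring.
  have h1 : 0 <= d * (om + 1) by rewrite mulr_ge0 ?addr_ge0// ltW.
  have h2 : 0 <= d * c by rewrite mulr_ge0// ltW.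
  by move: (d * c) (d * (om + 1)) h1 h2 => s t; lra.
rewrite -lee_fin; apply: le_trans ie.
rewrite /Rintegral fineK; last exact: integrable_fin_num (integrable_norm idiff).
apply: ae_ge0_le_integral => //.
- by have /integrableP[] := integrable_norm idiff.
- move=> x _; apply: mule_ge0; first by rewrite lee_fin.
  apply: adde_ge0; first by rewrite lee_fin ltW.
  by apply: mule_ge0; rewrite lee_fin ?sqr_ge0// invr_ge0 ltW.
- apply: emeasurable_funM => //; apply: emeasurable_funD => //; apply: emeasurable_funM => //.
  by apply/measurable_EFinP; exact: measurable_funX.
- apply: (@ball_ae _ _ (fun x => _ -> _)) => x x1 _.
  rewrite /= -(EFinM d^-1) -(EFinD d) -(EFinM `|C|) lee_fin -mulrBr normrM.
  apply: ler_pM => //; first by apply: le_trans (HC x x1) _; exact: ler_norm.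
  set y := h x - h_ k x; rewrite -[y ^+ 2]real_normK ?num_real//.
  have := normr_ge0 y; move: (`|y|) => t t0.
  have [td|td] := leP t d; first by rewrite ler_wpDr// mulr_ge0 ?sqr_ge0// invr_ge0 ltW.
  have : t <= d^-1 * t ^+ 2 by rewrite mulrC ler_pdivlMr// expr2 ler_wpM2l// ltW.
  by lra.
Qed.

End sobolev_facts.

(** * Polynomial approximation *)

Section bernstein.
Context {R : realType}.
Implicit Types (f g h : nat -> R) (x y a c : R).

(** The expectation of [f] at the number of successes among [n] tosses of probability $x$, defined
    by conditioning on one toss. Induction then replaces all identities on binomial coefficients. *)
Fixpoint bernstein (n : nat) f : {poly R} :=
  if n is m.+1 then 'X * bernstein m (fun k => f k.+1) + (1 - 'X) * bernstein m f else (f 0%N)%:P.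

Lemma bernsteinS n f x : (bernstein n.+1 f).[x] =
  x * (bernstein n (fun k => f k.+1)).[x] + (1 - x) * (bernstein n f).[x].
Proof. by rewrite /= !hornerE. Qed.

(** The mean $nx$ and the variance $nx(1-x)$ of the binomial law. *)
Lemma bernstein_sqr n a c y x : (bernstein n (fun k => a * (k%:R - y) ^+ 2 + c)).[x] =
  a * ((n%:R * x - y) ^+ 2 + n%:R * x * (1 - x)) + c.
Proof.
elim: n y => [|n IH] y; first by rewrite /= hornerC; ring.
rewrite bernsteinS IH (_ : (fun k => _) = fun k => a * (k%:R - (y - 1)) ^+ 2 + c).
  by rewrite IH -[n.+1%:R]natr1; ring.
by apply/funext => k; rewrite -[k.+1%:R]natr1; ring.
Qed.

Lemma bernsteinB n f c x : (bernstein n f).[x] - c = (bernstein n (fun k => f k - c)).[x].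
Proof.
elim: n f => [|n IH] f; first by rewrite /= !hornerC.
by rewrite !bernsteinS -!IH; ring.
Qed.

Lemma bernstein_norm n f h x : 0 <= x <= 1 -> (forall k, (k <= n)%N -> `|f k| <= h k) ->
  `|(bernstein n f).[x]| <= (bernstein n h).[x].
Proof.
move=> /andP[x0 x1]; elim: n f h => [|n IH] f h H; first by rewrite /= !hornerC; exact: H.
rewrite !bernsteinS; apply: le_trans (ler_normD _ _) _.
rewrite !normrM (ger0_norm x0) (ger0_norm (_ : 0 <= 1 - x)) ?subr_ge0//.
apply: lerD; apply: ler_wpM2l; rewrite ?subr_ge0//; apply: IH => k kn; apply: H => //.
exact: leqW.
Qed.

End bernstein.

Section weierstrass.
Context {R : realType}.

Lemma heine (g : R -> R) (a b e : R) : continuous g -> 0 < e -> exists2 d, 0 < d &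
  forall x y, a <= x <= b -> `|y - x| < d -> `|g y - g x| <= e.
Proof.
move=> cg e0; have e2 : 0 < e / 2 by rewrite divr_gt0.
have := (@compact_near_coveringP _ `[a, b]).1 (@segment_compact R a b).
move=> /(_ R (0 : R)^'+ (fun d x => forall y, `|y - x| < d -> `|g y - g x| <= e) _) [].
  move=> x _; have [d d0 Hd] := epsdeltaP (cg x) e2; have d2 : 0 < d / 2 by rewrite divr_gt0.
  exists ([set x' | `|x' - x| < d / 2], [set d' | d' < d / 2]) => /=.
    split; last by exact: nbhs_right_lt.
    by exists (d / 2) => //= z; rewrite /ball_/= distrC.
  move=> [x' d'] /= [xx' dd'] y yd'.
  have h1 : `|x' - x| < d by order_lra.
  have h2 : `|y - x| < d.
    by rewrite (_ : y - x = (y - x') + (x' - x)); [apply: le_lt_trans (ler_normD _ _) _; order_lra|ring].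
  rewrite (_ : g y - g x' = (g y - g x) - (g x' - g x)); last by ring.
  apply: le_trans (ler_normB _ _) _; have := Hd _ h1; have := Hd _ h2; order_lra.
move=> d0 /= d00 Hd; exists (d0 / 2); first by rewrite divr_gt0.
move=> x y xab; apply: (Hd (d0 / 2)) => /=; last by rewrite in_itv.
  by rewrite sub0r normrN gtr0_norm ?divr_gt0//; order_lra.
by rewrite divr_gt0.
Qed.

Lemma weierstrass (g : R -> R) (e : R) : continuous g -> 0 < e ->
  exists P : {poly R}, forall x, 0 <= x <= 1 -> `|P.[x] - g x| <= e.
Proof.
move=> cg e0; have e2 : 0 < e / 2 by rewrite divr_gt0.
have [d d0 Hd] := heine 0 1 cg e2; have [M M0 HM] := continuous_bounded_itv 0 1 cg.
pose n := (Num.truncn (4 * M / (d ^+ 2 * e))).+1.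
have nE : 4 * M / (d ^+ 2 * e) < n%:R by exact: truncnS_gt.
have n0 : 0 < n%:R :> R by rewrite ltr0n.
have de : 0 < d ^+ 2 * e by rewrite mulr_gt0// exprn_gt0.
exists (bernstein n (fun k => g (k%:R / n%:R))) => x x01; have /andP[x0 x1] := x01.
(* Chebyshev's argument: $|g(t)-g(x)|\le e/2+2M(t-x)^2/d^2$, by uniform continuity for close points
   and by boundedness otherwise. The choice of [n] makes the variance of the second term at most
   $e/2$. *)
rewrite bernsteinB; pose a := 2 * M / (d * n%:R) ^+ 2.
have a0 : 0 <= a by rewrite divr_ge0 ?sqr_ge0// mulr_ge0.
apply: le_trans (bernstein_norm (h := fun k => a * (k%:R - n%:R * x) ^+ 2 + e / 2) x01 _) _.
  move=> k kn; set t := k%:R / n%:R.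
  have t01 : 0 <= t <= 1 by rewrite divr_ge0//= ler_pdivrMr// mul1r ler_nat.
  have -> : k%:R - n%:R * x = n%:R * (t - x) by rewrite mulrBr /t mulrCA divff ?mulr1// gt_eqF.
  have -> : a * (n%:R * (t - x)) ^+ 2 = 2 * M * ((t - x) / d) ^+ 2.
    by rewrite /a; field; rewrite !gt_eqF.
  have q0 := sqr_ge0 ((t - x) / d).
  have [td|td] := ltP `|t - x| d.
    by apply: le_trans (Hd _ _ x01 td) _; rewrite lerDr mulr_ge0// mulr_ge0.
  apply: le_trans (ler_normB _ _) _; have gt := HM t t01; have gx := HM x x01.
  have : 1 <= ((t - x) / d) ^+ 2.
    rewrite -[_ ^+ 2]real_normK ?num_real// exprn_ege1// normrM normfV (gtr0_norm d0).
    by rewrite ler_pdivlMr// mul1r.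
  move: (_ ^+ 2) => s s1; have := ler_wpM2l M0 s1; order_lra.
rewrite bernstein_sqr subrr expr0n/= add0r.
have h1 : n%:R * x * (1 - x) <= n%:R.
  by rewrite -mulrA ler_piMr// ?ltW//; order_nra.
have h2 : a * n%:R <= e / 2.
  have -> : a * n%:R = 2 * M / (d ^+ 2 * n%:R) by rewrite /a; field; rewrite !gt_eqF.
  rewrite ler_pdivrMr ?mulr_gt0 ?exprn_gt0//.
  by move: nE; rewrite ltr_pdivrMr//; order_lra.
by have := ler_wpM2l a0 h1; order_lra.
Qed.

Lemma poly_antiderivative (Q : {poly R}) : exists P : {poly R}, P^`() = Q.
Proof.
exists (\sum_(i < size Q) (Q`_i / i.+1%:R) *: 'X^(i.+1)).
rewrite raddf_sum/= -[RHS]coefK poly_def; apply: eq_bigr => i _.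
rewrite derivZ derivXn/=.
rewrite -['X^i *+ _]scaler_nat.
by rewrite scalerA divfK// pnatr_eq0.
Qed.

End weierstrass.

(** * Radial functions in the Sobolev space *)

Section H10_limits.
Context {R : realType} {N : nat}.
Local Notation muB := (@ball_measure R N).

Lemma measurable_norm2 (G : 'rV[R]_N -> 'rV[R]_N) : (forall i, measurable_fun setT (fun x => G x 0 i)) ->
  measurable_fun setT (fun x => norm2 (G x)).
Proof. by move=> mG; apply: measurable_sum => i; exact: measurable_funM. Qed.

Lemma cvg_sum0 (I : finType) (f : I -> nat -> R) (a : I -> R) : (forall i, f i m @[m --> \oo] --> a i) ->
  \sum_i f i m @[m --> \oo] --> \sum_i a i.
Proof.
move=> H; rewrite !unlock; elim: (index_enum I) => [|j s IH] /=; first exact: cvg_cst.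
exact: cvgD.
Qed.

Section limits.
Variables (v : 'rV[R]_N -> R) (phi : nat -> 'rV[R]_N -> R).
Hypotheses (v1 : in_H1 v) (tphi : forall k, test_function (phi k)).
Hypothesis cv : (\int[muB]_x ((v x - phi k x) ^+ 2 +
       norm2 (weak_gradient v x - gradient (phi k) x))%:E)%E @[k --> \oo] --> 0%E.

Let wgv : is_weak_gradient v (weak_gradient v).
Proof. by case: v1 => _ [G HG]; exact: weak_gradientP HG. Qed.

Let mv : measurable_fun setT v. Proof. by apply: Lfun2_measurable; case: v1. Qed.
Let mwg i : measurable_fun setT (fun x => weak_gradient v x 0 i).
Proof. by apply: Lfun2_measurable; case: wgv. Qed.

Let mg k i : measurable_fun setT (fun x => (weak_gradient v x - gradient (phi k) x) 0 i).
Proof.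
rewrite (_ : (fun x => _) = fun x => weak_gradient v x 0 i - partial i (phi k) x).
  by apply: measurable_funB => //; apply: continuous_measurable_rV; exact: test_partial_cont.
by apply/funext => x; rewrite !mxE.
Qed.

Let mphi k : measurable_fun setT (phi k).
Proof. by apply: continuous_measurable_rV; exact: test_cont. Qed.

(** With its companion for the gradient, this carries identities from test functions to all of
    $H_0^1$; the other factor is continuous, hence bounded on the ball, in every use. *)
Lemma H10_limit (b : 'rV[R]_N -> R) : bdd b ->
  \int[muB]_x (b x * phi k x) @[k --> \oo] --> \int[muB]_x (b x * v x).
Proof.
move=> bb; apply: cvg_integral_bddM cv => //.
- by apply: Lfun2_integrable; case: v1.
- by move=> k; apply: bdd_cont; exact: test_cont.
- move=> k; apply: ge0_le_integral => //.
  + by move=> x _; rewrite lee_fin sqr_ge0.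
  + by apply/measurable_EFinP; apply: measurable_funX; exact: measurable_funB.
  + apply/measurable_EFinP; apply: measurable_funD.
      by apply: measurable_funX; exact: measurable_funB.
    exact: measurable_norm2.
  + by move=> x _; rewrite lee_fin lerDl norm2_ge0.
Qed.

Lemma H10_limit_grad (b : 'rV[R]_N -> R) i : bdd b ->
  \int[muB]_x (b x * partial i (phi k) x) @[k --> \oo] --> \int[muB]_x (b x * weak_gradient v x 0 i).
Proof.
move=> bb; apply: (cvg_integral_bddM (h := fun x => weak_gradient v x 0 i) _ _ bb _ cv).
- by apply: Lfun2_integrable; case: wgv.
- by move=> k; apply: bdd_cont; exact: test_partial_cont.
- move=> k; apply: ge0_le_integral => //.
  + by move=> x _; rewrite lee_fin sqr_ge0.
  + apply/measurable_EFinP; apply: measurable_funX; have := mg k i.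
    by congr (measurable_fun _ _); apply/funext => x; rewrite !mxE.
  + apply/measurable_EFinP; apply: measurable_funD.
      by apply: measurable_funX; exact: measurable_funB.
    exact: measurable_norm2.
  + move=> x _; rewrite lee_fin; apply: ler_wpDl; first exact: sqr_ge0.
    by apply: le_trans (coord_norm2 _ i); rewrite !mxE.
Qed.

End limits.
End H10_limits.

Section profile.
Context {R : realType} (n : nat).
Local Notation muB := (@ball_measure R n.+1).
Variables (W Z f Phi : R -> R).
Hypotheses (dW : forall r, hasD W r (Z r)) (cZ : continuous Z) (Z0 : Z 0 = 0) (W1 : W 1 = 0).
Hypotheses (cf : continuous f) (Phi0 : Phi 0 = 0) (dPhi : forall r, hasD Phi r (r ^+ n * f r)).
Hypothesis PhiZ : forall r : R, 0 < r -> Phi r = r ^+ n * Z r.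

Local Notation K := (mean n f Phi).
Definition profile (x : 'rV[R]_n.+1) : R := W (nrm x).
Definition profile_grad (x : 'rV[R]_n.+1) : 'rV[R]_n.+1 := \row_i (x 0 i * K (nrm x)).

Let cK : continuous K. Proof. exact: mean_cont. Qed.
Let cW : continuous W. Proof. by move=> r; exact: der_cont (@dW r). Qed.

Let ZK (r : R) : 0 <= r -> Z r = r * K r.
Proof.
rewrite le_eqVlt => /predU1P[<-|r0]; first by rewrite Z0 mul0r.
rewrite /mean r0 PhiZ// exprS; have rn : r != 0 by rewrite gt_eqF.
by have rnn := expf_neq0 n rn; move: (r ^+ n) rnn => q q0; field; rewrite q0.
Qed.

Lemma profile_cont : continuous profile.
Proof. by apply: cont_comp => //; exact: nrm_cont. Qed.

Lemma profile_grad_cont i : continuous (fun x => profile_grad x 0 i).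
Proof.
under eq_fun do rewrite mxE; apply: contM; first by apply: sm_continuous; exact: sm_coord.
by apply: cont_comp => //; exact: nrm_cont.
Qed.

Lemma profile_partial i x : has_partial i profile x (profile_grad x 0 i).
Proof. by rewrite mxE; exact: (radial_partial i x dW Z0 ZK). Qed.

Lemma profile_weak_gradient : is_weak_gradient profile profile_grad.
Proof.
split; first by move=> i; apply: bdd_Lfun2; apply: bdd_cont; exact: profile_grad_cont.
move=> i phi tphi; apply: test_ibp => //; first exact: profile_cont.
  exact: profile_grad_cont.
exact: profile_partial.
Qed.

Lemma norm2_profile_grad x : norm2 (profile_grad x) = Z (nrm x) ^+ 2.
Proof.
rewrite ZK ?nrm_ge0// exprMn nrm_sqr /norm2 /dot mulr_suml.
by apply: eq_bigr => i _; rewrite !mxE; ring.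
Qed.

Lemma profile_H1 : in_H1 profile.
Proof.
split; first by apply: bdd_Lfun2; apply: bdd_cont; exact: profile_cont.
by exists profile_grad; exact: profile_weak_gradient.
Qed.

(** The derivative of $s\mapsto W(\sqrt s)$ is $K(\sqrt s)/2$, continuous up to $0$. Approximating
    it and integrating from $s=1$, where $W$ vanishes, controls the function and its derivative
    together, and makes the error vanish linearly at the sphere, as the cutoff demands. *)
Lemma profile_approx : exists P Q : nat -> {poly R},
  (forall k, (P k)^`() = Q k) /\ forall k s, 0 <= s <= 1 ->
  `|(Q k).[s] - K (Num.sqrt s) / 2| <= k.+1%:R^-1 /\
  `|(P k).[s] - W (Num.sqrt s)| <= k.+1%:R^-1 * (1 - s).
Proof.
have cg : continuous (fun s : R => K (Num.sqrt s) / 2).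
  apply: contM; last exact: cont_cst.
  by apply: cont_comp => //; exact: sqrt_continuous.
have /choice[P HP] (k : nat) : exists P : {poly R}, forall s, 0 <= s <= 1 ->
    `|(P^`()).[s] - K (Num.sqrt s) / 2| <= k.+1%:R^-1 /\
    `|P.[s] - W (Num.sqrt s)| <= k.+1%:R^-1 * (1 - s).
  have k0 : 0 < k.+1%:R^-1 :> R by rewrite invr_gt0.
  have [Q HQ] := weierstrass cg k0; have [P0 P0Q] := poly_antiderivative Q.
  exists (P0 - (P0.[1])%:P); rewrite derivB derivC subr0 P0Q => s s01; split; first exact: HQ.
  have /andP[s0 s1] := s01; rewrite hornerD hornerN hornerC.
  have := @abs_incr_le _ (fun t => P0.[t] - P0.[1] - W (Num.sqrt t)) (fun t => k.+1%:R^-1 * t)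
    (fun t => Q.[t] - K (Num.sqrt t) / 2) (fun=> k.+1%:R^-1) s 1 s1.
  rewrite subrr sqrtr1 W1 subr0 sub0r normrN -mulrBr; apply.
  - move=> t _; apply: cvgB; last by apply: continuous_comp; [exact: sqrt_continuous|exact: cW].
    by apply: cvgB; [exact: continuous_horner|exact: cvg_cst].
  - by move=> t _; ct_auto.
  - move=> t /andP[st t1]; have t0 : 0 < t by exact: le_lt_trans st.
    have dP0 : hasD (horner P0) t Q.[t] by rewrite -P0Q; exact: is_derive_poly.
    have dS : hasD (@Num.sqrt R) t (2 * Num.sqrt t)^-1 by exact: is_derive1_sqrt.
    have dWS := der_comp dS (@dW (Num.sqrt t)).
    apply: der_eq; first by apply: derD; [apply: derD; [exact: dP0|exact: der_cst]|apply: derN; exact: dWS].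
    have q0 : 0 < Num.sqrt t by rewrite sqrtr_gt0.
    by rewrite addr0 ZK ?(ltW q0)//; congr (_ - _); field; rewrite gt_eqF.
  - by move=> t _; apply: der_eq; [der_auto|rewrite /=; ring].
  - move=> t /andP[st t1]; apply: HQ; rewrite (ltW t1) (le_trans s0)// ltW//.
by exists P, (fun k => (P k)^`()); split.
Qed.

Lemma profile_H10 : in_H10 profile.
Proof.
split; first exact: profile_H1.
have [P [Q [PQ HPQ]]] := profile_approx.
pose phi k (x : 'rV[R]_n.+1) := (P k).[norm2 x] * cutoff k x.
have tphi k : test_function (phi k) by apply: cut_test; apply: sm_horner; exact: sm_norm2.
exists phi; split => //.
have gphi k i x : partial i (phi k) x =
    2 * x 0 i * ((Q k).[norm2 x] * cutoff k x - (P k).[norm2 x] * dcutoff k x).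
  apply: hasP_partial; apply: hasP_eq.
    apply: hasPM; last exact: cut_partial.
    by apply: hasP_comp; [exact: hasP_norm2|exact: is_derive_poly].
  by rewrite PQ; ring.
pose I k (x : 'rV[R]_n.+1) := (profile x - phi k x) ^+ 2 + norm2 (profile_grad x - gradient (phi k) x).
have mpp k : measurable_fun setT (fun x => (profile x - phi k x) ^+ 2).
  apply: measurable_funX; apply: measurable_funB; apply: continuous_measurable_rV.
    exact: profile_cont.
  exact: test_cont.
have mG k (G : 'rV[R]_n.+1 -> 'rV[R]_n.+1) : (forall i, measurable_fun setT (fun x => G x 0 i)) ->
    measurable_fun setT (fun x => (profile x - phi k x) ^+ 2 + norm2 (G x - gradient (phi k) x)).
  move=> mG; apply: measurable_funD => //; apply: measurable_norm2 => i.
  rewrite (_ : (fun x => _) = fun x => G x 0 i - partial i (phi k) x).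
    by apply: measurable_funB => //; apply: continuous_measurable_rV; exact: test_partial_cont.
  by apply/funext => x; rewrite !mxE.
have mI k : measurable_fun setT (I k).
  by apply: mG => i; apply: continuous_measurable_rV; exact: profile_grad_cont.
have IE k : (\int[muB]_x ((profile x - phi k x) ^+ 2 +
       norm2 (weak_gradient profile x - gradient (phi k) x))%:E = \int[muB]_x (I k x)%:E)%E.
  apply: ae_eq_integral => //.
  - apply/measurable_EFinP; apply: mG => i.
    by apply: Lfun2_measurable; have [] := weak_gradientP profile_weak_gradient.
  - exact/measurable_EFinP.
  - by apply: filterS (weak_gradientE profile_weak_gradient) => x Hx _; rewrite Hx.
under eq_fun do rewrite IE.
have [A A0 HA] := continuous_bounded_itv 0 1 cK; have [C HC] := @dcut_bound R n.+1.
have C0 : 0 <= C by apply: le_trans (HC 0%N 0).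
pose D := A + 1; have D0 : 0 <= D by rewrite /D; lra.
have k1 k : 0 < (k.+1%:R^-1 : R) <= 1 by rewrite invr_gt0 ltr0Sn/= invf_le1// ler1n.
have sq01 (s : R) : 0 <= s <= 1 -> 0 <= Num.sqrt s <= 1.
  by move=> /andP[s0 s1]; rewrite sqrtr_ge0/= -sqrtr1 ler_wsqrtr.
have QB k s : 0 <= s <= 1 -> `|(Q k).[s]| <= D.
  move=> s01; have [H _] := HPQ k s s01; have := HA _ (sq01 s s01); have /andP[_ kk] := k1 k.
  have -> : (Q k).[s] = ((Q k).[s] - K (Num.sqrt s) / 2) + K (Num.sqrt s) / 2 by rewrite subrK.
  move=> HK; apply: le_trans (ler_normD _ _) _; rewrite normrM (ger0_norm (_ : 0 <= 2^-1)) ?invr_ge0//.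
  rewrite /D; move: (normr_ge0 (K (Num.sqrt s))) H HK kk.
  by move: (`|K _|) (`|_ - _|) (k.+1%:R^-1) => a b c; lra.
have PB k s : 0 <= s <= 1 -> `|(P k).[s]| <= D * (1 - s).
  move=> /andP[s0 s1]; have P1 : (P k).[1] = 0.
    have one : 0 <= (1 : R) <= 1 by rewrite ler01 lexx.
    by have [_] := HPQ k 1 one; rewrite sqrtr1 W1 subr0 subrr mulr0 normr_le0 => /eqP.
  have := @abs_incr_le _ (horner (P k)) (fun t => D * t) (horner (Q k)) (fun=> D) s 1 s1.
  rewrite P1 sub0r normrN -mulrBr; apply.
  - by move=> t _; exact: continuous_horner.
  - by move=> t _; ct_auto.
  - by move=> t _; rewrite -PQ; exact: is_derive_poly.
  - by move=> t _; apply: der_eq; [der_auto|rewrite /=; ring].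
  - by move=> t /andP[st t1]; apply: QB; rewrite (ltW t1) (le_trans s0)// ltW.
(* A common bound for the errors in the function and, up to the factor $2x$, in the gradient; it is
   uniformly bounded and tends to $0$ pointwise. *)
pose T k (x : 'rV[R]_n.+1) := k.+1%:R^-1 + D * `|1 - cutoff k x| + D * `|(1 - norm2 x) * dcutoff k x|.
have IT k x : norm2 x < 1 -> `|I k x| <= 5 * T k x ^+ 2.
  move=> x1; set s := norm2 x; have s0 : 0 <= s by exact: norm2_ge0.
  have s01 : 0 <= s <= 1 by rewrite s0 ltW.
  have [HQ HP] := HPQ k s s01; have PB' := PB k s s01; have QB' := QB k s s01.
  have /andP[k0 _] := k1 k.
  have c0 := normr_ge0 (1 - cutoff k x); have d0 := normr_ge0 ((1 - s) * dcutoff k x).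
  have T1 : `|profile x - phi k x| <= T k x.
    have -> : profile x - phi k x = (W (Num.sqrt s) - (P k).[s]) + (P k).[s] * (1 - cutoff k x).
      by rewrite /profile /phi /nrm -/s; ring.
    apply: le_trans (ler_normD _ _) _; rewrite distrC normrM /T -/s.
    have h1 : k.+1%:R^-1 * (1 - s) <= k.+1%:R^-1 by rewrite ler_piMr ?(ltW k0)// gerBl.
    have h2 : D * (1 - s) <= D by rewrite ler_piMr// gerBl.
    have h3 := ler_wpM2r c0 (le_trans PB' h2); have h4 := mulr_ge0 D0 d0.
    by apply: le_trans (lerD (le_trans HP h1) h3) _; rewrite lerDl.
  (* The difference of the gradients is $2x\,y$, so its squared norm is $4|x|^2y^2$; with the error
     in the function this accounts for the factor $5=1+4$. *)
  pose y := K (nrm x) / 2 - (Q k).[s] * cutoff k x + (P k).[s] * dcutoff k x.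
  have T2 : `|y| <= T k x.
    have -> : y = (K (Num.sqrt s) / 2 - (Q k).[s]) + (Q k).[s] * (1 - cutoff k x) + (P k).[s] * dcutoff k x.
      by rewrite /y /nrm -/s; ring.
    apply: le_trans (ler_normD _ _) _; apply: lerD.
      apply: le_trans (ler_normD _ _) _; apply: lerD; first by rewrite distrC.
      by rewrite normrM ler_wpM2r.
    rewrite normrM -/s [`|(1 - s) * _|]normrM (ger0_norm (_ : 0 <= 1 - s)) ?mulrA; last by rewrite subr_ge0 ltW.
    by rewrite ler_wpM2r.
  have -> : I k x = (profile x - phi k x) ^+ 2 + 4 * s * y ^+ 2.
    congr (_ + _); rewrite /s /norm2 /dot mulr_sumr mulr_suml; apply: eq_bigr => i _.
    by rewrite !mxE gphi /y -/s; field.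
  have T0 : 0 <= T k x by apply: le_trans T1.
  have a2 : (profile x - phi k x) ^+ 2 <= T k x ^+ 2.
    by rewrite -real_normK ?num_real// lerXn2r ?nnegrE.
  have b2 : y ^+ 2 <= T k x ^+ 2 by rewrite -real_normK ?num_real// lerXn2r ?nnegrE.
  rewrite ger0_norm; last by rewrite addr_ge0 ?sqr_ge0// mulr_ge0 ?sqr_ge0// mulr_ge0.
  have s41 : 4 * s <= 4 by rewrite ler_piMr// ltW.
  have s40 : 0 <= 4 * s by rewrite mulr_ge0.
  have -> : 5 * T k x ^+ 2 = T k x ^+ 2 + 4 * T k x ^+ 2 by ring.
  exact: lerD a2 (ler_pM s40 (sqr_ge0 y) s41 b2).
have [||||+ _] := @ball_dominated R n.+1 I (fun=> 0) (5 * (1 + D + D * C) ^+ 2).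
- exact: mI.
- exact: measurable_cst.
- move=> k x x1; apply: le_trans (IT k x x1) _; rewrite ler_pM2l//.
  have /andP[k0 kk] := k1 k; have /andP[c0 c1] := cut_bound k x.
  have h1 : `|1 - cutoff k x| <= 1 by rewrite ger0_norm; lra.
  have h2 := ler_wpM2l D0 h1; have h3 := ler_wpM2l D0 (HC k x).
  have T0 : 0 <= T k x by rewrite !addr_ge0 ?(ltW k0) ?mulr_ge0.
  have DC : 0 <= D * C by exact: mulr_ge0.
  rewrite lerXn2r ?nnegrE//; first by lra.
  by rewrite mulr1 in h2; exact: lerD (lerD kk h2) h3.
- move=> x x1.
  have T0 : T k x @[k --> \oo] --> (0 : R).
    have -> : (0 : R) = 0 + D * `|(1 : R) - 1| + D * `|(0 : R)| by rewrite subrr !normr0; ring.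
    apply: cvgD; first apply: cvgD.
    - exact: cvg_harmonic.
    - by apply: cvgMr; apply: cvg_norm; apply: cvgB; [exact: cvg_cst|exact: cut_cvg].
    - by apply: cvgMr; apply: cvg_norm; exact: dcut_cvg.
  have TT : 5 * T k x ^+ 2 @[k --> \oo] --> (0 : R).
    have -> : (0 : R) = 5 * (0 * 0) by ring.
    by under eq_fun do rewrite expr2; apply: cvgMr; apply: cvgM.
  have TN : - (5 * T k x ^+ 2) @[k --> \oo] --> (0 : R) by rewrite -oppr0; exact: cvgN.
  apply: squeeze_cvgr TN TT; near=> k.
  by rewrite -ler_norml; exact: IT.
- by rewrite integral0.
Unshelve. all: by end_near. Qed.

(** For test functions this is [radial_ibp], since the gradient is the radial field with divergence
    $f(|x|)$; both sides pass to the limit along an approximation of [v]. *)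
Lemma profile_equation (v : 'rV[R]_n.+1 -> R) : in_H10 v ->
  \int[muB]_x dot (weak_gradient profile x) (weak_gradient v x) = - \int[muB]_x (f (nrm x) * v x).
Proof.
move=> [v1 [phi [tphi cv]]].
have wgv : is_weak_gradient v (weak_gradient v) by case: v1 => _ [G HG]; exact: weak_gradientP HG.
have wgu := weak_gradientP profile_weak_gradient.
have mdot (G : 'rV[R]_n.+1 -> 'rV[R]_n.+1) : (forall i, measurable_fun setT (fun x => G x 0 i)) ->
    measurable_fun setT (fun x => dot (G x) (weak_gradient v x)).
  move=> mG; apply: measurable_sum => i; apply: measurable_funM => //.
  by apply: Lfun2_measurable; case: wgv.
have -> : \int[muB]_x dot (weak_gradient profile x) (weak_gradient v x) =
          \int[muB]_x dot (profile_grad x) (weak_gradient v x).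
  congr fine; apply: ae_eq_integral => //.
  - by apply/measurable_EFinP; apply: mdot => i; apply: Lfun2_measurable; case: wgu.
  - by apply/measurable_EFinP; apply: mdot => i; apply: continuous_measurable_rV; exact: profile_grad_cont.
  - by apply: filterS (weak_gradientE profile_weak_gradient) => x Hx _; rewrite Hx.
have bg i : bdd (fun x => profile_grad x 0 i) by apply: bdd_cont; exact: profile_grad_cont.
have bf : bdd (fun x : 'rV[R]_n.+1 => f (nrm x)) by apply: bdd_cont; apply: cont_comp => //; exact: nrm_cont.
have -> : \int[muB]_x dot (profile_grad x) (weak_gradient v x) =
          \sum_i \int[muB]_x (profile_grad x 0 i * weak_gradient v x 0 i).
  rewrite /dot ball_sum// => i; apply: integrable_bddM => //.
  by apply: Lfun2_integrable; case: wgv.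
have L1 := cvg_sum0 (fun i => H10_limit_grad v1 tphi cv (i := i) (bg i)).
have L2 : (- \int[muB]_x (f (nrm x) * phi k x)) @[k --> \oo] --> - \int[muB]_x (f (nrm x) * v x).
  by apply: cvgN; exact: H10_limit.
have E k : \sum_i \int[muB]_x (profile_grad x 0 i * partial i (phi k) x) = - \int[muB]_x (f (nrm x) * phi k x).
  rewrite -ball_sum; last first.
    by move=> i; apply: integrable_bddM => //; apply: bdd_integrable; apply: bdd_cont; exact: test_partial_cont.
  rewrite -(radial_ibp cf Phi0 dPhi (tphi k)); apply: eq_Rintegral => x _.
  by apply: eq_bigr => i _; rewrite mxE.
move: L1; under eq_fun do rewrite E.
by move=> L1; exact: cvg_unique L1 L2.
Qed.

End profile.

(** * The rescaled solution *)

Section polar_positive.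
Context {R : realType} (n : nat).
Local Notation muB := (@ball_measure R n.+1).

Lemma polar_gt0 (g : R -> R) (a b : R) : continuous g -> (forall r, 0 <= g r) -> 0 <= a -> a < b -> b <= 1 ->
  (forall r, a < r < b -> 0 < g r) -> 0 < \int[muB]_x g (nrm x).
Proof.
move=> cg g0 a0 ab b1 gpos.
have cr : continuous (fun r : R => r ^+ n * g r) by move=> r; ct_auto.
have [Phi Phi0 dPhi] := primitive cr.
have cPhi : continuous Phi by move=> r; exact: der_cont (dPhi r).
rewrite (polar cg Phi0 dPhi) mulr_gt0// ?mulr_gt0 ?omega_gt0//.
have nd (s t : R) : 0 <= s -> s <= t -> Phi s <= Phi t.
  move=> s0 st; apply: (@nondecr _ Phi (fun r => r ^+ n * g r) _ _ st) => [r _|r _|r /andP[sr _]].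
  - exact: cPhi.
  - exact: dPhi.
  - by rewrite mulr_ge0 ?g0// exprn_ge0// (le_trans s0)// ltW.
have h1 : Phi a < Phi b.
  apply: (@incr _ Phi (fun r => r ^+ n * g r) _ _ ab) => [r _|r _|r /andP[ar rb]].
  - exact: cPhi.
  - exact: dPhi.
  - by rewrite mulr_gt0 ?gpos ?ar// exprn_gt0// (le_lt_trans a0).
have := nd 0 a (lexx 0) a0; have := nd b 1 (le_trans a0 (ltW ab)) b1; rewrite Phi0; order_lra.
Qed.

(** If the positive part vanished almost everywhere its integral would be zero, but in polar
    coordinates a shell contributes a positive amount. *)
Lemma profile_not_ae_le0 (W : R -> R) (a b : R) : continuous W -> 0 <= a -> a < b -> b <= 1 ->
  (forall r, a < r < b -> 0 < W r) -> ~ {ae muB, forall x, Num.max (profile W x : R) 0 = 0}.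
Proof.
move=> cW a0 ab b1 Wpos H.
have cg : continuous (fun r : R => Num.max (W r) 0).
  by move=> r; apply: (@continuous_max _ _ W (fun=> 0)); [exact: cW|exact: cst_continuous].
have := @polar_gt0 (fun r => Num.max (W r) 0) a b cg _ a0 ab b1.
rewrite (_ : \int[muB]_x _ = 0).
  move=> h; have := h _ _; rewrite ltxx => h'; suff : false by []; apply: h'.
    by move=> r; rewrite le_max lexx orbT.
  by move=> r /Wpos rpos; rewrite lt_max rpos.
transitivity (\int[muB]_x (0 : R)); last by rewrite Rintegral_cst// mul0r.
congr fine; apply: ae_eq_integral => //.
- apply/measurable_EFinP; apply: continuous_measurable_rV; exact: (cont_comp nrm_cont cg).
- by apply: filterS H => x Hx _; rewrite -/(profile W x) Hx.
Qed.

End polar_positive.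

Section scaled_solution.
Context {R : realType} (n : nat) (p l : R) (w z : R -> R) (r1 rho : R).
Local Notation muB := (@ball_measure R n.+1).
Hypotheses (p2 : 2 < p) (l0 : 0 <= l) (lp : l < 2 / p) (sol : is_sol n p l w z) (tz : two_zeros w r1 rho).

Definition amplitude : R := rho `^ (2 / (p - 2)).
Local Notation c := amplitude.
Definition scaled (r : R) : R := c * w (rho * r).
Definition scaled_slope (r : R) : R := c * rho * z (rho * r).
Definition scaled_source (r : R) : R := - (c * rho ^+ 2 * nl p l (w (rho * r))).
Local Notation u := (@profile R n scaled).

Let rho0 : 0 < rho. Proof. exact: r2_gt0 tz. Qed.
Let c0 : 0 < c. Proof. by rewrite powR_gt0. Qed.
Let pp0 : p != 0. Proof. by have h := p2; rewrite gt_eqF//; order_lra. Qed.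
Let p20 : p - 2 != 0. Proof. by have h := p2; rewrite gt_eqF//; order_lra. Qed.

Let l01 : 0 <= l <= 1.
Proof.
have h := p2; have h' := lp; rewrite l0/=; apply: ltW; apply: lt_trans h' _.
by rewrite ltr_pdivrMr; order_lra.
Qed.

Lemma rho_ge : 1 / 4 <= rho.
Proof. by have := sol_lower sol p2 l01 (ltW rho0); have [_ _ -> _ _] := tz; order_lra. Qed.

Lemma der_rescale (F : R -> R) (r d : R) : hasD F (rho * r) d -> hasD (fun t => F (rho * t)) r (d * rho).
Proof.
move=> dF; have h := derM (der_cst rho r) (der_id r); have := der_comp h dF.
by rewrite mul0r add0r mulr1.
Qed.

Lemma der_scaled (r : R) : hasD scaled r (scaled_slope r).
Proof.
apply: der_eq; first by apply: derM; [exact: der_cst|apply: der_rescale; exact: sol_dw sol _].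
by rewrite mul0r add0r /scaled_slope; ring.
Qed.

Lemma scaled_slope_cont : continuous scaled_slope.
Proof.
have cz := sol_cz sol; apply: contM; first exact: cont_cst.
by apply: (cont_comp _ cz); apply: contM; [exact: cont_cst|move=> r; exact: cvg_id].
Qed.

Lemma nl_cont : continuous (nl p l).
Proof.
apply: contD; first exact: continuous_pw.
by apply: contN; apply: contM; [exact: cont_cst|move=> r; exact: cvg_id].
Qed.

Lemma w_rescale_cont : continuous (fun r => w (rho * r)).
Proof.
by apply: (cont_comp _ (sol_cw sol)); apply: contM; [exact: cont_cst|move=> r; exact: cvg_id].
Qed.

Lemma scaled_source_cont : continuous scaled_source.
Proof.
apply: contN; apply: contM; first exact: cont_cst.
by apply: (cont_comp w_rescale_cont); exact: nl_cont.
Qed.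

Lemma scaled_slope0 : scaled_slope 0 = 0.
Proof. by rewrite /scaled_slope mulr0 (sol_z0 sol (lexx 0)) mulr0. Qed.

Lemma scaled1 : scaled 1 = 0.
Proof. by rewrite /scaled mulr1; have [_ _ -> _ _] := tz; rewrite mulr0. Qed.

(** The flux must be differentiable on the whole line, while $r^n$ times the slope is known to be so
    only for $r>0$. A primitive of the source is used instead; on $r>0$ the two have the same
    derivative and both start from $0$. *)
Lemma scaled_flux : exists2 Phi : R -> R, Phi 0 = 0 &
  (forall r, hasD Phi r (r ^+ n * scaled_source r)) /\
  (forall r : R, 0 < r -> Phi r = r ^+ n * scaled_slope r).
Proof.
have cs := scaled_source_cont; have cz := scaled_slope_cont.
have cr : continuous (fun r : R => r ^+ n * scaled_source r) by move=> r; ct_auto.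
have [Phi Phi0 dPhi] := primitive cr; exists Phi => //; split => // r r0.
have cPhi : continuous Phi by move=> x; exact: der_cont (dPhi x).
pose D (t : R) := Phi t - t ^+ n * scaled_slope t.
have cD : continuous D by rewrite /D => t; ct_auto.
have D0 : D 0 = 0 by rewrite /D Phi0 scaled_slope0 mulr0 subrr.
have dD t : 0 < t -> hasD D t 0.
  move=> t0; have rt : 0 < rho * t by rewrite mulr_gt0.
  have dz : hasD scaled_slope t (- (n%:R / t * scaled_slope t) - c * rho ^+ 2 * nl p l (w (rho * t))).
    have dz0 := der_rescale (sol_dz sol rt).
    apply: der_eq; first by apply: derM; [exact: der_cst|exact: dz0].
    by rewrite /scaled_slope; field; rewrite !gt_eqF.
  apply: der_eq; first by apply: derD; [exact: dPhi|exact: derN (der_rnz w t0 dz)].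
  by rewrite /scaled_source; ring.
have h1 := @nondecr _ D (fun=> 0) 0 r (ltW r0) (fun x _ => cD x) _ (fun x _ => lexx 0).
have h2 := @nonincr _ D (fun=> 0) 0 r (ltW r0) (fun x _ => cD x) _ (fun x _ => lexx 0).
have dD' x : 0 < x < r -> hasD D x 0 by move=> /andP[x0 _]; exact: dD.
have : D r = 0 by apply/eqP; rewrite eq_le -{1}D0 h2//= -{1}D0 h1.
by move/eqP; rewrite subr_eq0 => /eqP.
Qed.

Lemma amplitude_pow : c `^ (p - 2) = rho ^+ 2.
Proof. by rewrite -powRrM divfK// (@powR_mulrn _ _ 2)// ltW. Qed.

Lemma pw_scaled (x : R) : pw p (c * x) = c * rho ^+ 2 * pw p x.
Proof. by rewrite /pw normrM (gtr0_norm c0) powRM ?(ltW c0)// amplitude_pow; ring. Qed.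

Lemma scaled_weak_solution : weak_solution p (l * rho ^+ 2) u.
Proof.
have [Phi Phi0 [dPhi PhiZ]] := scaled_flux; have cs := scaled_source_cont.
split; first exact: (profile_H10 der_scaled scaled_slope0 scaled1 cs Phi0 dPhi PhiZ).
move=> v vH; rewrite (profile_equation der_scaled scaled_slope0 cs Phi0 dPhi PhiZ vH).
have iv : muB.-integrable setT (EFin \o v) by apply: Lfun2_integrable; case: vH => -[].
have cu : continuous u by exact: profile_cont der_scaled.
have bu : bdd u by exact: bdd_cont.
have cpu : continuous (fun x => pw p (u x)) by apply: cont_comp => //; exact: continuous_pw.
have bpu := bdd_cont cpu.
have bs : bdd (fun x : 'rV[R]_n.+1 => scaled_source (nrm x)).
  by apply: bdd_cont; apply: cont_comp => //; exact: nrm_cont.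
have -> : \int[muB]_x (`|u x| `^ (p - 2) * u x * v x) = \int[muB]_x (pw p (u x) * v x) by [].
rewrite -RintegralZl//; last exact: integrable_bddM.
have -> : \int[muB]_x (l * rho ^+ 2 * (u x * v x)) =
    \int[muB]_x (pw p (u x) * v x + scaled_source (nrm x) * v x).
  apply: eq_Rintegral => x _; rewrite -mulrDl mulrA; congr (_ * _).
  by rewrite /profile /scaled pw_scaled /scaled_source /nl; ring.
by rewrite RintegralD//; [ring|exact: integrable_bddM..].
Qed.

Lemma scaled_sign_changing : sign_changing u.
Proof.
have [/andP[r10 r12] _ _ wpos wneg] := tz.
have cW : continuous scaled by move=> r; exact: der_cont (der_scaled r).
have r1r : 0 < r1 / rho by rewrite divr_gt0.
have r1r1 : r1 / rho < 1 by rewrite ltr_pdivrMr// mul1r.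
have [rE] : rho * (r1 / rho) = r1 by rewrite mulrCA divff ?mulr1// gt_eqF.
split.
  apply: (profile_not_ae_le0 cW (lexx 0) r1r (ltW r1r1)) => r /andP[r0 rr].
  rewrite mulr_gt0// wpos// mulr_ge0 ?(ltW rho0) ?(ltW r0)//=.
  by rewrite -rE ltr_pM2l.
move=> H; have cN := contN cW.
apply: (profile_not_ae_le0 cN (ltW r1r) r1r1 (lexx 1)) => [r /andP[r0 rr]|].
  rewrite oppr_gt0 pmulr_rlt0// wneg// -{1}rE ltr_pM2l// r0/=.
  by rewrite -[X in _ < X]mulr1 ltr_pM2l.
apply: filterS H => x; rewrite /profile => H.
by rewrite -[X in Num.max _ X]oppr0 -oppr_min H oppr0.
Qed.

Lemma polar_rescale (g h F : R -> R) (k : R) : continuous h -> (forall r, h r = k * g (rho * r)) ->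
  F 0 = 0 -> (forall r, hasD F r (r ^+ n * g r)) ->
  \int[muB]_x h (nrm x) = n.+1%:R * omega n * (k / rho ^+ n.+1 * F rho).
Proof.
move=> ch hE F0 dF.
have rn : rho ^+ n != 0 by rewrite gt_eqF// exprn_gt0.
have rr : rho != 0 by rewrite gt_eqF.
rewrite (@polar R n h (fun r => k / rho ^+ n.+1 * F (rho * r)) ch).
- by rewrite mulr1.
- by rewrite mulr0 F0 mulr0.
- move=> r; apply: der_eq; first by apply: derM; [exact: der_cst|apply: der_rescale; exact: dF].
  by rewrite hE mul0r add0r exprMn exprS; move: (rho ^+ n) rn => q q0; field; rewrite q0.
Qed.

Lemma scaled_mass M : is_mass_integral n w M ->
  mass u = n.+1%:R * omega n * (rho `^ (- (n.+1%:R - 4 / (p - 2))) * M rho).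
Proof.
move=> [M0 dM]; have cW : continuous scaled by move=> r; exact: der_cont (der_scaled r).
have ch : continuous (fun r => scaled r ^+ 2) by move=> r; ct_auto.
rewrite /mass; under eq_Rintegral do rewrite real_normK ?num_real//.
rewrite (@polar_rescale (fun r => w r ^+ 2) (fun r => scaled r ^+ 2) M (c ^+ 2))//.
  congr (_ * (_ * _)); rewrite opprB powRD; last by rewrite (gt_eqF rho0) implybT.
  rewrite powRN powR_mulrn ?(ltW rho0)//; congr (_ / _).
  rewrite -powR_mulrn ?(ltW c0)// -powRrM; congr (_ `^ _); field.
  by [].
by move=> r; rewrite /scaled exprMn.
Qed.

Lemma scaled_energy G P : is_energy_integral n p w z G P ->
  energy p u = n.+1%:R * omega n * (rho `^ (4 / (p - 2) + 2 - n.+1%:R) * (G rho / 2 - P rho / p)).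
Proof.
move=> [G0 P0 dG dP].
have [Phi Phi0 [dPhi PhiZ]] := scaled_flux; have cs := scaled_source_cont.
have cW : continuous scaled by move=> r; exact: der_cont (der_scaled r).
have cZ := scaled_slope_cont.
have cZ2 : continuous (fun r => scaled_slope r ^+ 2) by move=> r; ct_auto.
have wg := profile_weak_gradient der_scaled scaled_slope0 cs Phi0 dPhi PhiZ.
have cWp : continuous (fun r => `|scaled r| `^ p).
  have -> : (fun r => `|scaled r| `^ p) = fun r => pw p (scaled r) * scaled r.
    by apply/funext => r; exact: powR_pw.
  by apply: contM => //; apply: cont_comp => //; exact: continuous_pw.
have E1 : \int[muB]_x norm2 (weak_gradient u x) = \int[muB]_x (scaled_slope (nrm x) ^+ 2).
  congr fine; apply: ae_eq_integral => //.
  - apply/measurable_EFinP; apply: measurable_norm2 => i; apply: Lfun2_measurable.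
    by have [] := weak_gradientP wg.
  - apply/measurable_EFinP; apply: continuous_measurable_rV.
    by apply: (cont_comp nrm_cont cZ2).
  - apply: filterS (weak_gradientE wg) => x Hx _; rewrite Hx.
    by rewrite (norm2_profile_grad _ scaled_slope0 PhiZ).
have k2 : c ^+ 2 * rho ^+ 2 / rho ^+ n.+1 = rho `^ (4 / (p - 2) + 2 - n.+1%:R).
  rewrite powRD; last by rewrite (gt_eqF rho0) implybT.
  rewrite powRD; last by rewrite (gt_eqF rho0) implybT.
  rewrite powRN !powR_mulrn ?(ltW rho0)//; congr (_ * _ / _).
  by rewrite -powR_mulrn ?(ltW c0)// -powRrM; congr (_ `^ _); field.
have cp : c `^ p = c ^+ 2 * rho ^+ 2.
  rewrite -amplitude_pow -(@powR_mulrn _ c 2) ?(ltW c0)// -powRD; last by rewrite (gt_eqF c0) implybT.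
  by congr (_ `^ _); ring.
rewrite /energy E1.
rewrite (@polar_rescale (fun r => z r ^+ 2) (fun r => scaled_slope r ^+ 2) G (c ^+ 2 * rho ^+ 2))//; last first.
  by move=> r; rewrite /scaled_slope; ring.
rewrite (@polar_rescale (fun r => `|w r| `^ p) (fun r => `|scaled r| `^ p) P (c `^ p))//; last first.
  by move=> r; rewrite /scaled normrM (gtr0_norm c0) powRM// ltW.
by rewrite cp k2; field.
Qed.

(** Half of Pohozaev's lower bound minus the potential term leaves the coefficient $(N(p-2)-4)/(4p)$
    with $N=n+1$, positive exactly when $p>p_c$. The potential integral is bounded below by its part
    on $[0,1/4]$, where $w\ge1/2$. *)
Lemma scaled_energy_lower : 4 / (p - 2) < n.+1%:R ->
  n.+1%:R * omega n * (rho `^ (4 / (p - 2) + 2 - n.+1%:R) * ((n.+1%:R * (p - 2) - 4) / (4 * p) *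
    ((1 / 2) `^ p * (1 / 4) ^+ n.+1 / n.+1%:R))) <= energy p u.
Proof.
move=> sup; have [G [P GP]] := energy_integral_exists sol p2.
rewrite (scaled_energy GP) ler_pM2l ?mulr_gt0 ?omega_gt0// ler_pM2l ?powR_gt0//.
have h := p2; have p0 : 0 < p by order_lra.
have kap : 0 <= (n.+1%:R * (p - 2) - 4) / (4 * p).
  rewrite divr_ge0 ?mulr_ge0 ?(ltW p0)// subr_ge0 -ler_pdivrMr ?ltW//.
  by rewrite subr_gt0.
apply: le_trans (ler_wpM2l kap (potential_lower sol GP p2 l01 rho_ge)) _.
have := pohozaev_ball sol GP p2 l01 tz.
have -> : (n.+1%:R * (p - 2) - 4) / (4 * p) * P rho =
  (n.+1%:R * (1 / 2 - 1 / p) * P rho) / 2 - P rho / p by field.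
by move: (_ * P rho) (P rho / p) => a b; order_lra.
Qed.

End scaled_solution.

(** * The theorem *)

Section asymptotics.
Context {R : realType}.

Lemma powR_large (C q A : R) : 0 < C -> 0 < q -> exists2 T : R, 0 < T &
  forall t, T <= t -> A <= C * t `^ q.
Proof.
move=> C0 q0; pose B := Num.max 1 (A / C); have B0 : 0 < B by rewrite lt_max ltr01.
exists (B `^ q^-1) => [|t Tt]; first exact: powR_gt0.
have T0 := powR_ge0 B q^-1.
rewrite mulrC -ler_pdivrMr//; apply: (@le_trans _ _ B); first by rewrite le_max lexx orbT.
have -> : B = (B `^ q^-1) `^ q by rewrite -powRrM mulVf ?gt_eqF// powRr1// ltW.
by apply: ge0_ler_powR; rewrite ?nnegrE ?(ltW q0)// (le_trans T0).
Qed.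

(** Serves the energy and lambda alike: each is at least a positive power of the radius, and the
    radius is forced to infinity by the small mass. The radius need not depend on [m] in any regular
    way. *)
Lemma blow_up (E : R -> R) (m0 c g C q : R) : 0 < m0 -> 0 < c -> 0 < g -> 0 < C -> 0 < q ->
  (forall m, 0 < m -> m < m0 -> exists2 rho, 0 < rho & c / m <= rho `^ g /\ C * rho `^ q <= E m) ->
  E m @[m --> 0^'+] --> +oo.
Proof.
move=> m00 c0 g0 C0 q0 H; apply/cvgryPge => A.
have [T T0 HT] := powR_large A C0 q0.
have Tg : 0 < T `^ g by exact: powR_gt0.
near=> m.
have mpos : 0 < m by near: m; exact: nbhs_right_gt.
have [|rho rho0 [h1 h2]] := H m mpos; first by near: m; exact: nbhs_right_lt.
apply: le_trans h2; apply: HT; rewrite leNgt; apply/negP => rT.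
have : rho `^ g < T `^ g by rewrite gt0_ltr_powR ?nnegrE ?ltW.
apply/negP; rewrite -leNgt; apply: le_trans h1; rewrite ler_pdivlMr// mulrC -ler_pdivlMr//.
by apply: ltW; near: m; apply: nbhs_right_lt; rewrite divr_gt0.
Unshelve. all: by end_near. Qed.

End asymptotics.

Section exponents.
Context {R : realType} (n : nat) (p : R).

Lemma supercritical_mass : mass_critical_exponent n.+1 < p -> 2 < p /\ 4 / (p - 2) < n.+1%:R.
Proof.
rewrite /mass_critical_exponent => h; have N0 : 0 < n.+1%:R :> R by [].
have q0 : 0 < 4 / n.+1%:R :> R by rewrite divr_gt0.
have p2 : 2 < p by move: (4 / _) h q0 => t; order_lra.
split => //; have pp : 0 < p - 2 by order_lra.
rewrite ltr_pdivrMr// mulrC -ltr_pdivrMr//; move: (4 / _) h => t; order_lra.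
Qed.

(** With $N=n+1$ this is $p<2^*$ cleared of its denominator; for $N\le2$ the left side is not
    positive. *)
Lemma subcritical_bound : 2 < p -> (p%:E < critical_exponent n.+1)%E -> (n%:R - 1) * (p - 2) < 4.
Proof.
move=> p2; rewrite /critical_exponent; case: ifPn => [n1 _|n1].
  have : n%:R <= 1 :> R by rewrite -[1]/(1%:R) ler_nat.
  by order_nra.
have n2 : 2 <= n%:R :> R by rewrite ler_nat; move: n1; rewrite -ltnNge.
rewrite lte_fin -[n.+1%:R]natr1 ltr_pdivlMr; last by order_lra.
by order_nra.
Qed.

End exponents.

Theorem theorem1p4 (R : realType) (N : nat) (p : R) (hN : (0 < N)%N)
    (hpc : mass_critical_exponent N < p)
    (hp : (p%:E < critical_exponent N)%E) :
  exists2 mu_ss : R, 0 < mu_ss &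
  exists (u_sc : R -> 'rV[R]_N -> R) (lambda_sc : R -> R),
    [/\ (forall mu : R, 0 < mu -> mu < mu_ss ->
          [/\ weak_solution p (lambda_sc mu) (u_sc mu),
              mass (u_sc mu) = mu
            & sign_changing (u_sc mu)]),
        energy p (u_sc mu) @[mu --> 0^'+] --> +oo
      & lambda_sc mu @[mu --> 0^'+] --> +oo].
Proof.
case: N hN hpc hp => // n _ hpc hp.
have [p2 sup] := supercritical_mass hpc; have sub := subcritical_bound p2 hp.
have [l0 [m0 [l00 [m00 Hm]]]] := radial_family p2 sub sup.
have pp0 : 0 < p by order_lra.
have pp2 : 0 < p - 2 by order_lra.
(* The area of the unit sphere, which converts radial integrals into integrals over the ball. *)
pose K := n.+1%:R * omega n : R; have K0 : 0 < K by rewrite mulr_gt0// omega_gt0.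
pose g := n.+1%:R - 4 / (p - 2); have g0 : 0 < g by rewrite subr_gt0.
pose th := 4 / (p - 2) + 2 - n.+1%:R.
have th0 : 0 < th.
  have : n%:R - 1 < 4 / (p - 2) by rewrite ltr_pdivlMr.
  by rewrite /th -[n.+1%:R]natr1; order_lra.
pose m1 : R := (1 / 4) ^+ n.+1 / (4 * n.+1%:R).
have m10 : 0 < m1 by rewrite divr_gt0 ?mulr_gt0 ?exprn_gt0//; order_lra.
pose kap := (n.+1%:R * (p - 2) - 4) / (4 * p) * ((1 / 2) `^ p * (1 / 4) ^+ n.+1 / n.+1%:R).
have kap0 : 0 < kap.
  rewrite mulr_gt0// divr_gt0 ?mulr_gt0 ?powR_gt0 ?exprn_gt0//; try by order_lra.
  by rewrite subr_gt0 -ltr_pdivrMr.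
have C0 : 0 < K * kap by rewrite mulr_gt0.
(* The quantitative bounds are recorded together with the solution before choosing, so that the
   limits hold for the chosen family. Outside the range of masses the pair is an arbitrary
   default. *)
have H mu : exists ul : ('rV[R]_n.+1 -> R) * R, 0 < mu < K * m0 ->
    [/\ weak_solution p ul.2 ul.1, mass ul.1 = mu & sign_changing ul.1] /\
    exists2 rho, 0 < rho & [/\ K * m1 / mu <= rho `^ g, K * kap * rho `^ th <= energy p ul.1 &
      l0 * rho `^ 2 <= ul.2].
  have [/andP[mu0 muK]|nmu] := boolP (0 < mu < K * m0); last by exists (fun=> 0, 0).
  have mk0 : 0 < mu / K by rewrite divr_gt0.
  have [|l [w [z [M [r1 [rho [/andP[l0l lp] [sol tz mi Hmass]]]]]]]] := Hm (mu / K) mk0.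
    by rewrite ltr_pdivrMr// mulrC.
  have l0' : 0 <= l by rewrite (le_trans (ltW l00)).
  have l01 : 0 <= l <= 1.
    by rewrite l0'/=; apply: ltW; apply: lt_le_trans lp _; rewrite ler_pdivrMr//; order_lra.
  have rho0 := r2_gt0 tz; have rho4 := rho_ge p2 l0' lp sol tz.
  have q0 : (0 : R) <= 1 / 4 by order_lra.
  exists (profile (scaled p w rho), l * rho ^+ 2) => _ /=; split.
    split; first exact: (scaled_weak_solution p2 sol tz).
      rewrite (scaled_mass p2 sol tz mi) Hmass; rewrite -/K; field; rewrite gt_eqF//.
    exact: (scaled_sign_changing sol tz).
  exists rho => //; split.
  - have M1 : m1 <= M rho.
      apply: le_trans (mass_integral_lower p2 l01 sol mi) _.
      exact: mass_integral_nondecr mi q0 rho4.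
    have -> : K * m1 / mu = m1 / (mu / K) by field; rewrite !gt_eqF.
    rewrite ler_pdivrMr// -Hmass powRN mulrA mulfV ?mul1r// gt_eqF// powR_gt0//.
  - rewrite -mulrA [kap * _]mulrC; exact: scaled_energy_lower p2 l0' lp sol tz sup.
  - by rewrite (@powR_mulrn _ _ 2) ?(ltW rho0)// ler_wpM2r// exprn_ge0// ltW.
have [ul Hul] := choice H.
have Km0 : 0 < K * m0 by rewrite mulr_gt0.
have Km1 : 0 < K * m1 by rewrite mulr_gt0.
exists (K * m0) => //; exists (fun mu => (ul mu).1), (fun mu => (ul mu).2); split.
- by move=> mu mu0 muK; have [|] := Hul mu; first by rewrite mu0.
- apply: (blow_up Km0 Km1 g0 C0 th0) => mu mu0 muK.
  have [|_ [rho rho0 [h1 h2 _]]] := Hul mu; first by rewrite mu0.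
  by exists rho.
- apply: (blow_up Km0 Km1 g0 l00 (ltr0Sn R 1)) => mu mu0 muK.
  have [|_ [rho rho0 [h1 _ h3]]] := Hul mu; first by rewrite mu0.
  by exists rho.
Qed.
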